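(* Assume that the following statement (Conjecture C) is true: for every even integer $k\ge4$, every prime $l>k+1$ and every positive squarefree integer $N$ with $l\nmid N$, the representation $\mathbf{1}\oplus\chi_l^{k-1}$ over $\overline{\mathbb{F}}_l$ arises from a newform of weight $k$, level $N$ and trivial Nebentypus if and only if at least one of the following holds: (1) $(p^k-1)(p^{k-2}-1)\equiv0\pmod l$ for every prime $p\mid N$ and there exists a prime $p_0\mid N$ with $p_0^k\equiv1\pmod l$; (2) $p^{k-2}\equiv1\pmod l$ for every prime $p\mid N$ and $l$ divides the numerator of $B_k/k$, where $B_k$ is the $k$-th Bernoulli number. Let $q$ be a fixed prime number. Then for every integer $r\ge2$ and every even integer $k\ge4$, $$d^{\mathrm{new}}_k(N)\gg_{k,q}\frac1r\log N\qquad\text{as }N\to\infty,\ N\in\mathcal{N}_r\text{ coprime to }q;$$ that is, for every even $k\ge4$ there is a constant $c>0$ depending only on $k$ and $q$ such that for every $r\ge2$ one has $d^{\mathrm{new}}_k(N)\ge \frac{c}{r}\log N$ for all sufficiently large $N\in\mathcal{N}_r$ coprime to $q$.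
   Context: For a normalized Hecke eigenform $f=\sum_{n\ge1}a_n(f)q^n$ in the new subspace $\mathcal{S}_k(\Gamma_0(N))^{\mathrm{new}}$ put $K_f=\mathbb{Q}(a_n(f):\gcd(n,N)=1)$, and let $d^{\mathrm{new}}_k(N)$ be the maximum of $[K_f:\mathbb{Q}]$ over all normalized Hecke eigenforms $f\in\mathcal{S}_k(\Gamma_0(N))^{\mathrm{new}}$. For an integer $r\geq 1$, $\mathcal{N}_r$ is the set of integers $N=p_1p_2\cdots p_r$ that are products of $r$ distinct primes $p_1,\dots,p_r$ such that the largest prime factor of $\gcd_{1\le i\le r}(p_i-1)$ is $>N^{1/(2r)}$ (i.e. there is a prime $l>N^{1/(2r)}$ dividing every $p_i-1$). ''Arises from'': let $\overline{\mathbb{Q}}$ be the algebraic closure of $\mathbb{Q}$ in $\mathbb{C}$, $\overline{\mathbb{Z}}$ its ring of integers; for a prime $l$ fix a place $w$ of $\overline{\mathbb{Q}}$ over $l$ and write $a\mapsto\widetilde{a}$ for reduction $\overline{\mathbb{Z}}\to\overline{\mathbb{F}}_l$ modulo $w$. For a cuspidal eigenform $f\in\mathcal{S}_k(\Gamma_1(N))$ ($k\ge2$; eigenform for all $T_p$, $p\nmid N$, with eigenvalues $a_p$) there are a Dirichlet character $\chi$ of modulus $N$ (the Nebentypus) and an odd semisimple continuous representation $\rho_f:\mathrm{Gal}(\overline{\mathbb{Q}}/\mathbb{Q})\to\mathrm{GL}_2(\overline{\mathbb{F}}_l)$, unique up to isomorphism, unramified outside $Nl$, with $\mathrm{tr}(\rho_f(\mathrm{Frob}_p))=\widetilde{a_p}$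 and $\det(\rho_f(\mathrm{Frob}_p))=\widetilde{\chi(p)}p^{k-1}$ for all primes $p\nmid Nl$; a representation $\rho$ arises from $f$ if $\rho\simeq\rho_f$. $\mathbf{1}$ is the trivial character and $\chi_l$ the mod $l$ cyclotomic character. A newform is a normalized Hecke eigenform in the new subspace. *)

(* Defs.v *)
From HB Require Import structures.
From mathcomp Require Import all_boot all_order all_algebra.
From mathcomp Require Import complex.
From mathcomp Require Import all_classical all_reals all_analysis.

Set Implicit Arguments.
Unset Strict Implicit.
Unset Printing Implicit Defensive.

Import Order.TTheory GRing.Theory Num.Theory.
Import numFieldNormedType.Exports.

Local Open Scope classical_set_scope.
Local Open Scope complex_scope.
Local Open Scope ring_scope.

HB.instance Definition _ (R : realType) := NormedModule.copy R[i] R[i]^o.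

(** ** Arithmetic *)

Definition squarefree (N : nat) : Prop :=
  forall p : nat, prime p -> ~~ (p ^ 2 %| N)%N.

(* [:: B_0; ...; B_n], from \sum_(j < m.+1) 'C(m.+1, j) B_j = 0 for m >= 1. *)
Fixpoint bernoulli_seq (n : nat) : seq rat :=
  if n is m.+1 then
    let s := bernoulli_seq m in
    rcons s (- (m.+2%:R)^-1 * \sum_(j < m.+1) 'C(m.+2, j)%:R * s`_j)
  else [:: 1].

Definition bernoulli (n : nat) : rat := (bernoulli_seq n)`_n.

Definition Nset (R : realType) (r N : nat) : Prop :=
  exists ps : seq nat,
    [/\ size ps = r, uniq ps, all prime ps, N = (\prod_(p <- ps) p)%N &
        (N%:R : R) `^ ((2 * r)%:R)^-1
          < (max_pdiv (\big[gcdn/0%N]_(p <- ps) p.-1))%:R].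

(** ** Cusp forms *)

(* Forms are functions on R[i]; only their values on the upper half-plane
   are ever used. *)
Definition upper_half (R : realType) : set R[i] := [set z | 0 < complex.Im z].

Definition SL2Z : set 'M[int]_2 := [set g | \det g = 1].

Definition Gamma0 (N : nat) : set 'M[int]_2 :=
  [set g | \det g = 1 /\ (N %| g 1%R 0%R)%Z].

Definition Gamma1 (N : nat) : set 'M[int]_2 :=
  [set g | [/\ \det g = 1, (N %| g 1%R 0%R)%Z,
              (g 0%R 0%R = 1 %[mod N])%Z & (g 1%R 1%R = 1 %[mod N])%Z]].

Definition slash (R : realType) (k : nat) (g : 'M[int]_2) (f : R[i] -> R[i])
    (z : R[i]) : R[i] :=
  let j := (g 1 0)%:~R * z + (g 1 1)%:~R in
  j ^- k * f (((g 0 0)%:~R * z + (g 0 1)%:~R) / j).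

Definition holomorphic (R : realType) (f : R[i] -> R[i]) : Prop :=
  forall z : R[i], upper_half z -> derivable f z 1.

Definition vanishes_at_infty (R : realType) (f : R[i] -> R[i]) : Prop :=
  forall e : R, 0 < e -> exists Y : R, forall z : R[i],
    upper_half z -> Y < complex.Im z -> `|f z| < e%:C.

Definition cusp_form (R : realType) (G : set 'M[int]_2) (k : nat)
    (f : R[i] -> R[i]) : Prop :=
  [/\ holomorphic f,
      forall g, G g -> forall z, upper_half z -> slash k g f z = f z &
      forall g, SL2Z g -> vanishes_at_infty (slash k g f)].

(* T_p for p not dividing the level, on forms with Nebentypus chi;
   the argument chip is the value chi(p). *)
Definition hecke (R : realType) (k : nat) (chip : R[i]) (p : nat)
    (f : R[i] -> R[i]) (z : R[i]) : R[i] :=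
  p%:R ^+ k.-1 * chip * f (p%:R * z)
  + p%:R^-1 * \sum_(j < p) f ((z + j%:R) / p%:R).

(** ** Petersson product and new subspace *)

Definition is_Gamma0_reps (N : nat) (s : seq 'M[int]_2) : Prop :=
  [/\ uniq s, forall a, a \in s -> SL2Z a &
      forall d, SL2Z d -> exists! a, a \in s /\
        exists2 g, Gamma0 N g & d = g *m a].

Definition Gamma0_reps (N : nat) : seq 'M[int]_2 :=
  xget [::] [set s | is_Gamma0_reps N s].

Definition std_domain (R : realType) : set (R * R) :=
  [set u | [/\ 0 < u.2, `|u.1| <= 2^-1 & 1 <= u.1 ^+ 2 + u.2 ^+ 2]].

Definition cRintegral (R : realType) (D : set (R * R)) (F : R * R -> R[i])
    : R[i] :=
  let mu := (@lebesgue_measure R \x @lebesgue_measure R)%E in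
  Rintegral mu D (fun u => complex.Re (F u))
  +i* Rintegral mu D (fun u => complex.Im (F u)).

(* Integral over Gamma0(N)\H against dx dy / y^2, without the factor
   normalizing the volume, which is irrelevant for orthogonality. *)
Definition petersson (R : realType) (N k : nat) (f g : R[i] -> R[i]) : R[i] :=
  \sum_(a <- Gamma0_reps N)
    cRintegral (@std_domain R) (fun u =>
      slash k a f (u.1 +i* u.2) * (slash k a g (u.1 +i* u.2))^*
      * (u.2 ^+ k / u.2 ^+ 2)%:C).

Definition oldform (R : realType) (N k : nat) (g : R[i] -> R[i]) : Prop :=
  exists (n : nat) (M d : 'I_n -> nat) (h : 'I_n -> R[i] -> R[i]),
    (forall i, [/\ (M i * d i %| N)%N, M i != N & cusp_form (Gamma0 (M i)) k (h i)])
    /\ forall z, upper_half z -> g z = \sum_(i < n) h i ((d i)%:R * z).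

Definition new_subspace (R : realType) (N k : nat) (f : R[i] -> R[i]) : Prop :=
  cusp_form (Gamma0 N) k f /\ forall g, oldform N k g -> petersson N k f g = 0.

(** ** Newforms and their coefficient fields *)

Definition e2pii (R : realType) (z : R[i]) : R[i] :=
  (expR (- 2 * pi * complex.Im z))%:C
  * (cos (2 * pi * complex.Re z) +i* sin (2 * pi * complex.Re z)).

Definition q_expansion (R : realType) (f : R[i] -> R[i]) (a : nat -> R[i])
    : Prop :=
  forall z, upper_half z ->
    (fun n => \sum_(1 <= m < n) a m * e2pii (m%:R * z)) @ \oo --> f z.

Definition newform_with_coefs (R : realType) (N k : nat) (f : R[i] -> R[i])
    (a : nat -> R[i]) : Prop :=
  [/\ new_subspace N k f,
      forall p, prime p -> ~~ (p %| N)%N -> exists c : R[i],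
        forall z, upper_half z -> hecke k 1 p f z = c * f z,
      q_expansion f a & a 1%N = 1].

Definition newform (R : realType) (N k : nat) (f : R[i] -> R[i]) : Prop :=
  exists a, newform_with_coefs N k f a.

Definition is_subfield (R : realType) (K : set R[i]) : Prop :=
  [/\ K 1, forall x y, K x -> K y -> K (x - y) &
      forall x y, K x -> K y -> K (x / y)].

Definition coef_field (R : realType) (N : nat) (a : nat -> R[i]) : set R[i] :=
  smallest (@is_subfield R) [set a n | n in [set n | (0 < n)%N && coprime n N]].

(* [K : Q], as the supremum of the sizes of Q-linearly independent families *)
Definition degree_over_Q (R : realType) (K : set R[i]) : \bar R :=
  ereal_sup [set (n%:R)%:E | n in [set n : nat |
    exists v : 'I_n -> R[i], (forall i, K (v i)) /\
      forall c : 'I_n -> rat,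
        \sum_(i < n) ratr (c i) * v i = 0 -> forall i, c i = 0]].

(* The maximum, as a supremum; it is -oo when there is no newform. *)
Definition dnew (R : realType) (k N : nat) : \bar R :=
  ereal_sup [set d | exists f a,
    newform_with_coefs N k f a /\ d = degree_over_Q (coef_field (R := R) N a)].

(** ** Algebraic numbers, algebraic integers, places *)

Definition algebraic_number (R : realType) : {pred R[i]} :=
  fun z => `[< algebraicOver (@ratr R[i]) z >].

Lemma algebraic_number_divring_closed (R : realType) :
  GRing.divring_closed (@algebraic_number R).
Proof.
split.
- by apply/asboolP; apply: algebraic1.
- move=> x y /asboolP hx /asboolP hy; apply/asboolP.
  exact: algebraic_sub.
- move=> x y /asboolP hx /asboolP hy; apply/asboolP.
  exact: algebraic_div.
Qed.

HB.instance Definition _ (R : realType) :=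
  GRing.isDivringClosed.Build R[i] (@algebraic_number R) (@algebraic_number_divring_closed R).

Record Qbar (R : realType) := MkQbar
  { Qbar_val :> R[i] ; Qbar_algebraic : Qbar_val \in @algebraic_number R }.

HB.instance Definition _ (R : realType) := [isSub for @Qbar_val R].
HB.instance Definition _ (R : realType) := [Choice of Qbar R by <:].
HB.instance Definition _ (R : realType) :=
  [SubChoice_isSubIntegralDomain of Qbar R by <:].
HB.instance Definition _ (R : realType) :=
  [SubIntegralDomain_isSubField of Qbar R by <:].

Definition integral_number (R : realType) : {pred Qbar R} :=
  fun z => `[< integralOver (intr : int -> Qbar R) z >].

Lemma integral_number_subring_closed (R : realType) :
  GRing.subring_closed (@integral_number R).
Proof.
split.
- by apply/asboolP; apply: integral1.
- move=> x y /asboolP hx /asboolP hy; apply/asboolP.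
  exact: integral_sub.
- move=> x y /asboolP hx /asboolP hy; apply/asboolP.
  exact: integral_mul.
Qed.

HB.instance Definition _ (R : realType) :=
  GRing.isSubringClosed.Build (Qbar R) (@integral_number R)
    (@integral_number_subring_closed R).

Record Zbar (R : realType) := MkZbar
  { Zbar_val :> Qbar R ; Zbar_integral : Zbar_val \in @integral_number R }.

HB.instance Definition _ (R : realType) := [isSub for @Zbar_val R].
HB.instance Definition _ (R : realType) := [Choice of Zbar R by <:].
HB.instance Definition _ (R : realType) :=
  [SubChoice_isSubComNzRing of Zbar R by <:].

(* A place of Qbar over p, given by the reduction map of Zbar onto its residue
   field; the latter is then an algebraic closure of F_p. *)
Record place (R : realType) (p : nat) := Place {
  residue : closedFieldType;
  reduction :> {rmorphism Zbar R -> residue};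
  reduction_surj : forall y, exists x, reduction x = y;
  residue_char : p \in [pchar residue]
}.

(** ** The absolute Galois group of Q and its mod l representations *)

Record GalQ (R : realType) := MkGalQ {
  gal_morph :> {rmorphism Qbar R -> Qbar R};
  gal_bij : bijective gal_morph
}.

Definition gal_one (R : realType) : GalQ R :=
  @MkGalQ R idfun (Bijective (fun _ => erefl) (fun _ => erefl)).

Definition gal_mul (R : realType) (s t : GalQ R) : GalQ R :=
  @MkGalQ R (s \o t) (bij_comp (gal_bij s) (gal_bij t)).

Definition inertia (R : realType) (p : nat) (v : place R p) : set (GalQ R) :=
  [set s : GalQ R | forall x y : Zbar R, Zbar_val y = s x -> v y = v x].

Definition frobenius (R : realType) (p : nat) (v : place R p) : set (GalQ R) :=
  [set s : GalQ R | forall x y : Zbar R, Zbar_val y = s x -> v y = v x ^+ p].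

Definition is_rep (R : realType) (F : fieldType) (rho : GalQ R -> 'M[F]_2)
    : Prop :=
  rho (gal_one R) = 1%:M
  /\ forall s t, rho (gal_mul s t) = rho s *m rho t.

(* Continuity for the Krull and discrete topologies: rho is trivial on
   Gal(Qbar/E) for a finitely generated extension E of Q in Qbar. *)
Definition rep_continuous (R : realType) (F : fieldType)
    (rho : GalQ R -> 'M[F]_2) : Prop :=
  exists E : seq (Qbar R), forall s : GalQ R,
    (forall x, x \in E -> s x = x) -> rho s = 1%:M.

(* rho acts on column vectors, so a subspace, given as a row space, is
   invariant when it is stable under the transposed matrices. *)
Definition invariant_subspace (R : realType) (F : fieldType)
    (rho : GalQ R -> 'M[F]_2) (V : 'M[F]_2) : Prop :=
  forall s, stablemx V (rho s)^T.

Definition rep_semisimple (R : realType) (F : fieldType)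
    (rho : GalQ R -> 'M[F]_2) : Prop :=
  forall V : 'M[F]_2, invariant_subspace rho V ->
  exists W : 'M[F]_2, [/\ invariant_subspace rho W,
    (V + W :=: 1%:M)%MS & mxdirect (V + W)%MS].

Definition rep_odd (R : realType) (F : fieldType) (rho : GalQ R -> 'M[F]_2)
    : Prop :=
  forall c : GalQ R, (forall x : Qbar R, Qbar_val (c x) = (Qbar_val x)^*) ->
    \det (rho c) = -1.

Definition unramified_at (R : realType) (F : fieldType)
    (rho : GalQ R -> 'M[F]_2) (p : nat) : Prop :=
  forall v : place R p, forall s, inertia v s -> rho s = 1%:M.

Definition rep_iso (R : realType) (F : fieldType)
    (rho1 rho2 : GalQ R -> 'M[F]_2) : Prop :=
  exists2 P : 'M[F]_2, P \in unitmx & forall s, P *m rho1 s = rho2 s *m P.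

(* The class mod l of the exponent m such that s acts as z |-> z^m on the
   l-th roots of unity. *)
Definition cyclotomic_char (R : realType) (F : fieldType) (l : nat)
    (s : GalQ R) : F :=
  (xget 0%N [set m : nat | (m < l)%N /\
     forall z : Qbar R, z ^+ l = 1 -> s z = z ^+ m])%:R.

Definition one_plus_cyclotomic (R : realType) (F : fieldType) (l n : nat)
    (s : GalQ R) : 'M[F]_2 :=
  diag_mx (\row_(j < 2) if j == 0 then 1 else cyclotomic_char F l s ^+ n).

(** ** Representations attached to eigenforms *)

Definition dirichlet_char (R : realType) (N : nat) (chi : int -> Zbar R)
    : Prop :=
  [/\ chi 1 = 1, forall m n, chi (m * n) = chi m * chi n,
      forall m n, (m = n %[mod N])%Z -> chi m = chi n &
      forall m, (chi m == 0) = ~~ coprimez m N].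

Definition nebentypus (R : realType) (N k : nat) (chi : int -> Zbar R)
    (f : R[i] -> R[i]) : Prop :=
  dirichlet_char N chi /\
  forall g, Gamma0 N g -> forall z, upper_half z ->
    slash k g f z = Qbar_val (chi (g 1 1)) * f z.

Definition hecke_eigenvalues (R : realType) (N k : nat) (chi : int -> Zbar R)
    (f : R[i] -> R[i]) (a : nat -> Zbar R) : Prop :=
  forall p, prime p -> ~~ (p %| N)%N -> forall z, upper_half z ->
    hecke k (Qbar_val (chi p%:Z)) p f z = Qbar_val (a p) * f z.

Definition attached_rep (R : realType) (l : nat) (w : place R l) (N k : nat)
    (chi : int -> Zbar R) (a : nat -> Zbar R)
    (rho : GalQ R -> 'M[residue w]_2) : Prop :=
  [/\ is_rep rho, rep_continuous rho, rep_semisimple rho, rep_odd rho &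
      forall p, prime p -> ~~ (p %| N * l)%N ->
        unramified_at rho p /\
        forall (v : place R p) (s : GalQ R), frobenius v s ->
          \tr (rho s) = w (a p) /\
          \det (rho s) = w (chi p%:Z) * p%:R ^+ k.-1].

Definition arises_from (R : realType) (l : nat) (w : place R l) (N k : nat)
    (rho : GalQ R -> 'M[residue w]_2) (f : R[i] -> R[i]) : Prop :=
  cusp_form (Gamma1 N) k f /\
  exists (chi : int -> Zbar R) (a : nat -> Zbar R)
         (rho_f : GalQ R -> 'M[residue w]_2),
    [/\ nebentypus N k chi f, hecke_eigenvalues N k chi f a,
        attached_rep N k chi a rho_f & rep_iso rho rho_f].

Definition conjectureC (R : realType) (w : forall l : nat, prime l -> place R l)
    : Prop :=
  forall (k l N : nat) (l_pr : prime l),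
    ~~ odd k -> (4 <= k)%N -> (k.+1 < l)%N ->
    (0 < N)%N -> squarefree N -> ~~ (l %| N)%N ->
    (exists2 f : R[i] -> R[i], newform N k f &
       arises_from N k
         (@one_plus_cyclotomic R (residue (w l l_pr)) l k.-1) f)
    <->
    ((forall p, prime p -> (p %| N)%N ->
        (l %| (p ^ k - 1) * (p ^ (k - 2) - 1))%N) /\
     (exists p0, [/\ prime p0, (p0 %| N)%N & p0 ^ k = 1 %[mod l]]))
    \/
    ((forall p, prime p -> (p %| N)%N -> p ^ (k - 2) = 1 %[mod l]) /\
     (l %| `|numq (bernoulli k / k%:R)|)%N).

(* Main.v *)
Require Import Defs.
From HB Require Import structures.
From mathcomp Require Import all_boot all_order all_algebra.
From mathcomp Require Import complex.
From mathcomp Require Import all_classical all_reals all_analysis.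
From mathcomp Require Import ring lra.

(** Let [l] be the largest prime dividing all the [p - 1], for the primes [p] that
    divide [N]. Condition (1) of the conjecture holds because every [p] is 1
    modulo [l], and it yields a newform [f] of weight [k] and level [N] with
    representation [1 + chi_l^(k-1)]. The trace of a Frobenius element at [q] then
    says that [a_q] is congruent to [m = 1 + q^(k-1)] modulo the place [w] over [l]
    ([exists_frobenius], [eigenvalue_congruence]). If [a_q] differs from [m], and if
    all the conjugates of [a_q] are bounded by a constant that depends on [k] and [q]
    only, then the norm of [a_q - m] from [Q(a_q)] is a nonzero integer, divisible by
    [l] and at most [A^d], where [d] is the degree of [a_q] ([degree_of_congruence]).
    Hence [d >= log l / log A], and [l > N^(1/(2r))] gives the theorem.

    That [a_q] is an algebraic integer with bounded conjugates follows, without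
    Deligne's theorem, from the cohomology of [SL2(Z)]. Put [n = k - 2]. Each [f|g],
    for [g] in [SL2(Z)], has an Eichler integral [F_g], a primitive of
    [f|g (z) (X - z)^n dz] with values in the polynomials of degree at most [n];
    requiring that [F_g(z)] tend to 0 at [X = z], [z -> i oo], makes it unique
    ([canonical]). The periods [F_g|h - F_gh] are constant polynomials in [z]. They
    form a cocycle that vanishes when [h] is a translation, so that everything is
    expressed through the periods at [h = S], which depend on [g] modulo [N] only.
    Uniqueness of [F_g] shows that the Hecke operator at [q] acts on the periods by
    words in [S] and [T] in which [N] does not occur ([exists_hecke_words],
    [hecke_period]). So [a_q] is an eigenvalue of an integer matrix, large but with
    row sums bounded in terms of [k] and [q] ([eigenvalue_integer_polynomial]), and
    all its conjugates obey the same bound. The eigenvector is not zero: if all the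
    periods vanished, [F_g(z)] at [X = z] would be modular of weight [-n], hence small
    near the real axis, and its Fourier coefficients would vanish
    ([exists_nonzero_period]).

    That [a_q] is not [m] follows from the same integrals. Moving [z] into a region
    [Im z >= 1/2] by translations and inversions contracts, so [F_1(z)] at [X = z] is
    bounded on the whole half-plane ([eichv_bounded]). Its coefficients are a constant
    times [a_j / j^(k-1)], and Bessel's inequality makes them square summable; but
    [a_q = 1 + q^(k-1)] would force [a_j >= j^(k-1)] for [j] a power of [q]
    ([eigenvalue_not_eisenstein]). *)

Set Implicit Arguments.
Unset Strict Implicit.
Unset Printing Implicit Defensive.
Import Order.TTheory GRing.Theory Num.Theory.
Import numFieldNormedType.Exports.
Local Open Scope classical_set_scope.
Local Open Scope complex_scope.
Local Open Scope ring_scope.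

(** * Extension of isomorphisms between fields *)

Section PartialIsomorphisms.
Variable K : fieldType.
Implicit Types (G : set (K * K)) (p m : {poly K}).

(** The graph of an isomorphism between two subrings of [K]. As a set of pairs it
    treats source and target alike, so that totality and surjectivity of a maximal
    one are the same statement up to [swap]. *)
Definition partial_iso G : Prop :=
  [/\ G (1, 1),
      forall a b c d, G (a, b) -> G (c, d) -> G (a - c, b - d),
      forall a b c d, G (a, b) -> G (c, d) -> G (a * c, b * d) &
      forall a b, G (a, b) -> (a == 0) = (b == 0)].

Definition inv_closed G := forall a b, G (a, b) -> G (a^-1, b^-1).

Definition swap G : set (K * K) := [set u | G (u.2, u.1)].

Definition poly_over_graph G p1 p2 : Prop := forall i, G (p1`_i, p2`_i).

Lemma partial_iso_swap G : partial_iso G -> partial_iso (swap G).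
Proof.
case=> h1 hB hM h0; split=> //= [a b c d|a b c d|a b].
- exact: hB.
- exact: hM.
- by move/h0.
Qed.

Section Closure.
Variables (G : set (K * K)) (isoG : partial_iso G).

Lemma piso0 : G (0, 0).
Proof. by case: isoG => h1 hB _ _; have := hB _ _ _ _ h1 h1; rewrite !subrr. Qed.

Lemma pisoB a b c d : G (a, b) -> G (c, d) -> G (a - c, b - d).
Proof. by case: isoG => _ hB _ _; apply: hB. Qed.

Lemma pisoN a b : G (a, b) -> G (- a, - b).
Proof. by move=> h; have := pisoB piso0 h; rewrite !sub0r. Qed.

Lemma pisoD a b c d : G (a, b) -> G (c, d) -> G (a + c, b + d).
Proof. by move=> h /pisoN h'; have := pisoB h h'; rewrite !opprK. Qed.

Lemma pisoM a b c d : G (a, b) -> G (c, d) -> G (a * c, b * d).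
Proof. by case: isoG => _ _ hM _; apply: hM. Qed.

Lemma piso_sum I (r : seq I) (F1 F2 : I -> K) :
  (forall i, G (F1 i, F2 i)) -> G (\sum_(i <- r) F1 i, \sum_(i <- r) F2 i).
Proof.
move=> h; elim: r => [|i r IH]; first by rewrite !big_nil; exact: piso0.
by rewrite !big_cons; apply: pisoD.
Qed.

Lemma piso_eq0 a b : G (a, b) -> (a == 0) = (b == 0).
Proof. by case: isoG => _ _ _; apply. Qed.

Lemma piso_int (z : int) : G (z%:~R, z%:~R).
Proof.
have nat_G (n : nat) : G (n%:R, n%:R).
  elim: n => [|n IH]; first exact: piso0.
  by rewrite -natr1; apply: pisoD => //; case: isoG.
case: z => n; first exact: nat_G.
by rewrite NegzE !mulrNz; apply: pisoN; exact: nat_G.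
Qed.

Lemma pogC a b : G (a, b) -> poly_over_graph G a%:P b%:P.
Proof. by move=> h i; rewrite !coefC; case: eqP => // _; exact: piso0. Qed.

Lemma pogX : poly_over_graph G 'X 'X.
Proof.
by move=> i; rewrite coefX; case: eqP => _; [case: isoG | exact: piso0].
Qed.

Lemma pogB p1 p2 q1 q2 : poly_over_graph G p1 p2 -> poly_over_graph G q1 q2 ->
  poly_over_graph G (p1 - q1) (p2 - q2).
Proof. by move=> hp hq i; rewrite !coefB; apply: pisoB. Qed.

Lemma pogD p1 p2 q1 q2 : poly_over_graph G p1 p2 -> poly_over_graph G q1 q2 ->
  poly_over_graph G (p1 + q1) (p2 + q2).
Proof. by move=> hp hq i; rewrite !coefD; apply: pisoD. Qed.

Lemma pogM p1 p2 q1 q2 : poly_over_graph G p1 p2 -> poly_over_graph G q1 q2 ->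
  poly_over_graph G (p1 * q1) (p2 * q2).
Proof.
by move=> hp hq i; rewrite !coefM; apply: piso_sum => j; apply: pisoM.
Qed.

Lemma pog_size p1 p2 : poly_over_graph G p1 p2 -> size p1 = size p2.
Proof.
move=> h; apply/eqP; rewrite eqn_leq; apply/andP.
split; apply/leq_sizeP => j hj; apply/eqP.
  by rewrite (piso_eq0 (h j)) nth_default.
by rewrite -(piso_eq0 (h j)) nth_default.
Qed.

Lemma pog_lead p1 p2 :
  poly_over_graph G p1 p2 -> G (lead_coef p1, lead_coef p2).
Proof. by move=> h; rewrite !lead_coefE (pog_size h); apply: h. Qed.

Lemma pog_eq0 p1 p2 : poly_over_graph G p1 p2 -> (p1 == 0) = (p2 == 0).
Proof. by move=> /pog_size h; rewrite -!size_poly_eq0 h. Qed.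

Hypothesis invG : inv_closed G.

(** Euclidean division on both sides at once: the quotients correspond because the
    inverses of leading coefficients do. *)
Lemma pog_divmod p1 p2 m1 m2 : poly_over_graph G p1 p2 ->
  poly_over_graph G m1 m2 -> m1 != 0 ->
  exists q1 q2 r1 r2, [/\ poly_over_graph G q1 q2, poly_over_graph G r1 r2,
    p1 = q1 * m1 + r1, p2 = q2 * m2 + r2 & (size r1 < size m1)%N].
Proof.
move=> hp hm m1n0; have [n] := ubnP (size p1).
elim: n p1 p2 hp => // n IH p1 p2 hp lt_n.
have [lt|le] := ltnP (size p1) (size m1).
  exists 0, 0, p1, p2; split; rewrite ?mul0r ?add0r //.
  by apply: pogC; exact: piso0.
have p1n0 : p1 != 0.
  by rewrite -size_poly_gt0 (leq_trans _ le) // size_poly_gt0.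
have m2n0 : m2 != 0 by rewrite -(pog_eq0 hm).
have p2n0 : p2 != 0 by rewrite -(pog_eq0 hp).
pose c1 := lead_coef p1 * (lead_coef m1)^-1.
pose c2 := lead_coef p2 * (lead_coef m2)^-1.
have hc : G (c1, c2).
  by apply: pisoM; [apply: pog_lead | apply: invG; apply: pog_lead].
pose k := (size p1 - size m1)%N.
pose t1 : {poly K} := c1%:P * 'X^k; pose t2 : {poly K} := c2%:P * 'X^k.
have ht : poly_over_graph G t1 t2.
  move=> i; rewrite !coefCM !coefXn; apply: pisoM => //.
  by case: eqP => _; [case: isoG | exact: piso0].
have hp' := pogB hp (pogM ht hm).
have lt' : (size (p1 - t1 * m1)%R < n)%N.
  rewrite ltnS in lt_n; apply: leq_trans lt_n.
  have sz : size (t1 * m1) = size p1.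
    have c1n0 : c1 != 0 by rewrite mulf_neq0 ?invr_eq0 ?lead_coef_eq0.
    rewrite /t1 -mulrA size_Cmul // mulrC size_mulXn // /k.
    by rewrite subnK.
  have lc : lead_coef (t1 * m1) = lead_coef p1.
    rewrite !lead_coefM lead_coefC lead_coefXn mulr1 /c1 mulfVK //.
    by rewrite lead_coef_eq0.
  have le1 : (size (p1 - t1 * m1)%R <= size p1)%N.
    by rewrite (leq_trans (size_polyD _ _)) // size_polyN sz maxnn.
  rewrite ltn_neqAle le1 andbT; apply/negP => /eqP eqs.
  have := lead_coefE (p1 - t1 * m1); rewrite eqs coefB -lead_coefE.
  rewrite -sz -lead_coefE lc subrr => /eqP; rewrite lead_coef_eq0.
  rewrite -size_poly_eq0 eqs size_poly_eq0; exact/negP.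
have [q1 [q2 [r1 [r2 [hq hr e1 e2 hs]]]]] := IH _ _ hp' lt'.
exists (q1 + t1), (q2 + t2), r1, r2; split => //.
- exact: pogD.
- by rewrite mulrDl addrAC -e1 subrK.
- by rewrite mulrDl addrAC -e2 subrK.
Qed.

Definition adjoin x y : set (K * K) :=
  [set u | exists p1 p2, [/\ poly_over_graph G p1 p2, u.1 = p1.[x] & u.2 = p2.[y]]].

Definition minimal_over m1 m2 x : Prop :=
  [/\ poly_over_graph G m1 m2, m1 != 0, root m1 x &
      forall p1 p2, poly_over_graph G p1 p2 -> root p1 x ->
        (size p1 < size m1)%N -> p1 = 0].

Lemma sub_adjoin x y : G `<=` adjoin x y.
Proof.
by move=> [a b] h; exists a%:P, b%:P; split; [exact: pogC | rewrite hornerC..].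
Qed.

Lemma adjoin_gen x y : adjoin x y (x, y).
Proof. by exists 'X, 'X; split; [exact: pogX | rewrite hornerX..]. Qed.

(** Both kernels of evaluation are generated by the minimal polynomial: for
    [y] because a shorter relation would factor the one of [x]. *)
Lemma partial_iso_adjoin m1 m2 x y :
  minimal_over m1 m2 x -> root m2 y -> partial_iso (adjoin x y).
Proof.
case=> hm m1n0 rm1 mmin rm2; split.
- by apply: sub_adjoin; case: isoG.
- move=> a b c d [p1 [p2 [hp /= -> ->]]] [q1 [q2 [hq /= -> ->]]].
  by exists (p1 - q1), (p2 - q2); split; rewrite ?hornerD ?hornerN //; apply: pogB.
- move=> a b c d [p1 [p2 [hp /= -> ->]]] [q1 [q2 [hq /= -> ->]]].
  by exists (p1 * q1), (p2 * q2); split; rewrite ?hornerM //; apply: pogM.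
move=> a b [p1 [p2 [hp /= -> ->]]].
have [q1 [q2 [r1 [r2 [hq hr -> -> hs]]]]] := pog_divmod hp hm m1n0.
rewrite !hornerD !hornerM (rootP rm1) (rootP rm2) !mulr0 !add0r.
apply/eqP/eqP => [e|e].
  have r10 : r1 = 0 by apply: mmin hr _ hs; apply/rootP.
  have := pog_eq0 hr; rewrite r10 eqxx => /esym /eqP ->; exact: horner0.
have [->|r1n0] := eqVneq r1 0; first by rewrite horner0.
pose Q n := `[< exists s1 s2, [/\ poly_over_graph G s1 s2, s1 != 0,
                 root s2 y & size s1 = n] >].
have exQ : exists n, Q n.
  by exists (size r1); apply/asboolP; exists r1, r2; split => //; apply/rootP.
case: (ex_minnP exQ) => d /asboolP [s1 [s2 [hsG s1n0 rs2 sd]]] dmin.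
have led : (d <= size r1)%N.
  by apply: dmin; apply/asboolP; exists r1, r2; split => //; apply/rootP.
have [t1 [t2 [u1 [u2 [ht hu e1 e2 hlt]]]]] := pog_divmod hm hsG s1n0.
have u10 : u1 = 0.
  apply/eqP; apply: contraT => u1n0.
  have : (d <= size u1)%N.
    apply: dmin; apply/asboolP; exists u1, u2; split => //.
    have := rm2; rewrite e2 /root hornerD hornerM (rootP rs2) mulr0 add0r.
    by [].
  by rewrite leqNgt -sd hlt.
have s2n0 : s2 != 0 by rewrite -(pog_eq0 hsG).
have d2 : (1 < size s1)%N.
  rewrite (pog_size hsG) ltn_neqAle size_poly_gt0 s2n0 andbT eq_sym.
  by apply: contraL rs2 => /size_poly1P [c cn0 ->]; rewrite rootC.
have em : m1 = t1 * s1 by rewrite e1 u10 addr0.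
have t1n0 : t1 != 0 by apply: contraNneq m1n0 => h; rewrite em h mul0r.
have := rm1; rewrite em rootM => /orP [rt|rs].
  have t0 : t1 = 0.
    apply: (mmin _ _ ht rt); rewrite em size_mul //.
    case: (size s1) d2 => [|[|k]] // _; rewrite !addnS /= ltnS leq_addr //.
  by rewrite t0 eqxx in t1n0.
have s0 : s1 = 0.
  by apply: (mmin _ _ hsG rs); rewrite sd (leq_ltn_trans led).
by rewrite s0 eqxx in s1n0.
Qed.

Lemma exists_minimal_over p1 p2 x : poly_over_graph G p1 p2 -> p1 != 0 ->
  root p1 x -> exists m1 m2, minimal_over m1 m2 x.
Proof.
move=> hp p1n0 rp.
pose Q n := `[< exists s1 s2, [/\ poly_over_graph G s1 s2, s1 != 0,
                 root s1 x & size s1 = n] >].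
have exQ : exists n, Q n.
  by exists (size p1); apply/asboolP; exists p1, p2; split.
case: (ex_minnP exQ) => d /asboolP [m1 [m2 [hm m1n0 rm sd]]] dmin.
exists m1, m2; split => // q1 q2 hq rq lt; apply/eqP; apply: contraT => q1n0.
have : (d <= size q1)%N by apply: dmin; apply/asboolP; exists q1, q2; split.
by rewrite leqNgt -sd lt.
Qed.

End Closure.

Definition fractions G : set (K * K) :=
  [set u | exists a b c d, [/\ G (a, b), G (c, d), c != 0, u.1 = a / c & u.2 = b / d]].

(** A maximal partial isomorphism is therefore closed under inverses, as
    [pog_divmod] requires. *)
Lemma partial_iso_fractions G : partial_iso G ->
  [/\ partial_iso (fractions G), inv_closed (fractions G) & G `<=` fractions G].
Proof.
move=> isoG; have h1 : G (1, 1) by case: isoG.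
have sub : G `<=` fractions G.
  by move=> [a b] h; exists a, b, 1, 1; split; rewrite ?oner_eq0 ?divr1.
split => //; first split.
- exact: sub.
- move=> _ _ _ _ [a [b [c [d [h h' c0 /= -> ->]]]]] [a' [b' [c' [d' [k k' c0' /= -> ->]]]]].
  have d0 : d != 0 by rewrite -(piso_eq0 isoG h').
  have d0' : d' != 0 by rewrite -(piso_eq0 isoG k').
  exists (a * c' - a' * c), (b * d' - b' * d), (c * c'), (d * d').
  split; rewrite ?mulf_neq0 //=; try by field; apply/andP.
    by apply: (pisoB isoG); apply: (pisoM isoG).
  exact: (pisoM isoG).
- move=> _ _ _ _ [a [b [c [d [h h' c0 /= -> ->]]]]] [a' [b' [c' [d' [k k' c0' /= -> ->]]]]].
  exists (a * a'), (b * b'), (c * c'), (d * d').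
  split; rewrite ?mulf_neq0 ?mulf_div //=; exact: (pisoM isoG).
- move=> _ _ [a [b [c [d [h h' c0 /= -> ->]]]]].
  by rewrite !mulf_eq0 !invr_eq0 (piso_eq0 isoG h) (piso_eq0 isoG h').
move=> _ _ [a [b [c [d [h h' c0 /= -> ->]]]]].
have [a0|a0] := eqVneq a 0.
  exists 0, 0, 1, 1; split; rewrite ?oner_eq0 //; first exact: piso0.
    by rewrite a0 /= !mul0r invr0.
  have : b == 0 by rewrite -(piso_eq0 isoG h) a0.
  by move/eqP => -> /=; rewrite !mul0r invr0.
by exists c, d, a, b; split; rewrite /= ?invf_div.
Qed.

Hypothesis closedK : forall p, size p != 1%N -> exists x, root p x.

Definition maximal_iso G :=
  partial_iso G /\ forall G', partial_iso G' -> G `<=` G' -> G' `<=` G.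

(** Otherwise a root of the transported minimal polynomial of [x] would serve as
    image of [x] in a larger partial isomorphism. *)
Lemma maximal_iso_total G x : maximal_iso G ->
  (exists p : {poly int}, map_poly intr p != 0 :> {poly K} /\ root (map_poly intr p) x) ->
  exists y, G (x, y).
Proof.
move=> [isoG maxG] [p [pn0 rp]].
have [isoF invF subF] := partial_iso_fractions isoG.
have invG : inv_closed G.
  by move=> a b /subF /invF; apply: (maxG _ isoF).
have hp : poly_over_graph G (map_poly intr p) (map_poly intr p).
  by move=> i; rewrite coef_map /=; exact: piso_int.
have [m1 [m2 mm]] := exists_minimal_over hp pn0 rp.
have [hm m1n0 rm _] := mm.
have : size m2 != 1%N.
  rewrite -(pog_size isoG hm); apply: contraL rm => /size_poly1P [c cn0 ->].
  by rewrite rootC.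
move=> /closedK [y ry]; exists y.
apply: (maxG _ (partial_iso_adjoin isoG invG mm ry)); last exact: adjoin_gen.
exact: sub_adjoin.
Qed.

Lemma maximal_iso_swap G : maximal_iso G -> maximal_iso (swap G).
Proof.
move=> [isoG maxG]; split; first exact: partial_iso_swap.
move=> G' isoG' sub [a b] h; apply: (maxG (swap G')) => //=.
  exact: partial_iso_swap.
by move=> [c d] h'; apply: sub.
Qed.

(** Zorn's lemma, for the sets whose union with [G0] is a partial isomorphism: in this
    form the empty chain is harmless. *)
Lemma extend_maximal_iso G0 : partial_iso G0 ->
  exists2 G, maximal_iso G & G0 `<=` G.
Proof.
move=> iso0; pose P G := partial_iso (G `|` G0).
have [|A [PA maxA]] := @Zorn_bigcup _ P.
  move=> F FP tot.
  have two u v : (\bigcup_(X in F) X `|` G0) u -> (\bigcup_(X in F) X `|` G0) v ->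
      exists H, [/\ partial_iso H, H u, H v & H `<=` \bigcup_(X in F) X `|` G0].
    have subF X : F X -> X `|` G0 `<=` \bigcup_(X in F) X `|` G0.
      by move=> FX w [Xw|]; [left; exists X | right].
    case=> [[X FX Xu]|Gu] [[Y FY Yv]|Gv].
    - case: (tot X Y FX FY) => XY.
        by exists (Y `|` G0); split; [exact: FP|left; apply: XY|left|apply: subF].
      by exists (X `|` G0); split; [exact: FP|left|left; apply: XY|apply: subF].
    - by exists (X `|` G0); split; [exact: FP|left|right|apply: subF].
    - by exists (Y `|` G0); split; [exact: FP|right|left|apply: subF].
    - by exists G0; split=> // w Gw; right.
  split.
  - by right; case: iso0.
  - move=> a b c d /two h /h [H [isoH Hu Hv sub]]; apply: sub; exact: pisoB.
  - move=> a b c d /two h /h [H [isoH Hu Hv sub]]; apply: sub; exact: pisoM.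
  - move=> a b hab; have [H [isoH Hu _ _]] := two _ _ hab hab.
    exact: (piso_eq0 isoH).
exists (A `|` G0); last by move=> u; right.
split=> // G' isoG' sub u G'u; apply: contrapT => nAu.
apply: (maxA G'); last first.
  by rewrite /P setUidl // => w Gw; apply: sub; right.
split; first by move=> w Aw; apply: sub; left.
by move=> h; apply: nAu; left; apply: h.
Qed.

End PartialIsomorphisms.

(** * Automorphisms of the algebraic numbers *)

Section QbarGalois.
Variable R : realType.
Local Notation QQ := (Qbar R).

Lemma Qbar_closed (p : {poly QQ}) : size p != 1%N -> exists x, root p x.
Proof.
have [->|pn0 sp] := eqVneq p 0; first by exists 0; rewrite root0.
pose v : {rmorphism QQ -> R[i]} := \val.
have sp' : size (map_poly v p) != 1%N by rewrite size_map_poly.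
have /closed_rootP [x rx] := sp'.
have pn0' : map_poly v p != 0 by rewrite map_poly_eq0.
have xalg : x \in @algebraic_number R.
  apply/asboolP/integral_algebraic.
  apply: (integral_root pn0' rx); apply/integral_poly => i.
  rewrite coef_map; apply/integral_algebraic.
  by have /asboolP := Qbar_algebraic p`_i.
exists (MkQbar xalg); rewrite -(fmorph_root v); exact: rx.
Qed.

Lemma Qbar_int_poly (x : QQ) :
  exists p : {poly int}, map_poly intr p != 0 :> {poly QQ} /\ root (map_poly intr p) x.
Proof.
pose v : {rmorphism QQ -> R[i]} := \val.
have /asboolP [p pn0 rp] := Qbar_algebraic x.
have [q [a an0 e]] := rat_poly_scale p.
have inj : injective (intr : int -> QQ).
  by move=> m n h; have /(congr1 v) := h; rewrite !rmorph_int => /intr_inj.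
exists q; split.
  apply: contra_neq pn0 => q0; rewrite e.
  suff -> : q = 0 by rewrite rmorph0 scaler0.
  apply/polyP => i; apply: inj; rewrite coef0.
  by have := congr1 (fun u : {poly QQ} => u`_i) q0; rewrite coef_map coef0.
rewrite -(fmorph_root v) -map_poly_comp.
have -> : map_poly (v \o intr) q = map_poly (@ratr R[i]) (map_poly intr q).
  rewrite -map_poly_comp; apply: eq_map_poly => m.
  have -> : (v \o intr) m = v (m%:~R) by [].
  have -> : (ratr \o intr) m = ratr (m%:~R : rat) :> R[i] by [].
  by rewrite rmorph_int rmorph_int.
have := rp; rewrite e linearZ /= rootE hornerZ mulf_eq0 fmorph_eq0 invr_eq0 intr_eq0.
by rewrite (negbTE an0).
Qed.

Lemma gal_extends (G0 : set (QQ * QQ)) : partial_iso G0 ->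
  exists s : GalQ R, forall a b, G0 (a, b) -> s a = b.
Proof.
move=> iso0; have [G [isoG maxG] sub] := extend_maximal_iso iso0.
have mG : maximal_iso G by [].
have tot x : exists y, G (x, y).
  exact: (maximal_iso_total Qbar_closed mG (Qbar_int_poly x)).
have surj y : exists x, G (x, y).
  exact: (maximal_iso_total Qbar_closed (maximal_iso_swap mG) (Qbar_int_poly y)).
have fn a b b' : G (a, b) -> G (a, b') -> b = b'.
  move=> h h'; have := piso_eq0 isoG (pisoB isoG h h').
  by rewrite subrr eqxx => /esym; rewrite subr_eq0 => /eqP.
have inj a a' b : G (a, b) -> G (a', b) -> a = a'.
  move=> h h'; have := piso_eq0 isoG (pisoB isoG h h').
  by rewrite subrr eqxx subr_eq0 => /eqP.
pose f x := projT1 (cid (tot x)).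
have fP x : G (x, f x) by rewrite /f; case: cid.
have fB : zmod_morphism f.
  by move=> x y; apply: (fn (x - y)) => //; apply: pisoB.
have fM : monoid_morphism f.
  split; first by apply: (fn 1) => //; case: isoG.
  by move=> x y; apply: (fn (x * y)) => //; apply: pisoM.
have fbij : bijective f.
  pose g y := projT1 (cid (surj y)).
  have gP y : G (g y, y) by rewrite /g; case: cid.
  by exists g => x; [apply: (inj _ _ (f x)) | apply: (fn (g x))].
pose F : {rmorphism QQ -> QQ} := HB.pack f
  (GRing.isZmodMorphism.Build QQ QQ f fB) (GRing.isMonoidMorphism.Build QQ QQ f fM).
exists (@MkGalQ R F fbij) => a b /sub h; exact: (fn a).
Qed.

(** Every root of the minimal polynomial of [z] over the rationals is the image of
    [z] under some automorphism, hence equal to [z]. So this polynomial is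
    [c (X - z)^d], and its two leading coefficients determine [z]. *)
Lemma gal_fixed_rational (z : QQ) :
  (forall s : GalQ R, s z = z) -> exists r : rat, Qbar_val z = ratr r.
Proof.
move=> fixz.
pose v : {rmorphism QQ -> R[i]} := \val.
pose G : set (QQ * QQ) := [set u | u.1 = u.2 /\ exists r : rat, v u.1 = ratr r].
have isoG : partial_iso G.
  split.
  - by split=> //; exists 1; rewrite !rmorph1.
  - move=> a b c d [/= <- [r er]] [/= <- [r' er']]; split=> //; exists (r - r') => /=.
    by rewrite !rmorphB er er'.
  - move=> a b c d [/= <- [r er]] [/= <- [r' er']]; split=> //; exists (r * r') => /=.
    by rewrite !rmorphM er er'.
  - by move=> a b [/= ->].
have invG : inv_closed G.
  by move=> a b [/= <- [r e]]; split=> //; exists r^-1; rewrite /= !fmorphV e.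
have [p [pn0 rp]] := Qbar_int_poly z.
have hp : poly_over_graph G (map_poly intr p) (map_poly intr p).
  by move=> i; rewrite coef_map /=; exact: piso_int.
have [m1 [m2 mm]] := exists_minimal_over hp pn0 rp.
have [hm m1n0 rm _] := mm.
have em : m1 = m2.
  by apply/polyP => i; have [/= ->] := hm i.
have only y : root m1 y -> y = z.
  rewrite em => ry; have [s sP] := gal_extends (partial_iso_adjoin isoG invG mm ry).
  by rewrite -(sP _ _ (adjoin_gen isoG z y)) fixz.
have [d [u nru e]] := multiplicity_XsubC m1 z.
rewrite m1n0 /= in nru.
have /size_poly1P [c cn0 eu] : size u == 1%N.
  apply: contraT => /Qbar_closed [y ry].
  have yz : y = z by apply: only; rewrite e rootM ry.
  by rewrite -yz ry in nru.
have prodE : ('X - z%:P) ^+ d = \prod_(x <- nseq d z) ('X - x%:P) :> {poly QQ}.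
  by rewrite big_nseq -Monoid.iteropE.
have dn0 : (0 < d)%N.
  by case: d e {prodE} => // e; move: rm; rewrite e eu expr0 mulr1 rootC (negbTE cn0).
have [_ [r1 /= h1]] := hm d; have [_ [r2 /= h2]] := hm d.-1.
have c1 : m1`_d = c.
  rewrite e eu coefCM.
  have := lead_coefE (('X - z%:P) ^+ d).
  rewrite (monicP (monic_exp d (monicXsubC z))) size_exp_XsubC /= => <-.
  by rewrite mulr1.
have c2 : m1`_d.-1 = - (c * (z *+ d)).
  have := @coefPn_prod_XsubC QQ (nseq d z).
  rewrite size_nseq -lt0n => /(_ dn0); rewrite -prodE big_nseq iter_addr_0 => cP.
  by rewrite e eu coefCM cP mulrN.
have d0 : d%:R != 0 :> QQ.
  rewrite -(fmorph_eq0 (\val : {rmorphism QQ -> R[i]})) rmorph_nat pnatr_eq0.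
  by rewrite -lt0n.
have -> : z = - (m1`_d.-1 / m1`_d / d%:R).
  by rewrite c1 c2 -mulr_natr; field; rewrite d0 cn0.
exists (- (r2 / r1 / d%:R)).
change (v (- (m1`_d.-1 / m1`_d / d%:R)) = ratr (- (r2 / r1 / d%:R))).
have h1' : v m1`_d = ratr r1 by exact: h1.
have h2' : v m1`_d.-1 = ratr r2 by exact: h2.
rewrite rmorphN !fmorph_div h1' h2' rmorphN !fmorph_div.
by rewrite !rmorph_nat.
Qed.

End QbarGalois.

(** Gauss's lemma: the primitive part of [d] divides [P], so its leading coefficient
    is a unit. *)
Lemma monic_rat_dvd_int (d : {poly rat}) (P : {poly int}) :
  d \is monic -> P \is monic -> d %| map_poly intr P ->
  exists2 D : {poly int}, D \is monic & d = map_poly intr D.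
Proof.
move=> dmon Pmon dvd.
have [D0 [a an0 e]] := rat_poly_scale d.
set Z := zprimitive D0.
have e' : d = ((zcontents D0)%:~R / a%:~R) *: map_poly intr Z.
  by rewrite e {1}[D0]zpolyEprim linearZ /= scalerA mulrC.
have [c0 Z0] : (zcontents D0)%:~R / a%:~R != 0 :> rat /\ Z != 0.
  have := monic_neq0 dmon; rewrite e' scaler_eq0 negb_or => /andP[-> h]; split=> //.
  by apply: contraNneq h => ->; rewrite rmorph0.
move: e'; set c := _ / _ in c0 *; move=> e'.
have : Z %| P by rewrite -dvdp_rat_int (dvdp_trans _ dvd) // e' dvdpZr.
move=> /dvdpP_int [r]; rewrite zprimitive_id => eP.
have := monicP Pmon; rewrite eP lead_coefM => lcu.
have lc2 : lead_coef Z * lead_coef Z = 1.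
  have : lead_coef Z \is a GRing.unit by apply/unitrPr; exists (lead_coef r).
  by case/orP => /eqP ->.
exists (lead_coef Z *: Z).
  by rewrite monicE lead_coefZ lc2.
have := monicP dmon; rewrite e' lead_coefZ.
rewrite lead_coef_map_inj ?rmorph0 //; last exact: intr_inj.
move=> clc; rewrite linearZ /=; congr (_ *: _).
apply: (mulIf (x := (lead_coef Z)%:~R)).
  by rewrite intr_eq0 lead_coef_eq0.
by rewrite clc -intrM lc2.
Qed.

Lemma poly_roots_list (K : fieldType) (p : {poly K}) : p != 0 ->
  exists rs : seq K, forall y, root p y -> y \in rs.
Proof.
have [n] := ubnP (size p); elim: n p => // n IH p lt pn0.
have [[z rz]|no] := pselect (exists z, root p z); last first.
  by exists [::] => y ry; case: no; exists y.
have [q e] := factor_theorem p z rz.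
have qn0 : q != 0 by apply: contraNneq pn0 => q0; rewrite e q0 mul0r.
have [|rs hrs] := IH q _ qn0.
  by move: lt; rewrite e size_mul ?polyXsubC_eq0 // size_XsubC addn2 /= ltnS.
exists (z :: rs) => y; rewrite e rootM root_XsubC inE => /orP[/hrs -> |->] //.
by rewrite orbT.
Qed.

(** * Frobenius elements *)

Section Frobenius.
Variable R : realType.
Local Notation QQ := (Qbar R).
Local Notation ZZ := (Zbar R).

Lemma gal_orbit (x : QQ) : exists ys : seq QQ, forall s : GalQ R, s x \in ys.
Proof.
have [p [pn0 rp]] := Qbar_int_poly x.
have [ys hys] := poly_roots_list pn0; exists ys => s; apply: hys.
have -> : map_poly intr p = map_poly s (map_poly intr p) :> {poly QQ}.
  by rewrite -map_poly_comp; apply: eq_map_poly => m /=; rewrite rmorph_int.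
exact: rmorph_root.
Qed.

Lemma gal_integral (s : GalQ R) (x : ZZ) : s (Zbar_val x) \in @integral_number R.
Proof.
have /asboolP [p pmon rp] := Zbar_integral x; apply/asboolP; exists p => //.
have -> : map_poly intr p = map_poly s (map_poly intr p) :> {poly QQ}.
  by rewrite -map_poly_comp; apply: eq_map_poly => m /=; rewrite rmorph_int.
exact: rmorph_root.
Qed.

Definition galZ (s : GalQ R) (x : ZZ) : ZZ := MkZbar (gal_integral s x).

Lemma galZ_zmod s : zmod_morphism (galZ s).
Proof. by move=> x y; apply: val_inj; rewrite /= !rmorphB. Qed.
Lemma galZ_monoid s : monoid_morphism (galZ s).
Proof.
by split=> [|x y]; apply: val_inj; rewrite /= ?rmorph1 ?rmorphM.
Qed.
HB.instance Definition _ s := GRing.isZmodMorphism.Build ZZ ZZ (galZ s) (galZ_zmod s).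
HB.instance Definition _ s := GRing.isMonoidMorphism.Build ZZ ZZ (galZ s) (galZ_monoid s).

Lemma galZ_inj s : injective (galZ s).
Proof.
move=> x y /(congr1 (@Zbar_val R)) /= h; apply: val_inj => /=.
by have /bij_inj := gal_bij s; apply.
Qed.

Lemma galZ_mul s t x : galZ (gal_mul s t) x = galZ s (galZ t x).
Proof. exact: val_inj. Qed.

Lemma galZ_one x : galZ (gal_one R) x = x.
Proof. exact: val_inj. Qed.

Lemma Zbar_rational_int (x : ZZ) r : Qbar_val (Zbar_val x) = ratr r ->
  exists m : int, x = m%:~R.
Proof.
move=> e; have /asboolP [P Pmon rP] := Zbar_integral x.
pose v : {rmorphism QQ -> R[i]} := \val.
have rP' : root (map_poly intr P) r.
  have : root (map_poly (@ratr R[i]) (map_poly intr P)) (v (Zbar_val x)).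
    have -> : map_poly (@ratr R[i]) (map_poly intr P) = map_poly v (map_poly intr P).
      rewrite -!map_poly_comp; apply: eq_map_poly => m.
      have -> : (v \o intr) m = v (m%:~R) by [].
      have -> : (ratr \o intr) m = ratr (m%:~R : rat) :> R[i] by [].
      by rewrite rmorph_int rmorph_int.
    by rewrite fmorph_root.
  have -> : v (Zbar_val x) = ratr r by exact: e.
  by rewrite fmorph_root.
have [|D Dmon eD] := monic_rat_dvd_int (monicXsubC r) Pmon.
  by rewrite dvdp_XsubCl.
exists (- D`_0); apply: val_inj; apply: val_inj => /=.
rewrite e; have := congr1 (fun p : {poly rat} => p`_0) eD.
rewrite coefB coefX coefC /= coef_map sub0r => /eqP; rewrite eqr_oppLR => /eqP ->.
rewrite -[Qbar_val _]/(v _) -[Zbar_val _]/((\val : {rmorphism ZZ -> QQ}) _).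
by rewrite !rmorph_int -rmorphN rmorph_int rmorphN.
Qed.

Lemma galZ_fixed_int (x : ZZ) : (forall s, galZ s x = x) -> exists m : int, x = m%:~R.
Proof.
move=> h; have [|r /Zbar_rational_int//] := @gal_fixed_rational R (Zbar_val x).
by move=> s; have /(congr1 (@Zbar_val R)) := h s.
Qed.

Lemma galZ_orbit_seq (X : seq ZZ) :
  exists ts : seq (seq ZZ), forall s, map (galZ s) X \in ts.
Proof.
elim: X => [|x X [ts hts]]; first by exists [:: [::]].
have [ys hys] := gal_orbit (Zbar_val x).
pose ys' : seq ZZ := pmap insub ys.
exists [seq y :: t | y <- ys', t <- ts] => s /=.
apply/allpairsP; exists (galZ s x, map (galZ s) X); split => //=.
by rewrite mem_pmap_sub /=; exact: hys.
Qed.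

Section Finite.
Variables (q : nat) (v : place R q).

(** The polynomial with roots the Galois conjugates of the whole tuple [X],
    packed in one variable, has integer coefficients; its reduction is hence
    stable under the [q]-power map, which permutes the reduced conjugates. *)
Lemma frobenius_on_seq (X : seq ZZ) :
  exists s, forall x, x \in X -> v (galZ s x) = v x ^+ q.
Proof.
have [ts hts] := galZ_orbit_seq X.
pose os := undup [seq t <- ts | `[< exists s, t = map (galZ s) X >]].
have osP t : reflect (exists s, t = map (galZ s) X) (t \in os).
  rewrite mem_undup mem_filter; apply: (iffP andP) => [[/asboolP //]|[s ->]].
  by split=> //; apply/asboolP; exists s.
pose h : {poly {poly ZZ}} := \prod_(t <- os) ('X - (Poly t)%:P).
have map_Poly (A B : nzRingType) (f : {rmorphism A -> B}) t :
    map_poly f (Poly t) = Poly (map f t).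
  apply/polyP => i; rewrite coef_map !coef_Poly.
  have [lt|le] := ltnP i (size t); first by rewrite (nth_map 0).
  by rewrite [t`_i]nth_default // raddf0 nth_default ?size_map.
have hs s : map_poly (map_poly (galZ s)) h = h.
  rewrite /h rmorph_prod /= (eq_bigr (fun t => 'X - (Poly (map (galZ s) t))%:P)); last first.
    by move=> t _; rewrite rmorphB /= map_polyX map_polyC /= map_Poly.
  rewrite -(big_map (map (galZ s)) xpredT (fun t => 'X - (Poly t)%:P)).
  apply: perm_big.
  have uos : uniq os by exact: undup_uniq.
  have umap : uniq (map (map (galZ s)) os).
    by rewrite map_inj_uniq //; apply: inj_map; exact: galZ_inj.
  apply: uniq_perm => //.
  have sub : {subset map (map (galZ s)) os <= os}.
    move=> _ /mapP [t /osP [s' ->] ->]; apply/osP; exists (gal_mul s s').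
    by rewrite -map_comp; apply: eq_map => x /=; rewrite galZ_mul.
  have [|_ eqi] := uniq_min_size umap sub; first by rewrite size_map.
  by move=> t; rewrite eqi.
have hint i j : exists m : int, h`_i`_j = m%:~R.
  apply: galZ_fixed_int => s.
  by have := congr1 (fun p : {poly {poly ZZ}} => p`_i`_j) (hs s); rewrite !coef_map.
pose phi := pFrobenius_aut (residue_char v).
pose hv := map_poly (map_poly v) h.
have hphi : map_poly (map_poly phi) hv = hv.
  apply/polyP => i; apply/polyP => j; rewrite !coef_map /=.
  by have [m ->] := hint i j; rewrite !rmorph_int.
have hvE : hv = \prod_(t <- os) ('X - (Poly (map v t))%:P).
  rewrite /hv /h rmorph_prod; apply: eq_bigr => t _.
  by rewrite rmorphB /= map_polyX map_polyC /= map_Poly.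
have Xos : X \in os.
  apply/osP; exists (gal_one R); rewrite -[LHS]map_id; apply: eq_map => x.
  by rewrite galZ_one.
have r0 : root hv (Poly (map v X)).
  rewrite hvE -(big_map (fun t => Poly (map v t)) xpredT (fun u => 'X - u%:P)).
  by rewrite root_prod_XsubC; apply/mapP; exists X.
have : root hv (map_poly phi (Poly (map v X))).
  by rewrite -hphi; apply: rmorph_root.
rewrite hvE -(big_map (fun t => Poly (map v t)) xpredT (fun u => 'X - u%:P)).
rewrite root_prod_XsubC => /mapP [_ /osP [s ->] e]; exists s => x xX.
have ix : (index x X < size X)%N by rewrite index_mem.
have := congr1 (fun p : {poly _} => p`_(index x X)) e.
rewrite coef_map !coef_Poly -map_comp !(nth_map 0) // nth_index //=.
Qed.

(** [frobenius_on_seq] meets any finite number of the required congruences; what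
    remains is a compactness argument. Take a maximal set [G] of prescribed values
    such that any finite part of [G] can be met together with any finite number of
    congruences. Since an algebraic number has finitely many conjugates, [G]
    prescribes a value everywhere. *)
Lemma exists_frobenius : exists s, frobenius v s.
Proof.
pose ok (g : seq (QQ * QQ)) (X : seq ZZ) (s : GalQ R) :=
  (forall u, u \in g -> s u.1 = u.2) /\ forall x, x \in X -> v (galZ s x) = v x ^+ q.
pose P (G : set (QQ * QQ)) := forall (g : seq (QQ * QQ)) X,
  (forall u, u \in g -> G u) -> exists s, ok g X s.
have okS g g' X X' s : {subset g <= g'} -> {subset X <= X'} -> ok g' X' s -> ok g X s.
  by move=> hg hX [h1 h2]; split=> u hu; [apply/h1/hg | apply/h2/hX].
have [|G [PG maxG]] := @Zorn_bigcup _ P.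
  move=> F FP tot g X gF.
  suff : g = [::] \/ exists2 Y, F Y & forall u, u \in g -> Y u.
    case=> [->|[Y FY hY]]; last exact: (FP Y FY g X hY).
    by have [s hs] := frobenius_on_seq X; exists s; split.
  elim: g gF => [|u g IH] gF; first by left.
  right; have [X1 FX1 X1u] := gF u (mem_head _ _).
  case: IH => [w hw|->|[Y FY hY]]; first by apply: gF; rewrite inE hw orbT.
    by exists X1 => // w; rewrite inE => /eqP ->.
  case: (tot X1 Y FX1 FY) => sub.
    exists Y => // w; rewrite inE => /orP[/eqP ->|/hY//]; exact: sub.
  by exists X1 => // w; rewrite inE => /orP[/eqP ->//|/hY]; exact: sub.
have tot x : exists y, G (x, y).
  have [ys hys] := gal_orbit x.
  apply: contrapT => no.
  have bad y : exists gX : seq (QQ * QQ) * seq ZZ,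
      (forall u, u \in gX.1 -> G u \/ u = (x, y)) /\ forall s, ~ ok gX.1 gX.2 s.
    have nG : ~ G (x, y) by move=> h; apply: no; exists y.
    have : ~ P (G `|` [set (x, y)]).
      apply: maxG; split; first by move=> u; left.
      by move=> h; apply: nG; apply: h; right.
    move=> /existsNP [g /existsNP [X /not_implyP [h1 /forallNP h2]]].
    by exists (g, X).
  pose b y := projT1 (cid (bad y)).
  have bP y : (forall u, u \in (b y).1 -> G u \/ u = (x, y)) /\
      forall s, ~ ok (b y).1 (b y).2 s by rewrite /b; case: cid.
  pose g := [seq u <- flatten [seq (b y).1 | y <- ys] | `[< G u >]].
  have [|s [sg sX]] := PG g (flatten [seq (b y).2 | y <- ys]).
    by move=> u; rewrite mem_filter => /andP[/asboolP].
  have [b1 b2] := bP (s x); apply: (b2 s); split.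
    move=> u hu; case: (b1 u hu) => [Gu|-> //].
    apply: sg; rewrite mem_filter; apply/andP; split; first exact/asboolP.
    by apply/flattenP; exists (b (s x)).1 => //; apply/map_f/hys.
  move=> z hz; apply: sX.
  by apply/flattenP; exists (b (s x)).2 => //; apply/map_f/hys.
pose f x := projT1 (cid (tot x)).
have fG x : G (x, f x) by rewrite /f; case: cid.
have fP (xs : seq QQ) (X : seq ZZ) : exists s : GalQ R,
    (forall x, x \in xs -> s x = f x) /\ forall x, x \in X -> v (galZ s x) = v x ^+ q.
  have [|s [s1 s2]] := PG [seq (x, f x) | x <- xs] X.
    by move=> _ /mapP [x _ ->].
  exists s; split=> // x hx; apply: (s1 (x, f x)); exact: (map_f (fun x => (x, f x))).
have fB : zmod_morphism f.
  move=> x y; have [s [h _]] := fP [:: x; y; x - y] [::].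
  by rewrite -!h ?inE ?eqxx ?orbT // rmorphB.
have fM : monoid_morphism f.
  split; first by have [s [h _]] := fP [:: 1] [::]; rewrite -h ?inE // rmorph1.
  move=> x y; have [s [h _]] := fP [:: x; y; x * y] [::].
  by rewrite -!h ?inE ?eqxx ?orbT // rmorphM.
have finj : injective f.
  move=> x y; have [s [h _]] := fP [:: x; y] [::].
  rewrite -!h ?inE ?eqxx ?orbT //.
  by have /bij_inj := gal_bij s; apply.
have fsurj y : exists x, f x = y.
  have [ys hys] := gal_orbit y; have [s [h _]] := fP ys [::].
  have [t st ts] := gal_bij s.
  have tbij : bijective t by exists s.
  have tB : zmod_morphism t.
    by move=> a c; apply: (bij_inj (gal_bij s)); rewrite rmorphB !ts.
  have tM : monoid_morphism t.
    by split=> [|a c]; apply: (bij_inj (gal_bij s)); rewrite ?rmorph1 ?rmorphM !ts.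
  pose T : {rmorphism QQ -> QQ} := HB.pack t
    (GRing.isZmodMorphism.Build QQ QQ t tB) (GRing.isMonoidMorphism.Build QQ QQ t tM).
  exists (t y); rewrite -h ?ts //; exact: (hys (@MkGalQ R T tbij)).
have fbij : bijective f.
  pose g y := projT1 (cid (fsurj y)).
  have gP y : f (g y) = y by rewrite /g; case: cid.
  by exists g => // x; apply: finj; rewrite gP.
pose F : {rmorphism QQ -> QQ} := HB.pack f
  (GRing.isZmodMorphism.Build QQ QQ f fB) (GRing.isMonoidMorphism.Build QQ QQ f fM).
exists (@MkGalQ R F fbij) => x y /= exy.
have [s [h1 h2]] := fP [:: Zbar_val x] [:: x].
rewrite -h2 ?inE //; congr (v _); apply: val_inj => /=.
by rewrite exy /= h1 ?inE.
Qed.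

End Finite.
End Frobenius.

Section FrobeniusTrace.
Variable R : realType.
Local Notation QQ := (Qbar R).
Local Notation ZZ := (Zbar R).

Lemma Qbar_natr_eq0 (n : nat) : (n%:R == 0 :> QQ) = (n == 0)%N.
Proof.
by rewrite -(fmorph_eq0 (\val : {rmorphism QQ -> R[i]})) rmorph_nat pnatr_eq0.
Qed.

Lemma exists_primitive_root_Qbar (l : nat) : prime l ->
  exists z : QQ, l.-primitive_root z.
Proof.
move=> pl; have l1 := prime_gt1 pl; have l0 := prime_gt0 pl.
pose P : {poly QQ} := \poly_(i < l) 1.
have sP : size P = l.
  by rewrite size_poly_eq ?oner_eq0.
have [|z rz] := @Qbar_closed R P; first by rewrite sP; case: l l1 {pl l0 P sP} => [|[]].
have PE (x : QQ) : P.[x] = \sum_(i < l) x ^+ i.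
  by rewrite horner_poly; apply: eq_bigr => i _; rewrite mul1r.
have zl : z ^+ l = 1.
  apply/eqP; rewrite -subr_eq0 subrX1 -PE (rootP rz) mulr0 //.
have z1 : z != 1.
  apply: contraTneq rz => ->; rewrite rootE PE (eq_bigr (fun=> 1)).
    by rewrite sumr_const card_ord Qbar_natr_eq0 -lt0n.
  by move=> i _; rewrite expr1n.
have [m mprim mdvd] := prim_order_exists l0 zl.
exists z; case/primeP: pl => _ /(_ m mdvd) /pred2P [em|em]; last by rewrite -em.
by rewrite em in mprim; move: z1; rewrite -(prim_expr_order mprim) expr1 eqxx.
Qed.

(** If [u = x / y] is not 1, then [1 + u + ... + u^(l-1)] is zero; it reduces to [l],
    which is not zero in characteristic [q]. *)
Lemma roots_of_unity_reduction (q l : nat) (v : place R q) (x y : ZZ) :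
  prime l -> q != l -> x ^+ l = 1 -> y ^+ l = 1 -> v x = v y -> x = y.
Proof.
move=> pl neq xl yl e.
have l0 := prime_gt0 pl.
pose u := x * y ^+ l.-1.
have yy : y * y ^+ l.-1 = 1 by rewrite -exprS prednK.
have ul : u ^+ l = 1 by rewrite exprMn xl -exprM mulnC exprM yl expr1n mulr1.
have vu : v u = 1 by rewrite rmorphM e -rmorphM yy rmorph1.
pose val' : {rmorphism ZZ -> QQ} := \val.
have [/eqP|/eqP] : u - 1 == 0 \/ \sum_(i < l) u ^+ i == 0.
    apply/orP; rewrite -!(inj_eq (val_inj : injective val')) !rmorph0 -mulf_eq0.
    by rewrite -rmorphM -subrX1 ul subrr rmorph0.
  move=> /eqP; rewrite subr_eq0 => /eqP u1.
  by rewrite -[x]mulr1 -yy mulrCA -/u u1 mulr1.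
move=> /(congr1 v); rewrite rmorph0 rmorph_sum (eq_bigr (fun=> 1)); last first.
  by move=> i _; rewrite rmorphXn /= vu expr1n.
rewrite sumr_const card_ord => /eqP.
have pq : prime q by exact: (pcharf_prime (residue_char v)).
rewrite -(dvdn_pcharf (residue_char v)) dvdn_prime2 //.
by rewrite (negbTE neq).
Qed.

Lemma root_of_unity_integral (l : nat) (z : QQ) : (0 < l)%N -> z ^+ l = 1 ->
  z \in @integral_number R.
Proof.
move=> l0 zl; apply/asboolP; exists ('X^l - 1); first exact: monicXnsubC.
by rewrite rmorphB /= map_polyXn rmorph1 /root !hornerE zl subrr.
Qed.

(** A Frobenius element raises [l]-th roots of unity to the power [q] modulo [v],
    and reduction is injective on them. *)
Lemma cyclotomic_char_frobenius (q l : nat) (v : place R q) (F : fieldType) s :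
  prime l -> q != l -> l \in [pchar F] -> frobenius v s ->
  cyclotomic_char F l s = q%:R.
Proof.
move=> pl neq charF frob.
have l0 := prime_gt0 pl.
have sz (z : QQ) : z ^+ l = 1 -> s z = z ^+ q.
  move=> zl; pose Z : ZZ := MkZbar (root_of_unity_integral l0 zl).
  have Zl : Z ^+ l = 1.
    by apply: val_inj; rewrite rmorphXn /= zl.
  have : galZ s Z = Z ^+ q.
    apply: (roots_of_unity_reduction (v := v) pl neq).
    - by rewrite -rmorphXn Zl rmorph1.
    - by rewrite -exprM mulnC exprM Zl expr1n.
    - by rewrite rmorphXn; apply: frob.
  by move/(congr1 (\val : {rmorphism ZZ -> QQ})); rewrite rmorphXn.
have [z zprim] := exists_primitive_root_Qbar pl.
rewrite /cyclotomic_char; case: xgetP => [m _ [lt hm]|no]; last first.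
  case: (no (q %% l)%N); split; first by rewrite ltn_mod.
  by move=> y yl; rewrite sz // {1}(divn_eq q l) exprD mulnC exprM yl expr1n mul1r.
have := hm z (prim_expr_order zprim); rewrite sz ?(prim_expr_order zprim) //.
move/eqP; rewrite (eq_prim_root_expr zprim) => /eqP e.
by rewrite -(GRing.natr_mod_pchar charF m) -e GRing.natr_mod_pchar.
Qed.

(** Compare the traces of a Frobenius element at [q] on both representations. *)
Lemma eigenvalue_congruence (l : nat) (w : place R l) (N k q : nat)
    (chi : int -> ZZ) (a : nat -> ZZ) (rho : GalQ R -> 'M[residue w]_2) (v : place R q) :
  prime l -> prime q -> ~~ (q %| N * l)%N ->
  attached_rep N k chi a rho ->
  rep_iso (@one_plus_cyclotomic R (residue w) l k.-1) rho ->
  w (a q) = 1 + q%:R ^+ k.-1.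
Proof.
move=> pl pq ndvd [_ _ _ _ h] [P Pu hP].
have [s frob] := exists_frobenius v.
have [_ /(_ v s frob) [<- _]] := h q pq ndvd.
have neq : q != l by apply: contraNneq ndvd => ->; rewrite dvdn_mull.
have -> : rho s = P *m one_plus_cyclotomic (residue w) l k.-1 s *m invmx P.
  by rewrite hP mulmxK.
rewrite mxtrace_mulC mulmxA mulVmx // mul1mx mxtrace_diag.
by rewrite !big_ord_recl big_ord0 !mxE /= addr0 (cyclotomic_char_frobenius pl neq (residue_char w) frob).
Qed.

End FrobeniusTrace.

(** * Complex differentiation by estimates *)

Section ComplexNorm.
Variable R : realType.
Local Notation C := R[i].
Implicit Types (x y z w : C).

(** The modulus as a real number: the norm of [R[i]] is complex valued, whereas the
    estimates take place in the ordered field [R]. *)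
Definition nm (z : C) : R := Normc.normc z.

Lemma nmE z : nm z = Num.sqrt (complex.Re z ^+ 2 + complex.Im z ^+ 2).
Proof. by case: z. Qed.
Lemma nm_ge0 z : 0 <= nm z. Proof. by rewrite nmE sqrtr_ge0. Qed.
Lemma nm0 : nm 0 = 0. Proof. exact: Normc.normc0. Qed.
Lemma nm1 : nm 1 = 1. Proof. exact: Normc.normc1. Qed.
Lemma nm_eq0 z : nm z = 0 -> z = 0. Proof. exact: Normc.eq0_normc. Qed.
Lemma nmM x y : nm (x * y) = nm x * nm y. Proof. exact: Normc.normcM. Qed.
Lemma nmV x : nm x^-1 = (nm x)^-1. Proof. exact: Normc.normcV. Qed.
Lemma nmD x y : nm (x + y) <= nm x + nm y. Proof. exact: le_normcD. Qed.
Lemma nmN x : nm (- x) = nm x. Proof. exact: normcN. Qed.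
Lemma nmB x y : nm (x - y) <= nm x + nm y.
Proof. by rewrite -(nmN y) nmD. Qed.
Lemma nmBC x y : nm (x - y) = nm (y - x).
Proof. by rewrite -nmN opprB. Qed.
Lemma nm_real (r : R) : nm r%:C = `|r|.
Proof. by rewrite nmE /= expr0n /= addr0 sqrtr_sqr. Qed.
Lemma nm_nat (n : nat) : nm n%:R = n%:R.
Proof. by rewrite -(rmorph_nat (real_complex R)) nm_real ger0_norm ?ler0n. Qed.
Lemma nmX x n : nm (x ^+ n) = nm x ^+ n.
Proof. by elim: n => [|n IH]; rewrite ?expr0 ?nm1 // !exprS nmM IH. Qed.
Lemma nm_gt0 x : x != 0 -> 0 < nm x.
Proof.
by move=> h; rewrite lt_def nm_ge0 andbT; apply: contra h => /eqP/nm_eq0 ->.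
Qed.
Lemma nm_sum I (r : seq I) (P : pred I) (F : I -> C) :
  nm (\sum_(i <- r | P i) F i) <= \sum_(i <- r | P i) nm (F i).
Proof.
elim/big_rec2: _ => [|i y x _ h]; first by rewrite nm0.
by apply: le_trans (nmD _ _) _; rewrite lerD2l.
Qed.
Lemma Re_le_nm z : `|complex.Re z| <= nm z.
Proof.
rewrite nmE -sqrtr_sqr ler_sqrt ?lerDl ?sqr_ge0 //.
by rewrite addr_ge0 ?sqr_ge0.
Qed.
Lemma Im_le_nm z : `|complex.Im z| <= nm z.
Proof.
rewrite nmE -sqrtr_sqr ler_sqrt ?lerDr ?sqr_ge0 //.
by rewrite addr_ge0 ?sqr_ge0.
Qed.
Lemma nm_le_ReIm z : nm z <= `|complex.Re z| + `|complex.Im z|.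
Proof.
rewrite nmE -(ler_pXn2r (n := 2)) ?nnegrE ?addr_ge0 ?sqrtr_ge0 //.
rewrite sqr_sqrtr ?addr_ge0 ?sqr_ge0 // sqrrD !real_normK ?num_real //.
by rewrite lerD2r lerDl mulrn_wge0 ?mulr_ge0.
Qed.
Lemma nm_sqr z : nm z ^+ 2 = complex.Re z ^+ 2 + complex.Im z ^+ 2.
Proof. by rewrite nmE sqr_sqrtr ?addr_ge0 ?sqr_ge0. Qed.
Lemma nm_normr z : `|z| = (nm z)%:C.
Proof. by rewrite normc_def nmE. Qed.
Lemma nm_le_zero z : (forall e, 0 < e -> nm z <= e) -> z = 0.
Proof.
move=> h; apply: nm_eq0; apply/eqP; rewrite eq_le nm_ge0 andbT.
by apply/ler_addgt0Pr => e e0; rewrite add0r h.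
Qed.
End ComplexNorm.

Section ComplexDerivative.
Variable R : realType.
Local Notation C := R[i].
Implicit Types (F G : C -> C) (z w d : C).

(** The derivative in terms of an estimate for the remainder, which is the form in
    which it is established and used. *)
Definition cderiv F z d : Prop := forall e : R, 0 < e -> exists2 r : R, 0 < r &
  forall h : C, nm h < r -> nm (F (z + h) - F z - d * h) <= e * nm h.

Lemma cderiv_cst a z : cderiv (fun=> a) z 0.
Proof.
move=> e e0; exists 1 => // h _ /=.
by rewrite subrr mul0r subr0 nm0 mulr_ge0 ?nm_ge0 ?ltW.
Qed.

Lemma cderiv_id z : cderiv id z 1.
Proof.
move=> e e0; exists 1 => // h _ /=.
by rewrite [z + h]addrC addrK mul1r subrr nm0 mulr_ge0 ?nm_ge0 ?ltW.
Qed.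

Lemma cderivD F G z d d' :
  cderiv F z d -> cderiv G z d' -> cderiv (fun w => F w + G w) z (d + d').
Proof.
move=> hF hG e e0; have e20 : 0 < e / 2 by rewrite divr_gt0.
have [r r0 hr] := hF _ e20; have [s s0 hs] := hG _ e20.
exists (Num.min r s); first by rewrite lt_min r0.
move=> h; rewrite lt_min => /andP[/hr h1 /hs h2].
have -> : F (z + h) + G (z + h) - (F z + G z) - (d + d') * h =
   (F (z + h) - F z - d * h) + (G (z + h) - G z - d' * h) by ring.
apply: le_trans (nmD _ _) _; apply: le_trans (lerD h1 h2) _.
by rewrite -mulrDl -splitr.
Qed.

Lemma cderivZ a F z d : cderiv F z d -> cderiv (fun w => a * F w) z (a * d).
Proof.
move=> hF e e0; have e20 : 0 < e / (1 + nm a).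
  by rewrite divr_gt0 // ltr_wpDr ?nm_ge0.
have [r r0 hr] := hF _ e20; exists r => // h /hr hh.
have -> : a * F (z + h) - a * F z - a * d * h = a * (F (z + h) - F z - d * h) by ring.
rewrite nmM; apply: le_trans (ler_wpM2l (nm_ge0 a) hh) _.
rewrite mulrA ler_wpM2r ?nm_ge0 // mulrCA ler_piMr ?(ltW e0) //.
by rewrite ler_pdivrMr ?mul1r ?ltr_wpDr ?nm_ge0 // lerDr.
Qed.

Lemma cderiv_sum I (r : seq I) (F : I -> C -> C) (d : I -> C) z :
  (forall i, cderiv (F i) z (d i)) ->
  cderiv (fun w => \sum_(i <- r) F i w) z (\sum_(i <- r) d i).
Proof.
move=> h; elim: r => [|i r IH].
  rewrite big_nil (_ : (fun w => _) = (fun=> 0)); first exact: cderiv_cst.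
  by apply/funext => w; rewrite big_nil.
rewrite big_cons (_ : (fun w => _) = (fun w => F i w + \sum_(j <- r) F j w)).
  exact: cderivD.
by apply/funext => w; rewrite big_cons.
Qed.

Lemma cderiv_bound F z d : cderiv F z d -> exists2 r : R, 0 < r &
  forall h, nm h < r -> nm (F (z + h) - F z) <= (1 + nm d) * nm h.
Proof.
move=> /(_ 1 ltr01) [r r0 hr]; exists r => // h /hr hh.
have -> : F (z + h) - F z = (F (z + h) - F z - d * h) + d * h by ring.
apply: le_trans (nmD _ _) _; rewrite mulrDl; apply: lerD => //.
by rewrite nmM.
Qed.

Lemma cderiv_comp F G z d d' :
  cderiv G z d -> cderiv F (G z) d' -> cderiv (fun w => F (G w)) z (d' * d).
Proof.
move=> hG hF e e0.
have [r r0 hr] := cderiv_bound hG.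
have c0 : 0 < 1 + nm d by rewrite ltr_wpDr ?nm_ge0.
have c0' : 0 < 1 + nm d' by rewrite ltr_wpDr ?nm_ge0.
have [s s0 hs] := hF (e / 2 / (1 + nm d)) ltac:(by rewrite !divr_gt0).
have [t t0 ht] := hG (e / 2 / (1 + nm d')) ltac:(by rewrite !divr_gt0).
exists (Num.min t (Num.min r (s / (1 + nm d)))).
  by rewrite !lt_min r0 t0 divr_gt0.
move=> h; rewrite !lt_min => /and3P[/ht h1 /hr h2 h3].
set k := G (z + h) - G z in h1 h2.
have ks : nm k < s.
  apply: le_lt_trans h2 _.
  by rewrite mulrC -ltr_pdivlMr.
have eG : G z + k = G (z + h) by rewrite /k addrC subrK.
have := hs k ks; rewrite eG => h4.
have -> : F (G (z + h)) - F (G z) - d' * d * h =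
  (F (G (z + h)) - F (G z) - d' * k) + d' * (k - d * h) by ring.
apply: le_trans (nmD _ _) _; rewrite [e in _ <= e * _]splitr mulrDl; apply: lerD.
  apply: le_trans h4 _; rewrite -mulrA ler_wpM2l ?divr_ge0 ?(ltW e0) //.
  by rewrite ler_pdivrMl.
rewrite nmM; apply: le_trans (ler_wpM2l (nm_ge0 _) h1) _.
rewrite mulrA ler_wpM2r ?nm_ge0 // mulrCA ler_piMr ?divr_ge0 ?(ltW e0) //.
by rewrite ler_pdivrMr // mul1r lerDr.
Qed.

Lemma cderivM F G z d d' :
  cderiv F z d -> cderiv G z d' -> cderiv (fun w => F w * G w) z (d * G z + F z * d').
Proof.
move=> hF hG e e0.
have e30 : 0 < e / 3 by rewrite divr_gt0.
have p1 (x : R) : 0 <= x -> 0 < 1 + x by move=> x0; rewrite ltr_wpDr.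
have [r r0 hr] := cderiv_bound hF; have [s s0 hs] := cderiv_bound hG.
have [t t0 ht] := hF (e / 3 / (1 + nm (G z))) ltac:(by rewrite divr_gt0 ?p1 ?nm_ge0).
have [u u0 hu] := hG (e / 3 / (1 + nm (F z))) ltac:(by rewrite divr_gt0 ?p1 ?nm_ge0).
pose K := (1 + nm d) * (1 + nm d').
have K0 : 0 < K by rewrite mulr_gt0 ?p1 ?nm_ge0.
exists (Num.min (Num.min r s) (Num.min (Num.min t u) (e / 3 / K))).
  by rewrite !lt_min r0 s0 t0 u0 divr_gt0.
move=> h; rewrite !lt_min => /andP[/andP[/hr h1 /hs h2] /andP[/andP[/ht h3 /hu h4] h5]].
have -> : F (z + h) * G (z + h) - F z * G z - (d * G z + F z * d') * h =
  (F (z + h) - F z - d * h) * G z + F z * (G (z + h) - G z - d' * h) +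
  (F (z + h) - F z) * (G (z + h) - G z) by ring.
have -> : e * nm h = e / 3 * nm h + e / 3 * nm h + e / 3 * nm h by field.
apply: le_trans (nmD _ _) _; apply: lerD.
  apply: le_trans (nmD _ _) _; apply: lerD; rewrite nmM.
    rewrite mulrC; apply: le_trans (ler_wpM2l (nm_ge0 _) h3) _.
    rewrite mulrA ler_wpM2r ?nm_ge0 // mulrCA ler_piMr ?(ltW e30) //.
    by rewrite ler_pdivrMr ?p1 ?nm_ge0 // mul1r lerDr.
  apply: le_trans (ler_wpM2l (nm_ge0 _) h4) _.
  rewrite mulrA ler_wpM2r ?nm_ge0 // mulrCA ler_piMr ?(ltW e30) //.
  by rewrite ler_pdivrMr ?p1 ?nm_ge0 // mul1r lerDr.
rewrite nmM; apply: le_trans (ler_pM (nm_ge0 _) (nm_ge0 _) h1 h2) _.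
rewrite mulrACA -/K mulrA ler_wpM2r ?nm_ge0 // mulrC -ler_pdivlMr //.
exact: ltW.
Qed.

Lemma cderivV z : z != 0 -> cderiv (fun w => w^-1) z (- z^-1 ^+ 2).
Proof.
move=> z0 e e0; have n0 := nm_gt0 z0.
exists (Num.min (nm z / 2) (e * nm z ^+ 3 / 2)).
  by rewrite lt_min !divr_gt0 ?mulr_gt0 ?exprn_gt0.
move=> h; rewrite lt_min => /andP[h1 h2].
have zh : nm z / 2 <= nm (z + h).
  have : nm z <= nm (z + h) + nm h by rewrite -{1}(addrK h z) nmB.
  have := ltW h1; lra.
have zh0 : z + h != 0.
  by apply: contraTneq zh => ->; rewrite nm0 -ltNge divr_gt0.
have -> : (z + h)^-1 - z^-1 - - z^-1 ^+ 2 * h = h * h / (z ^+ 2 * (z + h)).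
  by field; rewrite z0 zh0.
rewrite nmM nmV [nm (z ^+ 2 * _)]nmM nmX nmM ler_pdivrMr; last first.
  by rewrite mulr_gt0 ?exprn_gt0 ?nm_gt0.
rewrite mulrAC ler_wpM2r ?nm_ge0 //; apply: le_trans (ltW h2) _.
have -> : e * nm z ^+ 3 / 2 = e * nm z ^+ 2 * (nm z / 2) by field.
by rewrite -mulrA ler_wpM2l ?(ltW e0) // ler_wpM2l ?exprn_ge0 ?nm_ge0.
Qed.

Lemma cderiv_local F G z d (r : R) : 0 < r ->
  (forall h, nm h < r -> F (z + h) = G (z + h)) -> cderiv F z d -> cderiv G z d.
Proof.
move=> r0 eFG hF e /hF [s s0 hs]; exists (Num.min r s); first by rewrite lt_min r0.
move=> h; rewrite lt_min => /andP[hr /hs]; rewrite eFG //.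
by have := eFG 0; rewrite addr0 nm0 => ->.
Qed.

(** The set of parameters up to which the increment is controlled is closed and
    relatively open in [0,1]. *)
Lemma cderiv_mean_value F (dF : C -> C) (a b : C) (M : R) :
  (forall t : R, 0 <= t <= 1 -> cderiv F (a + t%:C * (b - a)) (dF (a + t%:C * (b - a)))) ->
  (forall t : R, 0 <= t <= 1 -> nm (dF (a + t%:C * (b - a))) <= M) ->
  nm (F b - F a) <= M * nm (b - a).
Proof.
move=> hF hM; set D := b - a.
have M0 : 0 <= M by apply: le_trans (nm_ge0 _) (hM 0 _); rewrite lexx ler01.
pose g (t : R) := F (a + t%:C * D).
suff main (e : R) : 0 < e -> nm (F b - F a) <= (M + e) * nm D.
  have [D0|D0] := eqVneq (nm D) 0.
    by have := main 1 ltr01; rewrite D0 !mulr0.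
  have Dp : 0 < nm D by rewrite lt_def D0 nm_ge0.
  apply/ler_addgt0Pr => e e0; have := main (e / nm D) ltac:(by rewrite divr_gt0).
  by rewrite mulrDl divfK.
move=> e0; pose N := (M + e) * nm D.
have N0 : 0 <= N by rewrite mulr_ge0 ?nm_ge0 ?addr_ge0 ?(ltW e0).
have loc t : 0 <= t <= 1 -> exists2 r : R, 0 < r &
    forall s : R, `|s - t| < r -> nm (g s - g t) <= N * `|s - t|.
  move=> t01; have [r r0 hr] := hF t t01 e e0.
  exists (r / (1 + nm D)); first by rewrite divr_gt0 // ltr_wpDr ?nm_ge0.
  move=> s hs.
  have hsmall : nm ((s - t)%:C * D) < r.
    rewrite nmM nm_real; apply: le_lt_trans (_ : `|s - t| * (1 + nm D) < r).
      by rewrite ler_wpM2l // lerDr.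
    by rewrite -ltr_pdivlMr // ltr_wpDr ?nm_ge0.
  have := hr _ hsmall.
  have -> : a + t%:C * (b - a) + (s - t)%:C * D = a + s%:C * D.
    by rewrite -/D rmorphB; ring.
  rewrite -/D -/(g s) -/(g t) => h1.
  have -> : g s - g t = (g s - g t - dF (a + t%:C * D) * ((s - t)%:C * D)) +
     dF (a + t%:C * D) * ((s - t)%:C * D) by ring.
  apply: le_trans (nmD _ _) _.
  have := ler_wpM2r (nm_ge0 ((s - t)%:C * D)) (hM t t01).
  rewrite -/D; move: h1; rewrite !nmM nm_real /N.
  set X := nm (g s - _ - _); set Y := nm (dF _) * _ => h1 h2.
  apply: le_trans (lerD h1 h2) _.
  by rewrite -mulrDl [e + M]addrC [`|_| * _]mulrC mulrA.
pose S := [set t : R | 0 <= t <= 1 /\ nm (g t - g 0) <= N * t].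
have S0 : S 0 by split; rewrite ?lexx ?ler01 // subrr nm0 mulr0.
have supS : has_sup S by split; [exists 0|exists 1 => t [/andP[]]].
pose T := sup S.
have T0 : 0 <= T by apply: ub_le_sup S0; case: supS.
have T1 : T <= 1 by apply: sup_le_ub; [exists 0|move=> t [/andP[]]].
have ST : S T.
  split; first by rewrite T0 T1.
  have [r r0 hr] := loc T ltac:(by rewrite T0 T1).
  have [s Ss hs] := sup_adherent r0 supS.
  have sT : s <= T by apply: ub_le_sup Ss; case: supS.
  have := hr s; rewrite distrC ger0_norm ?subr_ge0 // => /(_ _) h1.
  have {}h1 := h1 ltac:(by rewrite ltrBlDr -ltrBlDl).
  case: Ss => _ h2.
  have -> : g T - g 0 = (g T - g s) + (g s - g 0) by ring.
  apply: le_trans (nmD _ _) _; rewrite nmBC; apply: le_trans (lerD h1 h2) _.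
  by rewrite -mulrDr subrK.
have eT : T = 1.
  apply/eqP; rewrite eq_le T1 leNgt; apply/negP => lt1.
  have [r r0 hr] := loc T ltac:(by rewrite T0 T1).
  pose s := T + Num.min (r / 2) (1 - T).
  have m0 : 0 < Num.min (r / 2) (1 - T) by rewrite lt_min divr_gt0 //= subr_gt0.
  have sS : S s.
    split.
      rewrite addr_ge0 ?(ltW m0) //= -lerBrDl ge_min lexx orbT //.
    have := hr s; rewrite /s [T + _]addrC addrK ger0_norm ?(ltW m0) //.
    set m := Num.min _ _ in m0 *.
    have mr : m < r by rewrite gt_min ltr_pdivrMr // ltr_pMr // ltr1n.
    move=> /(_ mr) h1; case: ST => _ h2.
    have -> : g (m + T) - g 0 = (g (m + T) - g T) + (g T - g 0) by ring.
    apply: le_trans (nmD _ _) _; apply: le_trans (lerD h1 h2) _.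
    by rewrite -mulrDr.
  have : s <= T by apply: ub_le_sup sS; case: supS.
  by rewrite /s gerDl leNgt m0.
case: ST => _; rewrite eT mulr1 /g rmorph1 rmorph0 mul1r mul0r addr0 /D.
by rewrite [a + _]addrC subrK.
Qed.

End ComplexDerivative.

Section HalfPlane.
Variable R : realType.
Local Notation C := R[i].
Local Notation H := (@upper_half R).
Implicit Types (F G : C -> C) (z w d : C).

Lemma ImD z w : complex.Im (z + w) = complex.Im z + complex.Im w.
Proof. by case: z; case: w. Qed.
Lemma ReD z w : complex.Re (z + w) = complex.Re z + complex.Re w.
Proof. by case: z; case: w. Qed.
Lemma ImZ (t : R) z : complex.Im (t%:C * z) = t * complex.Im z.
Proof. by case: z => a b /=; rewrite mul0r addr0. Qed.
Lemma ImN z : complex.Im (- z) = - complex.Im z. Proof. by case: z. Qed.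
Lemma ReN z : complex.Re (- z) = - complex.Re z. Proof. by case: z. Qed.
Lemma natC (n : nat) : n%:R = (n%:R : R)%:C.
Proof. by rewrite rmorph_nat. Qed.
Lemma intC (n : int) : n%:~R = (n%:~R : R)%:C.
Proof. by rewrite rmorph_int. Qed.

Lemma segment_Im (a b : C) (y t : R) : 0 <= t <= 1 ->
  y <= complex.Im a -> y <= complex.Im b -> y <= complex.Im (a + t%:C * (b - a)).
Proof.
case/andP=> t0 t1 ya yb; rewrite ImD ImZ ImD ImN.
have -> : complex.Im a + t * (complex.Im b - complex.Im a) =
  y + ((1 - t) * (complex.Im a - y) + t * (complex.Im b - y)) by ring.
by rewrite lerDl addr_ge0 // mulr_ge0 // subr_ge0.
Qed.

Lemma segment_H (a b : C) (t : R) : 0 <= t <= 1 -> H a -> H b ->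
  H (a + t%:C * (b - a)).
Proof.
move=> t01 ha hb; rewrite /upper_half /=.
apply: lt_le_trans (_ : Num.min (complex.Im a) (complex.Im b) <= _).
  by rewrite lt_min; apply/andP.
by apply: segment_Im => //; rewrite ge_min lexx ?orbT.
Qed.

Lemma mean_value_H F (dF : C -> C) (a b : C) (y M : R) :
  (forall w, H w -> cderiv F w (dF w)) -> H a -> H b ->
  y <= complex.Im a -> y <= complex.Im b ->
  (forall w, H w -> y <= complex.Im w -> nm (dF w) <= M) ->
  nm (F b - F a) <= M * nm (b - a).
Proof.
move=> hF ha hb ya yb hM; apply: (cderiv_mean_value (dF := dF)) => t t01.
  exact/hF/segment_H.
by apply: hM; [apply: segment_H | apply: segment_Im].
Qed.

Lemma cderiv0_constant F : (forall w, H w -> cderiv F w 0) ->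
  forall a b, H a -> H b -> F a = F b.
Proof.
move=> hF a b ha hb; apply/esym/eqP; rewrite -subr_eq0; apply/eqP/nm_eq0/eqP.
rewrite eq_le nm_ge0 andbT.
have := @mean_value_H F (fun=> 0) a b (Num.min (complex.Im a) (complex.Im b)) 0 hF ha hb.
rewrite mul0r; apply; rewrite ?ge_min ?lexx ?orbT // => w _ _.
by rewrite nm0.
Qed.

Lemma H_open z h : H z -> nm h < complex.Im z -> H (z + h).
Proof.
rewrite /upper_half /= ImD => hz hh.
by have := Im_le_nm h; rewrite ler_norml => /andP[h1 _]; lra.
Qed.

Lemma cderiv_eqH F G z d : H z -> (forall w, H w -> F w = G w) ->
  cderiv F z d -> cderiv G z d.
Proof.
move=> hz e; apply: (cderiv_local (r := complex.Im z)) => // h hh.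
by apply: e; apply: H_open.
Qed.

(** The mean value inequality for [F w - F1 z * w], whose derivative
    [F1 w - F1 z] is bounded by the mean value inequality again. *)
Lemma taylor2_H F (F1 F2 : C -> C) z h (y M : R) :
  (forall w, H w -> cderiv F w (F1 w)) -> (forall w, H w -> cderiv F1 w (F2 w)) ->
  H z -> H (z + h) -> y <= complex.Im z -> y <= complex.Im (z + h) -> 0 <= M ->
  (forall w, H w -> y <= complex.Im w -> nm (F2 w) <= M) ->
  nm (F (z + h) - F z - F1 z * h) <= M * nm h ^+ 2.
Proof.
move=> hF hF1 hz hzh yz yzh M0 hM.
pose G w := F w - F1 z * w.
have -> : F (z + h) - F z - F1 z * h = G (z + h) - G z by rewrite /G; ring.
have e : z + h - z = h by rewrite addrAC subrr add0r.
rewrite expr2 mulrA -{3}e.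
apply: (cderiv_mean_value (dF := fun w => F1 w - F1 z)) => t t01.
  set w := z + t%:C * (z + h - z); have hw : H w by apply: segment_H.
  rewrite /G (_ : F1 w - F1 z = F1 w + (- F1 z) * 1); last by rewrite mulr1.
  rewrite (_ : (fun u => _) = (fun u => F u + (- F1 z) * u)); last first.
    by apply/funext => u; rewrite mulNr.
  by apply: cderivD; [exact: hF | apply: cderivZ; exact: cderiv_id].
set w := z + t%:C * (z + h - z); have hw : H w by apply: segment_H.
have yw : y <= complex.Im w by apply: segment_Im.
apply: le_trans (mean_value_H hF1 hz hw yz yw hM) _.
apply: ler_wpM2l => //; rewrite /w addrAC subrr add0r e nmM nm_real.
case/andP: t01 => t0 t1; rewrite ger0_norm // ler_piMl ?nm_ge0 //.
Qed.

Local Notation e := (@e2pii R).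

Lemma e2piiD z w : e (z + w) = e z * e w.
Proof.
rewrite /e2pii ImD ReD !mulrDr expRD cosD sinD rmorphM /=.
set A := (expR _)%:C; set B := (expR _)%:C.
rewrite mulrACA; congr (_ * _); rewrite /GRing.mul /=.
by congr (_ +i* _); exact: addrC.
Qed.

Lemma nm_e2pii z : nm (e z) = expR (- 2 * pi * complex.Im z).
Proof.
rewrite /e2pii nmM nm_real ger0_norm ?expR_ge0 // nmE /=.
by rewrite cos2Dsin2 sqrtr1 mulr1.
Qed.

Lemma e2pii0 : e 0 = 1.
Proof. by rewrite /e2pii /= !mulr0 expR0 cos0 sin0 mul1r. Qed.

Lemma e2pii1 : e 1 = 1.
Proof. by rewrite /e2pii /= !mulr0 !mulr1 expR0 mul1r mulr_natl cos2pi sin2pi. Qed.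

Lemma e2piiX (n : nat) z : e (n%:R * z) = e z ^+ n.
Proof.
elim: n => [|n IH]; first by rewrite mul0r e2pii0.
by rewrite exprS -IH -e2piiD -{2}[z]mul1r -mulrDl -natr1 addrC.
Qed.

Lemma nm_e2pii_le z (y : R) : y <= complex.Im z -> nm (e z) <= expR (- 2 * pi * y).
Proof.
move=> h; rewrite nm_e2pii ler_expR !mulNr lerN2 ler_wpM2l //.
by rewrite mulr_ge0 ?pi_ge0.
Qed.

Definition twopii : C := 0 +i* (2 * pi).

Lemma twopii_neq0 : twopii != 0.
Proof.
apply: contraTneq (@pi_gt0 R) => /(congr1 (@complex.Im R)) /= /eqP.
by rewrite mulf_eq0 pnatr_eq0 /= => /eqP ->; rewrite ltxx.
Qed.

Lemma nm_twopii : nm twopii = 2 * pi.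
Proof.
by rewrite nmE /= expr0n add0r sqrtr_sqr ger0_norm // mulr_ge0 ?pi_ge0.
Qed.

Lemma real_deriv_eps (f : R -> R) (x d : R) : is_derive x 1 f d ->
  forall eps : R, 0 < eps -> exists2 r : R, 0 < r &
    forall h : R, `|h| < r -> `|f (x + h) - f x - d * h| <= eps * `|h|.
Proof.
move=> [df dE] eps eps0.
have : (fun h => h^-1 *: (f (h *: 1 + x) - f x)) @ 0^' --> d.
  by rewrite -dE; exact: df.
move=> /cvgrPdist_le /(_ eps eps0); rewrite near_withinE => -[r /= r0 hr].
exists r => // h hh; have [->|h0] := eqVneq h 0.
  by rewrite addr0 subrr mulr0 subr0 normr0 mulr0.
have := hr h; rewrite /= sub0r normrN => /(_ hh h0).
rewrite distrC /GRing.scale /= mulr1 => hle.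
have -> : f (x + h) - f x - d * h = (h^-1 * (f (h + x) - f x) - d) * h.
  by rewrite [h + x]addrC; field.
by rewrite normrM ler_wpM2r.
Qed.

Lemma cderiv_e2pii0 : cderiv e 0 twopii.
Proof.
move=> eps eps0.
have [P PE] : exists P : R, P = 2 * pi by exists (2 * pi).
have P0 : 0 < P by rewrite PE mulr_gt0 ?pi_gt0.
(* 9 = 4 + 5, the constants in the bounds T1 and T2 for the two parts below. *)
pose d := Num.min 1 (eps / (9 * P)).
have d0 : 0 < d by rewrite lt_min ltr01; apply: divr_gt0 => //; apply: mulr_gt0.
have d1 : d <= 1 by rewrite ge_min lexx.
have dP : 9 * (d * P) <= eps.
  have : d <= eps / (9 * P) by rewrite ge_min lexx orbT.
  by rewrite ler_pdivlMr ?mulr_gt0 // => hd; rewrite mulrCA.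
clearbody d.
have [r1 r10 h1] := real_deriv_eps (is_derive_expR 0) d0.
have [r2 r20 h2] := real_deriv_eps (is_derive_cos 0) d0.
have [r3 r30 h3] := real_deriv_eps (is_derive_sin 0) d0.
exists (Num.min (Num.min d r1) (Num.min r2 r3) / P).
  by rewrite divr_gt0 // !lt_min d0 r10 r20 r30.
move=> h; rewrite ltr_pdivlMr // !lt_min => /andP[/andP[nd n1] /andP[n2 n3]].
set n := nm h in nd n1 n2 n3 *; have n0 : 0 <= n by exact: nm_ge0.
pose x := complex.Re h; pose y := complex.Im h.
have xn : `|x| <= n by exact: Re_le_nm.
have yn : `|y| <= n by exact: Im_le_nm.
have hxy : h = x +i* y by rewrite /x /y; case: (h).
have Px : `|P * x| <= n * P by rewrite normrM (gtr0_norm P0) mulrC ler_wpM2r // ltW.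
have Py : `|- (P * y)| <= n * P.
  by rewrite normrN normrM (gtr0_norm P0) mulrC ler_wpM2r // ltW.
have k1 := h1 _ (le_lt_trans Py n1); have k2 := h2 _ (le_lt_trans Px n2).
have k3 := h3 _ (le_lt_trans Px n3).
rewrite !add0r expR0 mul1r in k1; rewrite !add0r cos0 sin0 oppr0 mul0r subr0 in k2.
rewrite !add0r sin0 cos0 mul1r subr0 in k3.
rewrite add0r e2pii0.
have eh : e h = (expR (- (P * y)))%:C * (cos (P * x) +i* sin (P * x)).
  by rewrite /e2pii !mulNr -PE.
clearbody x y.
set E := expR _ in k1 eh; set c := cos _ in k2 eh; set s := sin _ in k3 eh.
have dnP : d * (n * P) <= n * P by rewrite ler_piMl // mulr_ge0 // ltW.
have K1 : `|E - 1 - - (P * y)| <= d * (n * P).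
  by apply: le_trans k1 _; rewrite ler_wpM2l // ltW.
have K2 : `|c - 1| <= d * (n * P) by apply: le_trans k2 _; rewrite ler_wpM2l // ltW.
have K3 : `|s - P * x| <= d * (n * P) by apply: le_trans k3 _; rewrite ler_wpM2l // ltW.
have E1 : `|E - 1| <= 2 * (n * P).
  have -> : E - 1 = (E - 1 - - (P * y)) + - (P * y) by ring.
  by apply: le_trans (ler_normD _ _) _; lra.
have S1 : `|s| <= 2 * (n * P).
  have -> : s = (s - P * x) + P * x by ring.
  by apply: le_trans (ler_normD _ _) _; lra.
have E2 : `|E| <= 3.
  have -> : E = (E - 1) + 1 by ring.
  by apply: le_trans (ler_normD _ _) _; rewrite normr1; lra.
apply: le_trans (nm_le_ReIm _) _.
have -> : complex.Re (e h - 1 - twopii * h) = (E - 1 - - (P * y)) + E * (c - 1).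
  by rewrite eh hxy /twopii -PE !ReD !ReN /=; ring.
have -> : complex.Im (e h - 1 - twopii * h) = (E - 1) * s + (s - P * x).
  by rewrite eh hxy /twopii -PE !ImD !ImN /=; ring.
have T1 : `|E - 1 - - (P * y) + E * (c - 1)| <= 4 * (d * (n * P)).
  apply: le_trans (ler_normD _ _) _; rewrite [`|E * _|]normrM.
  have : `|E| * `|c - 1| <= 3 * (d * (n * P)) by apply: ler_pM.
  by lra.
have T2 : `|(E - 1) * s + (s - P * x)| <= 5 * (d * (n * P)).
  apply: le_trans (ler_normD _ _) _; rewrite [`|(E - 1) * _|]normrM.
  have : `|E - 1| * `|s| <= (2 * (n * P)) * (2 * (n * P)) by apply: ler_pM.
  have : (n * P) * (n * P) <= d * (n * P).
    by rewrite ler_wpM2r ?mulr_ge0 ?(ltW P0) ?(ltW nd).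
  by lra.
have : 9 * (d * P) * n <= eps * n by rewrite ler_wpM2r.
lra.
Qed.

Lemma cderiv_e2pii z : cderiv e z (twopii * e z).
Proof.
move=> eps eps0; have ez0 : 0 < nm (e z) by rewrite nm_e2pii expR_gt0.
have [r r0 hr] := cderiv_e2pii0 (divr_gt0 eps0 ez0); exists r => // h /hr.
rewrite add0r e2pii0 => hh; rewrite e2piiD.
have -> : e z * e h - e z - twopii * e z * h = e z * (e h - 1 - twopii * h) by ring.
by rewrite nmM mulrC -ler_pdivlMr // mulrAC.
Qed.

Lemma cderiv_e2piiX (n : nat) z :
  cderiv (fun w => e w ^+ n) z (twopii * n%:R * e z ^+ n).
Proof.
rewrite (_ : (fun w => _) = (fun w => e (n%:R * w))); last first.
  by apply/funext => w; rewrite e2piiX.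
rewrite -e2piiX mulrAC; apply: cderiv_comp; last exact: cderiv_e2pii.
by rewrite -[X in cderiv _ _ X]mulr1; apply: cderivZ; exact: cderiv_id.
Qed.

End HalfPlane.

(** * Fourier series on the upper half-plane *)

Section QSeries.
Variable R : realType.
Local Notation C := R[i].
Local Notation H := (@upper_half R).
Local Notation e := (@e2pii R).
Implicit Types (c d : nat -> C) (z w : C).

Lemma expr_small (r B eps : R) : 0 <= r < 1 -> 0 <= B -> 0 < eps ->
  exists M0, forall M, (M0 <= M)%N -> B * r ^+ M <= eps.
Proof.
move=> /andP[r0 r1] B0 eps0.
have B1 : 0 < 1 + B by rewrite ltr_wpDr.
have : (GRing.exp r : R^nat) @ \oo --> 0 by apply: cvg_expr; rewrite ger0_norm.
move=> /cvgrPdist_le /(_ (eps / (1 + B))) [|M0 _ hM].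
  by rewrite divr_gt0.
exists M0 => M /hM /=; rewrite sub0r normrN ger0_norm ?exprn_ge0 // => h.
apply: le_trans (_ : (1 + B) * r ^+ M <= _).
  by rewrite ler_wpM2r ?exprn_ge0 // lerDr.
by rewrite mulrC -ler_pdivlMr.
Qed.

Lemma sum_geometric_le (r : R) M K : 0 <= r < 1 ->
  \sum_(M <= i < K) r ^+ i <= r ^+ M / (1 - r).
Proof.
move=> /andP[r0 r1]; have r10 : 0 < 1 - r by rewrite subr_gt0.
have [le|lt] := leqP K M; first by rewrite big_geq // divr_ge0 ?exprn_ge0 // ltW.
rewrite ler_pdivlMr // mulrC.
have -> : (1 - r) * \sum_(M <= i < K) r ^+ i = r ^+ M - r ^+ K.
  have := telescope_sumr (fun i => - r ^+ i) (ltnW lt).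
  rewrite opprK addrC mulr_sumr => <-.
  by apply: eq_bigr => i _; rewrite exprS; ring.
by rewrite lerBlDr lerDl exprn_ge0.
Qed.

Lemma real_geometric_sum (u : nat -> R) (B r : R) : 0 <= r < 1 ->
  (forall n, `|u n| <= B * r ^+ n) ->
  exists s, forall M, `|s - \sum_(i < M) u i| <= B * r ^+ M / (1 - r).
Proof.
move=> r01 hu; have /andP[r0 r1] := r01.
have B0 : 0 <= B by have := hu 0%N; rewrite expr0 mulr1; exact: le_trans.
have cu : cvgn (series u).
  apply: normed_cvg; apply: (series_le_cvg (v_ := geometric B r)) => //.
  - by move=> n; exact: normr_ge0.
  - by move=> n; exact: mulr_ge0 B0 (exprn_ge0 n r0).
  - by apply: is_cvg_geometric_series; rewrite ger0_norm.
exists (limn (series u)) => M.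
have near_b : \forall K \near \oo, `|series u K - \sum_(i < M) u i| <= B * r ^+ M / (1 - r).
  exists M => // K /= MK; rewrite /series /= -(big_mkord xpredT u).
  rewrite (big_cat_nat _ MK) //= addrAC subrr add0r.
  apply: le_trans (ler_norm_sum _ _ _) _.
  apply: le_trans (ler_sum _ (fun i _ => hu i)) _.
  by rewrite -mulr_sumr -mulrA ler_wpM2l // sum_geometric_le.
rewrite ler_norml; apply/andP; split.
  rewrite lerBrDr; apply: limr_ge => //.
  by apply: filterS near_b => K; rewrite ler_norml lerBrDr => /andP[].
rewrite lerBlDr; apply: limr_le => //.
by apply: filterS near_b => K; rewrite ler_norml lerBlDr => /andP[].
Qed.

Definition sums_to c (s : C) : Prop := forall eps : R, 0 < eps ->
  exists M0, forall M, (M0 <= M)%N -> nm (s - \sum_(i < M) c i) <= eps.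

Lemma ReSum n c : complex.Re (\sum_(i < n) c i) = \sum_(i < n) complex.Re (c i).
Proof. by elim: n => [|n IH]; rewrite ?big_ord0 // !big_ord_recr /= ReD IH. Qed.
Lemma ImSum n c : complex.Im (\sum_(i < n) c i) = \sum_(i < n) complex.Im (c i).
Proof. by elim: n => [|n IH]; rewrite ?big_ord0 // !big_ord_recr /= ImD IH. Qed.

Lemma sums_to_unique c s t : sums_to c s -> sums_to c t -> s = t.
Proof.
move=> hs ht; apply/eqP; rewrite -subr_eq0; apply/eqP/nm_le_zero => eps eps0.
have [M1 h1] := hs (eps / 2) ltac:(by rewrite divr_gt0).
have [M2 h2] := ht (eps / 2) ltac:(by rewrite divr_gt0).
pose M := maxn M1 M2.
have -> : s - t = (s - \sum_(i < M) c i) - (t - \sum_(i < M) c i) by ring.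
apply: le_trans (nmB _ _) _; rewrite [eps]splitr.
by apply: lerD; [apply: h1 | apply: h2]; rewrite leq_max leqnn ?orbT.
Qed.

Lemma sums_to_lin a c d s t : sums_to c s -> sums_to d t ->
  sums_to (fun n => a * c n + d n) (a * s + t).
Proof.
move=> hs ht eps eps0.
have a1 : 0 < 1 + nm a by rewrite ltr_wpDr ?nm_ge0.
have [M1 h1] := hs (eps / 2 / (1 + nm a)) ltac:(by rewrite !divr_gt0).
have [M2 h2] := ht (eps / 2) ltac:(by rewrite divr_gt0).
exists (maxn M1 M2) => M; rewrite geq_max => /andP[/h1 k1 /h2 k2].
rewrite big_split /= -mulr_sumr.
set S1 := \sum_(i < M) c i in k1 *; set S2 := \sum_(i < M) d i in k2 *.
have -> : a * s + t - (a * S1 + S2) = a * (s - S1) + (t - S2) by ring.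
apply: le_trans (nmD _ _) _; rewrite [eps]splitr nmM; apply: lerD => //.
apply: le_trans (ler_wpM2l (nm_ge0 _) k1) _.
rewrite mulrCA ler_piMr ?divr_ge0 ?(ltW eps0) //.
by rewrite ler_pdivrMr // mul1r lerDr.
Qed.

Lemma geometric_sum c (B r : R) : 0 <= r < 1 -> (forall n, nm (c n) <= B * r ^+ n) ->
  exists s, sums_to c s /\
    forall M, nm (s - \sum_(i < M) c i) <= 2 * B / (1 - r) * r ^+ M.
Proof.
move=> r01 hc; have /andP[r0 r1] := r01.
have B0 : 0 <= B by have := hc 0%N; rewrite expr0 mulr1; apply: le_trans; exact: nm_ge0.
have r10 : 0 < 1 - r by rewrite subr_gt0.
have [s1 h1] := real_geometric_sum r01 (fun n => le_trans (Re_le_nm (c n)) (hc n)).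
have [s2 h2] := real_geometric_sum r01 (fun n => le_trans (Im_le_nm (c n)) (hc n)).
have hb M : nm (s1 +i* s2 - \sum_(i < M) c i) <= 2 * B / (1 - r) * r ^+ M.
  apply: le_trans (nm_le_ReIm _) _.
  rewrite ReD ImD ReN ImN ReSum ImSum /=; have := lerD (h1 M) (h2 M).
  move/le_trans; apply; rewrite le_eqVlt; apply/orP; left; apply/eqP; field.
  by rewrite subr_eq0 eq_sym lt_eqF.
exists (s1 +i* s2); split => // eps eps0.
have [M0 hM] := @expr_small r (2 * B / (1 - r)) eps r01
  ltac:(by rewrite divr_ge0 ?mulr_ge0 ?(ltW r10)) eps0.
by exists M0 => M /hM; apply: le_trans.
Qed.

(** Radius of convergence at least 1: the series in [e z] converges on the whole
    half-plane. *)
Definition tame c : Prop := forall r : R, 0 < r < 1 ->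
  exists B : R, forall n, nm (c n) * r ^+ n <= B.

Lemma tame_le c d (K : R) : (forall n, nm (d n) <= K * nm (c n)) -> tame c -> tame d.
Proof.
move=> h hc r r01; have [B hB] := hc r r01.
have /andP[r0 _] := r01.
have B0 : 0 <= B.
  by apply: le_trans (hB 0%N); rewrite mulr_ge0 ?exprn_ge0 ?nm_ge0 // ltW.
exists (`|K| * B) => n.
apply: le_trans (_ : `|K| * (nm (c n) * r ^+ n) <= _); last first.
  by rewrite ler_wpM2l.
rewrite mulrA ler_wpM2r ?exprn_ge0 ?(ltW r0) //.
by apply: le_trans (h n) _; rewrite ler_wpM2r ?nm_ge0 // ler_norm.
Qed.

Lemma tame_natM c : tame c -> tame (fun n => n%:R * c n).
Proof.
move=> hc r /andP[r0 r1]; pose r' := (1 + r) / 2.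
have rr' : r < r' by rewrite /r' ltr_pdivlMr //; lra.
have r'1 : r' < 1 by rewrite /r' ltr_pdivrMr //; lra.
have r'0 : 0 < r' by apply: lt_trans rr'.
clearbody r'.
have [B hB] := hc r' ltac:(by rewrite r'0).
have B0 : 0 <= B.
  by apply: le_trans (hB 0%N); rewrite mulr_ge0 ?exprn_ge0 ?nm_ge0 // ltW.
pose t := r / r'; have t01 : 0 <= t < 1.
  by rewrite divr_ge0 ?(ltW r0) ?(ltW r'0) //= ltr_pdivrMr // mul1r.
exists (B * (1 / (1 - t))) => n; rewrite nmM nm_nat.
have -> : n%:R * nm (c n) * r ^+ n = (nm (c n) * r' ^+ n) * (n%:R * t ^+ n).
  have : r' ^+ n != 0 by rewrite expf_neq0 // lt0r_neq0.
  rewrite /t expr_div_n; move: (r' ^+ n) (r ^+ n) (nm _) => u1 u2 u3 u10.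
  by field.
apply: ler_pM => //.
- by rewrite mulr_ge0 ?exprn_ge0 ?nm_ge0 // ltW.
- by rewrite mulr_ge0 ?exprn_ge0 //; case/andP: t01.
(* n t^n is at most 1 + t + ... + t^(n-1). *)
apply: le_trans (sum_geometric_le 0 n t01).
rewrite mulr_natl -[X in _ *+ X]subn0 -sumr_const_nat.
apply: ler_sum_nat => i /andP[_ lt]; have /andP[t0 t1] := t01.
by rewrite ler_wiXn2l ?(ltW t1) // ltnW.
Qed.

Lemma tame_e2pii_bound c (y0 : R) : tame c -> 0 < y0 ->
  exists B r : R, [/\ 0 <= B, 0 <= r < 1 & forall n z, y0 <= complex.Im z ->
    nm (c n * e z ^+ n) <= B * r ^+ n].
Proof.
move=> hc y00; pose rho := expR (- 2 * pi * y0).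
have rho0 : 0 < rho by rewrite expR_gt0.
have rho1 : rho < 1 by rewrite expR_lt1 !mulNr oppr_lt0 !mulr_gt0 ?pi_gt0.
pose r' := (1 + rho) / 2.
have rr' : rho < r' by rewrite /r' ltr_pdivlMr //; lra.
have r'1 : r' < 1 by rewrite /r' ltr_pdivrMr //; lra.
have r'0 : 0 < r' by apply: lt_trans rr'.
clearbody r'.
have [B hB] := hc r' ltac:(by rewrite r'0).
have B0 : 0 <= B.
  by apply: le_trans (hB 0%N); rewrite mulr_ge0 ?exprn_ge0 ?nm_ge0 // ltW.
exists B, (rho / r'); split => //.
  by rewrite divr_ge0 ?(ltW rho0) ?(ltW r'0) //= ltr_pdivrMr // mul1r.
move=> n z hz; rewrite nmM nmX.
apply: le_trans (_ : nm (c n) * rho ^+ n <= _).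
  rewrite ler_wpM2l ?nm_ge0 // lerXn2r ?nnegrE ?nm_ge0 ?(ltW rho0) //.
  exact: nm_e2pii_le.
have -> : nm (c n) * rho ^+ n = (nm (c n) * r' ^+ n) * (rho / r') ^+ n.
  have : r' ^+ n != 0 by rewrite expf_neq0 // lt0r_neq0.
  rewrite expr_div_n; move: (r' ^+ n) (rho ^+ n) (nm _) => u1 u2 u3 u10.
  by field.
by rewrite ler_wpM2r // exprn_ge0 // divr_ge0 ?(ltW rho0) ?(ltW r'0).
Qed.

(** The value is arbitrary where the series diverges. *)
Definition qser c z : C := xget 0 [set s | sums_to (fun n => c n * e z ^+ n) s].

Lemma qser_unique c z s : sums_to (fun n => c n * e z ^+ n) s -> qser c z = s.
Proof.
move=> hs; rewrite /qser; case: xgetP => [t _ ht|/(_ s) //].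
exact: sums_to_unique ht hs.
Qed.

Lemma qser_tail c (y0 : R) : tame c -> 0 < y0 ->
  exists B r : R, [/\ 0 <= B, 0 <= r < 1 & forall z, y0 <= complex.Im z ->
    forall M, nm (qser c z - \sum_(i < M) c i * e z ^+ i) <= B * r ^+ M].
Proof.
move=> hc y00; have [B [r [B0 r01 hB]]] := tame_e2pii_bound hc y00.
have /andP[r0 r1] := r01.
exists (2 * B / (1 - r)), r; split => // [|z hz M].
  by rewrite divr_ge0 ?mulr_ge0 // subr_ge0 ltW.
have [s [hs hM]] := geometric_sum r01 (fun n => hB n z hz).
by rewrite (qser_unique hs).
Qed.

Lemma qserP c z : tame c -> H z -> sums_to (fun n => c n * e z ^+ n) (qser c z).
Proof.
move=> hc hz; have [B [r [B0 r01 hB]]] := tame_e2pii_bound hc hz.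
have [s [hs hM]] := geometric_sum r01 (fun n => hB n z (lexx _)).
by rewrite (qser_unique hs).
Qed.

Lemma qser_lin a c d z : tame c -> tame d -> H z ->
  qser (fun n => a * c n + d n) z = a * qser c z + qser d z.
Proof.
move=> hc hd hz; apply: qser_unique.
have := sums_to_lin a (qserP hc hz) (qserP hd hz).
rewrite (_ : (fun n => a * (c n * _) + _) = (fun n => (a * c n + d n) * e z ^+ n)) //.
by apply/funext => n; ring.
Qed.

Lemma qser_cusp c (y0 : R) : tame c -> c 0%N = 0 -> 0 < y0 ->
  exists2 B : R, 0 <= B & forall z, y0 <= complex.Im z ->
    nm (qser c z) <= B * expR (- 2 * pi * (complex.Im z - y0)).
Proof.
move=> hc c0 y00; have [B [r [B0 r01 hB]]] := tame_e2pii_bound hc y00.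
have /andP[r0 r1] := r01.
exists (2 * B / (1 - r)).
  by rewrite divr_ge0 ?mulr_ge0 // subr_ge0 ltW.
move=> z hz; set t := expR _.
have t1 : t <= 1 by rewrite expR_le1 !mulNr oppr_le0 !mulr_ge0 ?pi_ge0 // subr_ge0.
have t0 : 0 <= t by exact: expR_ge0.
have hb n : nm (c n * e z ^+ n) <= (B * t) * r ^+ n.
  case: n => [|n]; first by rewrite c0 mul0r nm0 !mulr_ge0.
  pose z0 : C := complex.Re z +i* y0.
  have -> : nm (c n.+1 * e z ^+ n.+1) = nm (c n.+1 * e z0 ^+ n.+1) * t ^+ n.+1.
    rewrite !nmM !nmX -mulrA -exprMn !nm_e2pii -expRD.
    by congr (_ * expR _ ^+ _); rewrite /=; ring.
  rewrite mulrAC; apply: ler_pM; rewrite ?nm_ge0 ?exprn_ge0 ?hB //=.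
  by rewrite exprS ler_piMr // exprn_ile1.
have [s [hs hM]] := geometric_sum r01 hb.
rewrite (qser_unique hs); have := hM 0%N; rewrite big_ord0 subr0 expr0 mulr1.
by move/le_trans; apply; rewrite le_eqVlt; apply/orP; left; apply/eqP; ring.
Qed.

(** Term by term, the second order estimate bounds the remainder by a series in
    [n^2 c_n], which converges since [n^2 c_n] is [tame]. *)
Lemma cderiv_qser c z : tame c -> H z ->
  cderiv (qser c) z (twopii R * qser (fun n => n%:R * c n) z).
Proof.
move=> hc hz; have y0 : 0 < complex.Im z / 2 by rewrite divr_gt0.
have t1 := tame_natM hc; have t2 := tame_natM t1.
have [B [r [B0 r01 hB]]] := tame_e2pii_bound t2 y0.
have /andP[r0 r1] := r01; have r10 : 0 < 1 - r by rewrite subr_gt0.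
pose K := (2 * pi) ^+ 2 * (B / (1 - r)) : R.
have K0 : 0 <= K by rewrite mulr_ge0 ?exprn_even_ge0 ?divr_ge0 ?(ltW r10).
suff quad h : nm h < complex.Im z / 2 ->
    nm (qser c (z + h) - qser c z - twopii R * qser (fun n => n%:R * c n) z * h)
      <= K * nm h ^+ 2.
  move=> eps eps0; exists (Num.min (complex.Im z / 2) (eps / (1 + K))).
    by rewrite lt_min y0 divr_gt0 // ltr_wpDr.
  move=> h; rewrite lt_min => /andP[/quad hh h2]; apply: le_trans hh _.
  rewrite expr2 mulrA ler_wpM2r ?nm_ge0 //.
  apply: le_trans (_ : (1 + K) * nm h <= _); first by rewrite ler_wpM2r ?nm_ge0 // lerDr.
  by rewrite mulrC -ler_pdivlMr ?ltW // ltr_wpDr.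
move=> hh.
have y_lt : complex.Im z / 2 <= complex.Im z by rewrite ler_pdivrMr // mulr_natr mulr2n lerDl ltW.
have hzh : H (z + h) by apply: H_open => //; apply: lt_le_trans y_lt.
have yzh : complex.Im z / 2 <= complex.Im (z + h).
  rewrite ImD; have := le_lt_trans (Im_le_nm h) hh.
  by rewrite ltr_norml => /andP[h1 _]; lra.
pose term n := c n * e (z + h) ^+ n - c n * e z ^+ n - twopii R * (n%:R * c n * e z ^+ n) * h.
have bterm n : nm (term n) <= (2 * pi) ^+ 2 * (B * r ^+ n) * nm h ^+ 2.
  have -> : term n = (c n * e (z + h) ^+ n) - (c n * e z ^+ n)
     - (c n * (twopii R * n%:R * e z ^+ n)) * h by rewrite /term; ring.
  apply: (taylor2_H (F := fun w => c n * e w ^+ n)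
     (F1 := fun w => c n * (twopii R * n%:R * e w ^+ n))
     (F2 := fun w => c n * (twopii R * n%:R * (twopii R * n%:R * e w ^+ n)))
     (y := complex.Im z / 2)) => //.
  - by move=> w _; apply: cderivZ; exact: cderiv_e2piiX.
  - by move=> w _; apply: cderivZ; apply: cderivZ; exact: cderiv_e2piiX.
  - by apply: mulr_ge0; [exact: exprn_even_ge0 | apply: mulr_ge0 => //; exact: exprn_ge0].
  move=> w _ yw.
  have -> : c n * (twopii R * n%:R * (twopii R * n%:R * e w ^+ n)) =
    twopii R ^+ 2 * (n%:R * (n%:R * c n) * e w ^+ n) by ring.
  rewrite nmM nmX nm_twopii ler_wpM2l ?exprn_even_ge0 //; exact: hB.
set D := nm _; apply/ler_addgt0Pr => eps eps0.
have S : sums_to term (qser c (z + h) - qser c z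
    - twopii R * qser (fun n => n%:R * c n) z * h).
  have s1 := qserP hc hzh; have s2 := qserP hc hz; have s3 := qserP t1 hz.
  move: s1 s2 s3; move: (qser c (z + h)) (qser c z) (qser (fun n => n%:R * c n) z).
  move=> v1 v2 v3 s1 s2 s3.
  have := sums_to_lin (- 1) s2 s1; move=> s12.
  have := sums_to_lin (- (twopii R * h)) s3 s12.
  rewrite (_ : (fun n => _) = term); last by apply/funext => n; rewrite /term; ring.
  have -> : - (twopii R * h) * v3 + (- 1 * v2 + v1) = v1 - v2 - twopii R * v3 * h.
    by ring.
  by [].
have [M0 /(_ M0 (leqnn _)) hM] := S eps eps0.
rewrite /D; set X := _ - _ * h in hM *.
have -> : X = (X - \sum_(i < M0) term i) + \sum_(i < M0) term i by rewrite subrK.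
apply: le_trans (nmD _ _) _; rewrite addrC; apply: lerD => //.
apply: le_trans (nm_sum _ _ _) _.
apply: le_trans (_ : \sum_(i < M0) (2 * pi) ^+ 2 * (B * r ^+ i) * nm h ^+ 2 <= _).
  by apply: ler_sum => i _; exact: bterm.
rewrite -mulr_suml -mulr_sumr -mulr_sumr /K ler_wpM2r ?exprn_even_ge0 //.
rewrite ler_wpM2l ?exprn_even_ge0 // ler_wpM2l //.
have := @sum_geometric_le r 0 M0 r01; rewrite big_mkord expr0 mul1r.
by [].
Qed.

End QSeries.

(** * Bessel's inequality *)

Section Bessel.
Variable R : realType.
Local Notation C := R[i].
Local Notation H := (@upper_half R).
Local Notation e := (@e2pii R).
Implicit Types (c d : nat -> C) (z w : C).

Lemma cos_neq1 (t : R) : 0 < t < 2 * pi -> cos t != 1.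
Proof.
move=> /andP[t0 t2]; have s0 : 0 < sin (t / 2).
  by apply: sin_gt0_pi; rewrite divr_gt0 //= ltr_pdivrMr // mulrC.
have -> : cos t = 1 - sin (t / 2) ^+ 2 *+ 2.
  have -> : cos t = cos (t / 2 + t / 2) by rewrite -splitr.
  by rewrite cosD; have := cos2Dsin2 (t / 2); lra.
rewrite -subr_eq0 addrAC subrr add0r oppr_eq0 mulrn_eq0 /= expf_eq0 /=.
exact: lt0r_neq0.
Qed.

Lemma e2pii_primitive_root (M : nat) : (0 < M)%N ->
  M.-primitive_root (e (M%:R^-1)%:C).
Proof.
move=> M0; set w := e _.
have wM : w ^+ M = 1.
  rewrite -e2piiX natC -rmorphM mulfV ?pnatr_eq0 -?lt0n //.
  by rewrite rmorph1 e2pii1.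
have [m mp /dvdn_leq -/(_ M0)] := prim_order_exists M0 wM.
rewrite leq_eqVlt => /orP[/eqP <- //|lt].
have m0 := prim_order_gt0 mp.
have := prim_expr_order mp; rewrite -e2piiX natC -rmorphM /e2pii /=.
rewrite mulr0 expR0 mul1r => /(congr1 (@complex.Re R)) /= /eqP.
rewrite (negbTE (cos_neq1 _)) //.
have pi2 : 0 < 2 * pi :> R by rewrite mulr_gt0 ?pi_gt0.
by rewrite pmulr_rgt0 // divr_gt0 ?ltr0n //= gtr_pMr // ltr_pdivrMr ?ltr0n // mul1r ltr_nat.
Qed.

Lemma nm_sqrC z : ((nm z) ^+ 2)%:C = z * z^*%C.
Proof.
have -> : (nm z ^+ 2)%:C = (nm z)%:C ^+ 2 by exact: rmorphXn.
by rewrite -nm_normr sqr_normc.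
Qed.

(** Orthogonality of the characters of the cyclic group of order [M]. *)
Lemma discrete_parseval (M : nat) (a : nat -> C) : (0 < M)%N ->
  \sum_(j < M) nm (\sum_(n < M) a n * e (M%:R^-1)%:C ^+ (j * n)) ^+ 2 =
  M%:R * \sum_(n < M) nm (a n) ^+ 2.
Proof.
move=> M0; apply: (fmorph_inj (real_complex R)) => /=.
have wp := e2pii_primitive_root M0; set w := e _ in wp *.
have ww : w * w^*%C = 1.
  by rewrite -nm_sqrC /w nm_e2pii /= mulr0 expR0 expr1n rmorph1.
clearbody w; rewrite rmorphM !rmorph_sum rmorph_nat.
transitivity (\sum_(j < M) \sum_(n < M) \sum_(m < M)
    a n * (a m)^*%C * (w ^+ n * w^*%C ^+ m) ^+ j).
  apply: eq_bigr => j _; rewrite [LHS]nm_sqrC rmorph_sum big_distrlr /=.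
  apply: eq_bigr => n _; apply: eq_bigr => m _.
  rewrite rmorphM rmorphXn. rewrite mulrACA exprMn -!exprM.
  by rewrite [(n * j)%N]mulnC [(m * j)%N]mulnC.
rewrite exchange_big mulr_sumr; apply: eq_bigr => n _; rewrite exchange_big /=.
rewrite (bigD1 n) //= [X in _ + X]big1 => [|m neq].
  rewrite -exprMn ww expr1n (eq_bigr (fun=> a n * (a n)^*%C)); last first.
    by move=> j _; rewrite expr1n mulr1.
  by rewrite sumr_const card_ord addr0 -[RHS]/(_ * real_complex R _) nm_sqrC mulr_natl.
rewrite -mulr_sumr; apply/eqP; rewrite mulf_eq0; apply/orP; right.
set u := w ^+ n * _.
have uM : u ^+ M = 1.
    rewrite exprMn -!exprM [(n * M)%N]mulnC [(m * M)%N]mulnC !exprM (prim_expr_order wp).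
  have -> : w^*%C ^+ M = 1.
    by have := congr1 (fun t => t ^+ M) ww; rewrite /= exprMn (prim_expr_order wp) mul1r expr1n.
  by rewrite !expr1n mulr1.
have u1 : u - 1 != 0.
  apply: contra neq; rewrite subr_eq0 => /eqP ue.
  have : w ^+ m == w ^+ n.
    have : u * w ^+ m = w ^+ m by rewrite ue mul1r.
    by rewrite /u -mulrA -exprMn [_^*%C * w]mulrC ww expr1n mulr1 => ->.
  by rewrite (eq_prim_root_expr wp) !modn_small // => /eqP/val_inj ->.
have /eqP := subrX1 u M; rewrite uM subrr eq_sym mulf_eq0 (negbTE u1) /=.
by [].
Qed.

(** Sample the series at [M] equidistant points of height [y], and let [M] be so
    large that the sum is close to its [M]-th partial sum, to which
    [discrete_parseval] applies. *)
Lemma bessel c (y K : R) : tame c -> 0 < y ->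
  (forall x : R, nm (qser c (x +i* y)) <= K) ->
  forall L, \sum_(n < L) (nm (c n) * expR (- 2 * pi * y) ^+ n) ^+ 2 <= K ^+ 2.
Proof.
move=> hc y0 hK L; have K0 : 0 <= K by apply: le_trans (hK 0); exact: nm_ge0.
set S := \sum_(n < L) _.
have S0 : 0 <= S by apply: sumr_ge0 => i _; exact: sqr_ge0.
suff : Num.sqrt S <= K.
  by rewrite -(ler_pXn2r (n := 2)) ?nnegrE ?sqrtr_ge0 // sqr_sqrtr.
apply/ler_addgt0Pr => eps eps0.
rewrite -(ler_pXn2r (n := 2)) ?nnegrE ?sqrtr_ge0 ?addr_ge0 ?(ltW eps0) // sqr_sqrtr //.
have [B [r [B0 r01 hB]]] := qser_tail hc y0.
have [M0 hM0] := expr_small r01 B0 eps0.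
pose M := (maxn M0 L).+1.
have ML : (L <= M)%N by rewrite leqW // leq_maxr.
have MM0 : (M0 <= M)%N by rewrite leqW // leq_maxl.
pose a n : C := c n * e (0 +i* y) ^+ n.
apply: le_trans (_ : \sum_(n < M) nm (a n) ^+ 2 <= _).
  have -> : S = \sum_(n < L) nm (a n) ^+ 2.
    by apply: eq_bigr => n _; rewrite /a nmM nmX nm_e2pii.
  rewrite -(big_mkord xpredT (fun n => nm (a n) ^+ 2)) -(big_mkord xpredT (fun n => nm (a n) ^+ 2)).
  rewrite (big_cat_nat _ ML) //= lerDl; apply: sumr_ge0 => i _; exact: sqr_ge0.
have M1 : 0 < M%:R :> R by rewrite ltr0n.
rewrite -(ler_pM2l M1) -discrete_parseval //.
have -> : M%:R * (K + eps) ^+ 2 = \sum_(j < M) (K + eps) ^+ 2.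
  by rewrite sumr_const card_ord mulr_natl.
apply: ler_sum => j _.
rewrite lerXn2r ?nnegrE ?nm_ge0 ?addr_ge0 ?(ltW eps0) //.
pose z : C := (j%:R / M%:R) +i* y.
have -> : \sum_(n < M) a n * e (M%:R^-1)%:C ^+ (j * n) = \sum_(n < M) c n * e z ^+ n.
  apply: eq_bigr => n _; rewrite /a -mulrA; congr (_ * _).
  rewrite exprM -exprMn -e2piiX -e2piiD; congr (e _ ^+ _).
  rewrite natC -rmorphM /z; apply/eqP; rewrite eq_complex /=.
  by rewrite add0r addr0 !eqxx.
set T := \sum_(n < M) _.
have -> : T = qser c z - (qser c z - T) by ring.
apply: le_trans (nmB _ _) _; apply: lerD; first exact: hK.
by apply: le_trans (hB z _ M) _ => //; apply: hM0.
Qed.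

Lemma coef_bound c (y K : R) n : tame c -> 0 < y ->
  (forall x : R, nm (qser c (x +i* y)) <= K) ->
  nm (c n) * expR (- 2 * pi * y) ^+ n <= K.
Proof.
move=> hc y0 hK; have K0 : 0 <= K by apply: le_trans (hK 0); exact: nm_ge0.
have t0 : 0 <= nm (c n) * expR (- 2 * pi * y) ^+ n.
  by rewrite mulr_ge0 ?nm_ge0 // exprn_ge0 // expR_ge0.
rewrite -(ler_pXn2r (n := 2)) ?nnegrE //.
apply: le_trans (bessel hc y0 hK n.+1); rewrite big_ord_recr /= lerDr.
by apply: sumr_ge0 => i _; exact: sqr_ge0.
Qed.

Lemma qser_eq0 c : tame c -> (forall z, H z -> qser c z = 0) -> forall n, c n = 0.
Proof.
move=> hc h n; apply: nm_eq0; apply/eqP; rewrite eq_le nm_ge0 andbT.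
have := @coef_bound c 1 0 n hc ltr01.
rewrite pmulr_lle0 ?exprn_gt0 ?expR_gt0 //; apply=> x.
by rewrite h ?nm0 //= /upper_half /=.
Qed.

Lemma qser_inj c d : tame c -> tame d -> (forall z, H z -> qser c z = qser d z) ->
  c =1 d.
Proof.
move=> hc hd h n; apply/eqP; rewrite -subr_eq0.
have t : tame (fun n => (-1) * d n + c n).
  move=> r r01; have [B1 h1] := hc r r01; have [B2 h2] := hd r r01.
  exists (B1 + B2) => m; have /andP[r0 _] := r01.
  apply: le_trans (_ : nm (c m) * r ^+ m + nm (d m) * r ^+ m <= _); last exact: lerD.
  rewrite -mulrDl ler_wpM2r ?exprn_ge0 ?(ltW r0) // mulN1r addrC.
  exact: nmB.
have := @qser_eq0 _ t _ n; rewrite mulN1r addrC => -> // z hz.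
by rewrite qser_lin // h // mulN1r addrC subrr.
Qed.

(** A [q]-expansion starts at index 1 and leaves [a 0] arbitrary. *)
Definition coefs0 (a : nat -> C) (n : nat) : C := if n is 0 then 0 else a n.

Lemma q_expansion_qser (f : C -> C) (a : nat -> C) : q_expansion f a ->
  tame (coefs0 a) /\ forall z, H z -> f z = qser (coefs0 a) z.
Proof.
move=> hq.
have sums z : H z -> sums_to (fun n => coefs0 a n * e z ^+ n) (f z).
  move=> hz eps eps0.
  have /cvgrPdist_le /(_ eps%:C) := hq z hz.
  rewrite ltcR => /(_ eps0) [M0 _ hM]; exists M0.+1 => M ltM.
  have := hM M (ltnW ltM); rewrite /= nm_normr lecR => h.
  rewrite -(big_mkord xpredT (fun n => coefs0 a n * e z ^+ n)) big_ltn ?(leq_trans _ ltM) //.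
  rewrite mul0r add0r; apply: le_trans h; rewrite le_eqVlt; apply/orP; left.
  apply/eqP; congr (nm (_ - _)); apply: eq_big_nat => i /andP[i1 _].
  by rewrite e2piiX; case: i i1.
suff t : tame (coefs0 a).
  by split=> // z hz; apply/esym/qser_unique/sums.
move=> r /andP[r0 r1].
pose y : R := - ln r / (2 * pi).
have pi2 : 0 < 2 * pi :> R by rewrite mulr_gt0 ?pi_gt0.
have y0 : 0 < y by rewrite divr_gt0 // oppr_gt0 ln_lt0 // r0.
have ey : nm (e (0 +i* y)) = r.
  rewrite nm_e2pii /= !mulNr /y mulrC divfK ?lt0r_neq0 // opprK lnK //.
have [M0 hM] := sums (0 +i* y) y0 1 ltr01.
pose B := \sum_(i < M0) nm (coefs0 a i) * r ^+ i.
have B0 : 0 <= B.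
  by apply: sumr_ge0 => i _; rewrite mulr_ge0 ?nm_ge0 ?exprn_ge0 // ltW.
exists (B + 2) => n; have [lt|le] := ltnP n M0.
  rewrite /B (bigD1 (Ordinal lt)) //= -addrA lerDl addr_ge0 //.
  by apply: sumr_ge0 => i _; rewrite mulr_ge0 ?nm_ge0 ?exprn_ge0 // ltW.
have h1 := hM n le; have := hM n.+1 (leqW le); rewrite big_ord_recr /=.
set S := \sum_(i < n) _ in h1 *; set T := coefs0 a n * _ => h2.
have -> : nm (coefs0 a n) * r ^+ n = nm T by rewrite /T nmM nmX ey.
have -> : T = (f (0 +i* y) - S) - (f (0 +i* y) - (S + T)) by ring.
apply: le_trans (nmB _ _) _; apply: le_trans (lerD h1 h2) _.
by rewrite lerDr.
Qed.

End Bessel.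

(** * Integer matrices acting on the half-plane and on polynomials *)

Section IntegerMatrices.
Implicit Types (g h : 'M[int]_2).

Definition mx2 (a b c d : int) : 'M[int]_2 :=
  \matrix_(i, j) if i == 0 then (if j == 0 then a else b)
                 else (if j == 0 then c else d).

Lemma ord2P (i : 'I_2) : i = 0 \/ i = 1.
Proof. by case: i => [[|[|i]] lt] //; [left|right]; apply: val_inj. Qed.

Lemma mx2_eq g h : g 0 0 = h 0 0 -> g 0 1 = h 0 1 -> g 1 0 = h 1 0 ->
  g 1 1 = h 1 1 -> g = h.
Proof.
by move=> *; apply/matrixP => i j; case: (ord2P i) => ->; case: (ord2P j) => ->.
Qed.

Lemma mulmx2E g h i j : (g *m h) i j = g i 0 * h 0 j + g i 1 * h 1 j.
Proof.
rewrite mxE big_ord_recl big_ord1; congr (_ + g i _ * h _ j); exact: val_inj.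
Qed.

Lemma det2E g : \det g = g 0 0 * g 1 1 - g 0 1 * g 1 0.
Proof.
rewrite (expand_det_row _ 0) big_ord_recl big_ord1 /cofactor !det_mx11 !mxE /=.
rewrite expr0 expr1 mul1r mulN1r mulrN.
by congr (_ * g _ _ - g _ _ * g _ _); apply: val_inj.
Qed.

Lemma det_mx2 a b c d : \det (mx2 a b c d) = a * d - b * c.
Proof. by rewrite det2E !mxE. Qed.

End IntegerMatrices.

Section Moebius.
Variable R : realType.
Local Notation C := R[i].
Local Notation H := (@upper_half R).
Implicit Types (g h : 'M[int]_2) (z w : C).

Definition jf g z : C := (g 1 0)%:~R * z + (g 1 1)%:~R.
Definition mob g z : C := ((g 0 0)%:~R * z + (g 0 1)%:~R) / jf g z.

Lemma slashE k g (f : C -> C) z : slash k g f z = jf g z ^- k * f (mob g z).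
Proof. by []. Qed.

Lemma det_row_neq0 g : 0 < \det g -> (g 1 0 != 0) || (g 1 1 != 0).
Proof.
rewrite det2E; case: eqVneq => //= ->; case: eqVneq => //= ->.
by rewrite !mulr0 subrr ltxx.
Qed.

Lemma jf_neq0 g z : 0 < \det g -> H z -> jf g z != 0.
Proof.
move=> /det_row_neq0 h hz; apply/eqP; rewrite /jf !intC => e.
have := congr1 (@complex.Im R) e; rewrite ImD ImZ /= addr0 => /eqP.
rewrite mulf_eq0 (gt_eqF hz) orbF intr_eq0 => /eqP c0.
move: e; rewrite c0 mulr0z rmorph0 mul0r add0r => /(congr1 (@complex.Re R)) /= /eqP.
by rewrite intr_eq0 => /eqP d0; rewrite c0 d0 eqxx in h.
Qed.

Lemma Im_mob g z : 0 < \det g -> H z ->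
  complex.Im (mob g z) = (\det g)%:~R * complex.Im z / nm (jf g z) ^+ 2.
Proof.
move=> dg hz; have j0 := jf_neq0 dg hz.
rewrite /mob nm_sqr det2E /jf !intC.
have : nm (jf g z) ^+ 2 != 0 by rewrite expf_neq0 // lt0r_neq0 // nm_gt0.
rewrite nm_sqr /jf !intC; case: z {hz j0} => x y /=.
rewrite !mul0r !subr0 !addr0 rmorphB !rmorphM /= => h.
by field.
Qed.

Lemma mob_H g z : 0 < \det g -> H z -> H (mob g z).
Proof.
move=> dg hz; rewrite /upper_half /= Im_mob // divr_gt0 //.
  by rewrite mulr_gt0 // ltr0z.
by rewrite exprn_gt0 // nm_gt0 // jf_neq0.
Qed.

Lemma jfM g h z : 0 < \det h -> H z -> jf (g *m h) z = jf g (mob h z) * jf h z.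
Proof.
move=> dh hz; have j0 := jf_neq0 dh hz; move: j0.
rewrite /mob /jf !mulmx2E !rmorphD !rmorphM /= => j0. by field.
Qed.

Lemma mobM g h z : 0 < \det g -> 0 < \det h -> H z ->
  mob (g *m h) z = mob g (mob h z).
Proof.
move=> dg dh hz; have j0 := jf_neq0 dh hz.
have j1 := jf_neq0 dg (mob_H dh hz).
rewrite {1}/mob jfM // [RHS]/mob !mulmx2E !rmorphD !rmorphM /=.
move: (jf g _) j1 => u j1; move: j0; rewrite /mob /jf => j0.
by field; rewrite j0 j1.
Qed.

Lemma slashM k g h (f : C -> C) z : 0 < \det g -> 0 < \det h -> H z ->
  slash k (g *m h) f z = slash k h (slash k g f) z.
Proof.
move=> dg dh hz; rewrite !slashE jfM // mobM // exprMn invfM mulrA.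
by congr (_ * _); rewrite mulrC.
Qed.

(** The reason why Eichler integrals are equivariant: the kernel [X - z] is
    multiplied by factors that depend on [X] and on [z] separately. *)
Lemma mob_sub g X z : 0 < \det g -> H X -> H z ->
  mob g X - mob g z = (\det g)%:~R * (X - z) / (jf g X * jf g z).
Proof.
move=> dg hX hz; have := jf_neq0 dg hX; have := jf_neq0 dg hz.
rewrite /mob det2E rmorphB !rmorphM /= /jf => h1 h2.
by field; rewrite h1 h2.
Qed.

Lemma cderiv_affine (a b z : C) : cderiv (fun w => a * w + b) z a.
Proof.
rewrite -[X in cderiv _ _ X]addr0 -{2}[a]mulr1.
apply: cderivD; last exact: cderiv_cst.
by apply: cderivZ; exact: cderiv_id.
Qed.

Lemma cderiv_mob g z : 0 < \det g -> H z ->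
  cderiv (mob g) z ((\det g)%:~R / jf g z ^+ 2).
Proof.
move=> dg hz; have j0 := jf_neq0 dg hz.
have h1 := cderiv_affine (g 0 0)%:~R (g 0 1)%:~R z.
have h2 : cderiv (jf g) z (g 1 0)%:~R := cderiv_affine _ _ z.
have := cderivM h1 (cderiv_comp h2 (cderivV j0)).
congr (cderiv _ _ _); rewrite det2E rmorphB !rmorphM /=.
by move: j0; rewrite /jf => j0; field.
Qed.

(** The points [i, 2i, 3i, ...] outnumber the roots of a nonzero difference. *)
Lemma poly_eq_H (p q : {poly C}) : (forall X, H X -> p.[X] = q.[X]) -> p = q.
Proof.
move=> h; apply/eqP; rewrite -subr_eq0; apply: contraT => n0.
pose r := p - q; pose s : seq C := [seq 0 +i* (m.+1%:R : R) | m <- iota 0 (size r)].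
have : (size s < size r)%N.
  apply: max_poly_roots => //.
    apply/allP => _ /mapP [m _ ->]; rewrite /root hornerD hornerN h ?subrr //.
    by rewrite /upper_half /=.
  rewrite map_inj_uniq ?iota_uniq // => a b [] /eqP.
  by rewrite eqr_nat eqSS => /eqP.
by rewrite size_map size_iota ltnn.
Qed.

End Moebius.

Section PolySlash.
Variables (R : realType) (n : nat).
Local Notation C := R[i].
Local Notation H := (@upper_half R).
Implicit Types (g h : 'M[int]_2) (p q : {poly C}).

(** The image of [X^i] under the action of [g] on polynomials of degree at most [n],
    over any ring: its integer coefficients become entries of the Hecke matrix. *)
Definition slash_basis (T : nzRingType) g (i : nat) : {poly T} :=
  ((g 0 0)%:~R *: 'X + (g 0 1)%:~R%:P) ^+ i *
  ((g 1 0)%:~R *: 'X + (g 1 1)%:~R%:P) ^+ (n - i).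

Definition pslash g p : {poly C} := \sum_(i < n.+1) p`_i *: slash_basis C g i.

Lemma size_slash_basis (T : idomainType) g i : (i <= n)%N ->
  (size (slash_basis T g i) <= n.+1)%N.
Proof.
move=> le; have s1 (a b : T) : (size (a *: 'X + b%:P)%R <= 2)%N.
  by rewrite (leq_trans (size_polyD _ _)) // geq_max
    (leq_trans (size_scale_leq _ _)) ?size_polyX // (leq_trans (size_polyC_leq1 _)).
have sX (a b : T) k : (size ((a *: 'X + b%:P) ^+ k)%R <= k.+1)%N.
  apply: leq_trans (size_poly_exp_leq _ _) _; rewrite ltnS.
  have := s1 a b; case: (size _) => [|[|[|m]]] //= _; rewrite ?mul0n ?mul1n //.
apply: leq_trans (size_polyMleq _ _) _.
have := leq_add (sX (g 0 0)%:~R (g 0 1)%:~R i) (sX (g 1 0)%:~R (g 1 1)%:~R (n - i)%N).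
by rewrite addSn addnS subnKC // -[X in (_ <= X)%N]/(n.+2.-1.+1) => h; case: (_ + _)%N h.
Qed.

Lemma size_pslash g p : (size (pslash g p) <= n.+1)%N.
Proof.
apply: leq_trans (size_sum _ _ _) _; apply/bigmax_leqP => i _.
apply: leq_trans (size_scale_leq _ _) _; apply: size_slash_basis.
by rewrite -ltnS.
Qed.

Lemma horner_pslash g p X : (size p <= n.+1)%N -> 0 < \det g -> H X ->
  (pslash g p).[X] = jf g X ^+ n * p.[mob g X].
Proof.
move=> sp dg hX; have j0 := jf_neq0 dg hX.
rewrite /pslash horner_sum (horner_coef_wide _ sp) mulr_sumr.
apply: eq_bigr => i _; rewrite hornerZ /slash_basis hornerM !horner_exp.
rewrite !hornerD !hornerZ !hornerX !hornerC -/(jf g X) /mob expr_div_n.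
have -> : jf g X ^+ n = jf g X ^+ i * jf g X ^+ (n - i).
  by rewrite -exprD subnKC // -ltnS.
have : jf g X ^+ i != 0 by rewrite expf_neq0.
move: (jf g X ^+ i) (jf g X ^+ (n - i)) ((_ * X + _) ^+ i) (p`_i) => a b c d a0.
by field.
Qed.

Lemma pslashD g p q : pslash g (p + q) = pslash g p + pslash g q.
Proof.
by rewrite /pslash -big_split; apply: eq_bigr => i _; rewrite coefD scalerDl.
Qed.

Lemma pslashZ g (a : C) p : pslash g (a *: p) = a *: pslash g p.
Proof.
by rewrite /pslash scaler_sumr; apply: eq_bigr => i _; rewrite coefZ scalerA.
Qed.

Lemma pslash0 g : pslash g 0 = 0.
Proof. by have := pslashZ g 0 0; rewrite !scale0r. Qed.

Lemma pslash_sum I (r : seq I) g (F : I -> {poly C}) :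
  pslash g (\sum_(i <- r) F i) = \sum_(i <- r) pslash g (F i).
Proof.
elim: r => [|i r IH]; first by rewrite !big_nil pslash0.
by rewrite !big_cons pslashD IH.
Qed.

Lemma pslashM g h p : (size p <= n.+1)%N -> 0 < \det g -> 0 < \det h ->
  pslash (g *m h) p = pslash h (pslash g p).
Proof.
move=> sp dg dh; apply: poly_eq_H => X hX.
have dgh : 0 < \det (g *m h) by rewrite det_mulmx mulr_gt0.
rewrite !horner_pslash ?size_pslash //; last exact: mob_H.
by rewrite jfM // mobM // exprMn; ring.
Qed.

Lemma coef_pslash g p j : (pslash g p)`_j =
  \sum_(i < n.+1) p`_i * ((slash_basis int g i)`_j)%:~R.
Proof.
rewrite /pslash coef_sum; apply: eq_bigr => i _; rewrite coefZ; congr (_ * _).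
have -> : slash_basis C g i = map_poly intr (slash_basis int g i).
  rewrite /slash_basis rmorphM !rmorphXn !rmorphD /= !linearZ /= !map_polyX !map_polyC /=.
  by rewrite !intz.
by rewrite coef_map.
Qed.

End PolySlash.

(** * Primitives of functions that vanish at infinity *)

Section Growth.
Variable R : realType.
Local Notation C := R[i].
Local Notation H := (@upper_half R).
Implicit Types (t s r u : C -> C) (z w : C) (p : {poly C}).

Definition vanish u : Prop := forall eps : R, 0 < eps ->
  exists Y : R, forall z, H z -> Y < complex.Im z -> nm (u z) <= eps.

Lemma vanish_lin a u s : vanish u -> vanish s -> vanish (fun z => a * u z + s z).
Proof.
move=> hu hs eps eps0.
have a1 : 0 < 1 + nm a by rewrite ltr_wpDr ?nm_ge0.
have [Y1 h1] := hu (eps / 2 / (1 + nm a)) ltac:(by rewrite !divr_gt0).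
have [Y2 h2] := hs (eps / 2) ltac:(by rewrite divr_gt0).
exists (Num.max Y1 Y2) => z hz; rewrite gt_max => /andP[/(h1 z hz) k1 /(h2 z hz) k2].
apply: le_trans (nmD _ _) _; rewrite [eps]splitr nmM; apply: lerD => //.
apply: le_trans (ler_wpM2l (nm_ge0 _) k1) _.
rewrite mulrCA ler_piMr ?divr_ge0 ?(ltW eps0) //.
by rewrite ler_pdivrMr // mul1r lerDr.
Qed.

Lemma vanish_eq u s : (forall z, H z -> u z = s z) -> vanish u -> vanish s.
Proof.
by move=> e hu eps /hu [Y hY]; exists Y => z hz /(hY z hz); rewrite e.
Qed.

Lemma vanish0 : vanish (fun=> 0).
Proof. by move=> eps eps0; exists 0 => z _ _; rewrite nm0 ltW. Qed.

Lemma above (Y : R) : exists z, H z /\ Y < complex.Im z.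
Proof.
exists (0 +i* (`|Y| + 1)); rewrite /upper_half /= ltr_pwDr //; split => //.
by apply: le_lt_trans (ler_norm Y) _; rewrite ltrDl.
Qed.

(** The leading term dominates along the imaginary axis. *)
Lemma vanish_poly_eq0 p : vanish (fun z => p.[z]) -> p = 0.
Proof.
move=> hp; apply/eqP; apply: contraT => pn0.
pose d := (size p).-1; pose cd := nm p`_d.
have cd0 : 0 < cd.
  by apply: nm_gt0; rewrite -[p`_d]/(lead_coef p) lead_coef_eq0.
pose S := \sum_(i < d) nm p`_i.
have S0 : 0 <= S by apply: sumr_ge0 => i _; exact: nm_ge0.
have [Y hY] := hp (cd / 2) ltac:(by rewrite divr_gt0).
pose T := `|Y| + 1 + S / cd + 1.
have Sc : 0 <= S / cd by rewrite divr_ge0 // ltW.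
have T1 : 1 <= T by rewrite /T lerDr !addr_ge0.
have T0 : 0 < T by apply: lt_le_trans T1.
have YT : Y < T.
  apply: le_lt_trans (ler_norm Y) _; rewrite /T; have := normr_ge0 Y; lra.
pose z : C := 0 +i* T; have nz : nm z = T.
  by rewrite nmE /= expr0n add0r sqrtr_sqr ger0_norm // ltW.
have := hY z T0 YT; rewrite leNgt => /negP [].
apply: lt_le_trans (_ : cd <= _); first by rewrite ltr_pdivrMr // ltr_pMr // ltr1n.
have E : p.[z] = \sum_(i < d) p`_i * z ^+ i + p`_d * z ^+ d.
  by rewrite horner_coef -(prednK (n := size p)) ?size_poly_gt0 // big_ord_recr.
have hd : nm (p`_d * z ^+ d) = cd * T ^+ d by rewrite nmM nmX nz.
have hs : nm (\sum_(i < d) p`_i * z ^+ i) <= S * T ^+ d.-1.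
  apply: le_trans (nm_sum _ _ _) _; rewrite mulr_suml; apply: ler_sum => i _.
  rewrite nmM nmX nz ler_wpM2l ?nm_ge0 // ler_weXn2l //.
  by rewrite -ltnS (ltn_predK (ltn_ord i)).
have hdiff : cd * T ^+ d <= nm p.[z] + S * T ^+ d.-1.
  rewrite -hd.
  have -> : p`_d * z ^+ d = p.[z] - \sum_(i < d) p`_i * z ^+ i by rewrite E addrAC subrr add0r.
  by apply: le_trans (nmB _ _) _; rewrite lerD2l.
have [d0|dn0] := posnP d.
  have SE : S = 0 by rewrite /S d0 big_ord0.
  by move: hdiff; rewrite SE d0 expr0 mulr1 mul0r addr0.
move: hdiff; rewrite -{1}(prednK dn0) exprS.
have TS : S + cd <= cd * T.
  have -> : cd * T = cd * (`|Y| + 1) + S + cd.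
    by rewrite /T; field; rewrite lt0r_neq0.
  have : 0 <= cd * (`|Y| + 1) by rewrite mulr_ge0 ?addr_ge0 // ltW.
  by lra.
have T2 : 1 <= T ^+ d.-1 by rewrite exprn_ege1.
move: (T ^+ d.-1) T2 => V V1 hV.
have : (S + cd) * V <= cd * T * V by rewrite ler_wpM2r // (le_trans ler01).
have : cd <= cd * V by rewrite ler_peMr // ltW.
by move: hV; rewrite mulrA; lra.
Qed.

Section Period.
Variable N : nat.
Hypothesis N0 : (0 < N)%N.

Definition periodic u := forall z, H z -> u (z + N%:R) = u z.

Lemma H_shift z (x : R) : H z -> H (z + x%:C).
Proof. by rewrite /upper_half /= ImD /= addr0. Qed.

Lemma H_shiftN z : H z -> H (z + N%:R).
Proof. by rewrite natC; exact: H_shift. Qed.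

Lemma cderiv_shift u z (a d : C) : cderiv u (z + a) d -> cderiv (fun w => u (w + a)) z d.
Proof.
move=> hu e /hu [r r0 hr]; exists r => // h /hr hh /=.
by rewrite [z + h + a]addrAC.
Qed.

Lemma cderivB u s z d d' : cderiv u z d -> cderiv s z d' ->
  cderiv (fun w => u w - s w) z (d - d').
Proof.
move=> hu hs; have := cderivD hu (cderivZ (-1) hs).
by rewrite mulN1r; congr cderiv; apply/funext => w; rewrite mulN1r.
Qed.

Lemma periodic_increment_const u s : periodic s ->
  (forall z, H z -> cderiv u z (s z)) ->
  exists b, forall z, H z -> u (z + N%:R) - u z = b.
Proof.
move=> ps hu; exists (u ('i%C + N%:R) - u 'i%C) => z hz.
apply: (cderiv0_constant (F := fun z => u (z + N%:R) - u z)) => //; last first.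
  by rewrite /upper_half /=.
move=> w hw; rewrite -(subrr (s w)); apply: cderivB; last exact: hu.
by apply: cderiv_shift; rewrite -(ps w hw); apply/hu/H_shiftN.
Qed.

(** The constant increment of [u] over a period is at most [N] times the supremum of
    its derivative, which is small high up. *)
Lemma periodic_of_vanish_deriv u s : periodic s -> vanish s ->
  (forall z, H z -> cderiv u z (s z)) -> periodic u.
Proof.
move=> ps vs hu; have [b hb] := periodic_increment_const ps hu.
suff b0 : b = 0 by move=> z hz; apply/eqP; rewrite -subr_eq0 hb // b0.
apply: nm_le_zero => eps eps0.
have NR : 0 < N%:R :> R by rewrite ltr0n.
have [Y hY] := vs (eps / N%:R) ltac:(by rewrite divr_gt0).
have [z [hz Yz]] := above Y.
have := @mean_value_H _ u s z (z + N%:R) (complex.Im z) (eps / N%:R) hu hz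
  (H_shiftN hz) (lexx _).
rewrite natC ImD /= addr0 lexx => /(_ isT) /(_ _); rewrite -natC hb //.
have -> : z + N%:R - z = N%:R by rewrite addrAC subrr add0r.
rewrite nm_nat divfK ?lt0r_neq0 //; apply => w hw zw.
by apply: hY => //; apply: lt_le_trans Yz zw.
Qed.

(** The mean of [s] over a period is an increment of its primitive [t], hence
    independent of the height, while [s] deviates little from its mean. *)
Lemma vanish_deriv_limit t s r :
  (forall z, H z -> cderiv t z (s z)) -> (forall z, H z -> cderiv s z (r z)) ->
  periodic r -> vanish r -> periodic s /\ exists c, vanish (fun z => s z - c).
Proof.
move=> ht hs pr vr; have ps := periodic_of_vanish_deriv pr vr hs.
split=> //; have [b hb] := periodic_increment_const ps ht.
exists (b / N%:R) => eps eps0.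
have NR : 0 < N%:R :> R by rewrite ltr0n.
have NC : N%:R != 0 :> C by rewrite pnatr_eq0 -lt0n.
have [Y hY] := vr (eps / N%:R) ltac:(by rewrite divr_gt0).
exists Y => z hz Yz.
have hzN := H_shiftN hz.
have e0 : z + N%:R - z = N%:R by rewrite addrAC subrr add0r.
have Imz : complex.Im (z + N%:R) = complex.Im z by rewrite natC ImD /= addr0.
have key : nm (t (z + N%:R) - t z - s z * N%:R) <= eps / N%:R * nm (N%:R : C) ^+ 2.
  apply: (taylor2_H (F2 := r) (y := complex.Im z)) => //.
  - by rewrite Imz.
  - by rewrite divr_ge0 // ltW.
  by move=> w hw zw; apply: hY => //; apply: lt_le_trans Yz zw.
have -> : s z - b / N%:R = - ((t (z + N%:R) - t z - s z * N%:R) / N%:R).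
  by rewrite hb //; field.
rewrite nmN nmM nmV nm_nat ler_pdivrMr //; apply: le_trans key _.
rewrite nm_nat le_eqVlt; apply/orP; left; apply/eqP; field; exact: lt0r_neq0.
Qed.

Lemma cauchy_vanish u :
  (forall eps : R, 0 < eps -> exists Y : R, forall z w, H z -> H w ->
     Y < complex.Im z -> Y < complex.Im w -> nm (u z - u w) <= eps) ->
  exists c, vanish (fun z => u z - c).
Proof.
have real_case (v : C -> R) : (forall eps : R, 0 < eps -> exists Y : R, forall z w, H z -> H w ->
     Y < complex.Im z -> Y < complex.Im w -> `|v z - v w| <= eps) ->
   exists c : R, forall eps : R, 0 < eps -> exists Y : R, forall z, H z ->
     Y < complex.Im z -> `|v z - c| <= eps.
  move=> hv; pose S := [set x : R | exists Y : R, forall z, H z -> Y < complex.Im z -> x <= v z].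
  have [Y1 hY1] := hv 1 ltr01; have [z1 [hz1 Yz1]] := above Y1.
  have hasS : has_sup S.
    split; first by exists (v z1 - 1), Y1 => z hz Yz;
      have := hY1 z1 z hz1 hz Yz1 Yz; rewrite ler_norml => /andP[_]; lra.
    exists (v z1 + 1) => x [Y hx]; have [z [hz]] := above (Num.max Y Y1).
    rewrite gt_max => /andP[/(hx z hz) h1 h2].
    by have := hY1 z1 z hz1 hz Yz1 h2; rewrite ler_norml => /andP[h3 _]; lra.
  exists (sup S) => eps eps0; have [Y hY] := hv eps eps0; exists Y => z hz Yz.
  rewrite ler_norml; apply/andP; split.
    rewrite lerBrDr addrC lerBlDr.
    apply: sup_le_ub; first by case: hasS.
    move=> x [Y' hx]; have [w [hw]] := above (Num.max Y Y').
    rewrite gt_max => /andP[h1 /(hx w hw) h2].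
    by have := hY z w hz hw Yz h1; rewrite ler_norml => /andP[h3 _]; lra.
  rewrite lerBlDr -lerBlDl; apply: ub_le_sup; first by case: hasS.
  exists Y => w hw Yw; have := hY z w hz hw Yz Yw; rewrite ler_norml => /andP[_]; lra.
move=> hu.
have [|c1 h1] := real_case (fun z => complex.Re (u z)).
  move=> eps /hu [Y hY]; exists Y => z w hz hw Yz Yw.
  apply: le_trans (hY z w hz hw Yz Yw); rewrite -ReN -ReD; exact: Re_le_nm.
have [|c2 h2] := real_case (fun z => complex.Im (u z)).
  move=> eps /hu [Y hY]; exists Y => z w hz hw Yz Yw.
  apply: le_trans (hY z w hz hw Yz Yw); rewrite -ImN -ImD; exact: Im_le_nm.
exists (c1 +i* c2) => eps eps0.
have [Y1 k1] := h1 (eps / 2) ltac:(by rewrite divr_gt0).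
have [Y2 k2] := h2 (eps / 2) ltac:(by rewrite divr_gt0).
exists (Num.max Y1 Y2) => z hz; rewrite gt_max => /andP[Yz1 Yz2].
apply: le_trans (nm_le_ReIm _) _; rewrite ReD ImD ReN ImN /= [eps]splitr.
by apply: lerD; [apply: k1 | apply: k2].
Qed.

(** Averages over [M] equidistributed points of a period are nearly independent
    of the height, because their derivative is a Riemann sum of the increment of
    [u] over the period. *)
Lemma vanish_deriv_limit0 u s r :
  (forall z, H z -> cderiv u z (s z)) -> (forall z, H z -> cderiv s z (r z)) ->
  periodic s -> vanish s -> vanish r -> exists c, vanish (fun z => u z - c).
Proof.
move=> hu hs ps vs vr; have pu := periodic_of_vanish_deriv ps vs hu.
apply: cauchy_vanish => eps eps0.
have NR : 0 < N%:R :> R by rewrite ltr0n.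
have [Y1 hY1] := vs (eps / 4 / N%:R) ltac:(by rewrite !divr_gt0).
have [Y2 hY2] := vr 1 ltr01.
exists (Num.max Y1 Y2) => z1 z2 hz1 hz2; rewrite !gt_max => /andP[Yz11 Yz12] /andP[Yz21 Yz22].
have [M Mbig] : exists M : nat, (0 < M)%N /\ N%:R * nm (z1 - z2) / M%:R <= eps / 2.
  pose x := N%:R * nm (z1 - z2) / (eps / 2).
  have x0 : 0 <= x by rewrite !divr_ge0 ?mulr_ge0 ?nm_ge0 // ltW.
  exists (Num.bound x); have hb := archi_boundP x0.
  have b0 : (0 < Num.bound x)%N by rewrite -(ltr_nat R); apply: le_lt_trans x0 hb.
  split=> //; rewrite ler_pdivrMr ?ltr0n // [eps / 2 * _]mulrC.
  by rewrite -ler_pdivrMr ?divr_gt0 // ltW.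
case: Mbig => M0 hM; have MR : 0 < M%:R :> R by rewrite ltr0n.
pose dx : R := N%:R / M%:R.
pose A z := M%:R^-1 * \sum_(j < M) u (z + (j%:R * dx)%:C).
pose dA z := M%:R^-1 * \sum_(j < M) s (z + (j%:R * dx)%:C).
have hA z : H z -> cderiv A z (dA z).
  move=> hz; apply: cderivZ; apply: cderiv_sum => j.
  by apply: cderiv_shift; apply/hu/H_shift.
pose y := Num.min (complex.Im z1) (complex.Im z2).
have y1 : y <= complex.Im z1 by rewrite ge_min lexx.
have y2 : y <= complex.Im z2 by rewrite ge_min lexx orbT.
have dA_bound w : H w -> y <= complex.Im w -> nm (dA w) <= N%:R / M%:R.
  move=> hw yw.
  pose p j := w + (j%:R * dx)%:C.
  have tele : \sum_(j < M) (u (p j.+1) - u (p j)) = 0.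
    rewrite -(big_mkord xpredT (fun j => u (p j.+1) - u (p j))) telescope_sumr //.
    rewrite /p mul0r rmorph0 addr0 /dx mulrC divfK ?lt0r_neq0 // -natC pu ?subrr //.
  have dxM : dx * M%:R = N%:R by rewrite /dx divfK ?lt0r_neq0.
  have dxC : dx%:C * M%:R = N%:R by rewrite !natC -rmorphM dxM.
  have dx0 : 0 < dx by rewrite divr_gt0.
  have -> : dA w = - ((\sum_(j < M) (u (p j.+1) - u (p j) - s (p j) * dx%:C)) / N%:R).
    rewrite sumrB tele sub0r -mulr_suml /dA -/p mulNr opprK -dxC.
    have : dx%:C != 0 :> C by rewrite -(rmorph0 (real_complex R)) (inj_eq (@complexI R)) lt0r_neq0.
    have : M%:R != 0 :> C by rewrite pnatr_eq0 -lt0n.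
    move: (\sum_(j < M) s _) => S k1 k2; by field; rewrite k1 k2.
  rewrite nmN nmM nmV nm_nat ler_pdivrMr //.
  apply: le_trans (nm_sum _ _ _) _.
  have term (j : nat) : nm (u (p j.+1) - u (p j) - s (p j) * dx%:C) <= 1 * nm (dx%:C : C) ^+ 2.
    have -> : p j.+1 = p j + dx%:C by rewrite /p -natr1 mulrDl mul1r rmorphD addrA.
    have ip : complex.Im (p j) = complex.Im w by rewrite /p ImD /= addr0.
    have hp : H (p j) by apply: H_shift.
    apply: (taylor2_H (F2 := r) (y := y)) => //.
    - exact: H_shift.
    - by rewrite ip.
    - by rewrite ImD /= addr0 ip.
    move=> v hv yv; apply: hY2 => //; apply: lt_le_trans yv.
    by rewrite lt_min Yz12 Yz22.
  apply: le_trans (_ : \sum_(j < M) 1 * nm (dx%:C : C) ^+ 2 <= _).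
    by apply: ler_sum => j _; exact: term.
  rewrite sumr_const card_ord mul1r nm_real ger0_norm ?(ltW dx0) //.
  by rewrite -[dx ^+ 2 *+ M]mulr_natr expr2 -[dx * dx * _]mulrA dxM.
have near_A z : H z -> Y1 < complex.Im z -> nm (u z - A z) <= eps / 4.
  move=> hz Yz.
  have -> : u z - A z = M%:R^-1 * \sum_(j < M) (u z - u (z + (j%:R * dx)%:C)).
    rewrite sumrB sumr_const card_ord /A -[u z *+ M]mulr_natr; field.
    by rewrite pnatr_eq0 -lt0n.
  rewrite nmM nmV nm_nat mulrC ler_pdivrMr //.
  apply: le_trans (nm_sum _ _ _) _.
  have -> : eps / 4 * M%:R = \sum_(j < M) eps / 4 by rewrite sumr_const card_ord mulr_natr.
  apply: ler_sum => j _; rewrite nmBC.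
  have hzj := H_shift (j%:R * dx) hz.
  have iz : complex.Im (z + (j%:R * dx)%:C) = complex.Im z by rewrite ImD /= addr0.
  apply: le_trans (mean_value_H (y := complex.Im z) (M := eps / 4 / N%:R) hu hz hzj _ _ _) _ => //.
  - by rewrite iz.
  - by move=> w hw zw; apply: hY1 => //; apply: lt_le_trans zw.
  have -> : z + (j%:R * dx)%:C - z = (j%:R * dx)%:C by rewrite addrAC subrr add0r.
  rewrite nm_real ger0_norm; last by rewrite mulr_ge0 // divr_ge0.
  rewrite -mulrA ler_piMr ?divr_ge0 ?(ltW eps0) // ler_pdivrMl // mulr1.
  rewrite /dx mulrCA ler_piMr ?(ltW NR) // ler_pdivrMr // mul1r ler_nat.
  exact: ltnW.
have hAA : nm (A z1 - A z2) <= N%:R / M%:R * nm (z1 - z2).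
  exact: mean_value_H hA hz2 hz1 y2 y1 dA_bound.
have -> : u z1 - u z2 = (u z1 - A z1) + (A z1 - A z2) + (A z2 - u z2) by ring.
apply: le_trans (nmD _ _) _; apply: le_trans (lerD (nmD _ _) (lexx _)) _.
rewrite [nm (A z2 - u z2)]nmBC.
have := near_A _ hz1 Yz11; have := near_A _ hz2 Yz21.
have : N%:R / M%:R * nm (z1 - z2) <= eps / 2 by rewrite mulrAC.
lra.
Qed.

Lemma cderiv_horner p z : cderiv (fun w => p.[w]) z p^`().[z].
Proof.
elim/poly_ind: p => [|p c IH].
  rewrite deriv0 horner0 (_ : (fun w => _) = fun=> 0); first exact: cderiv_cst.
  by apply/funext => w; rewrite horner0.
rewrite derivMXaddC hornerD hornerM hornerX.
rewrite (_ : (fun w => _) = (fun w => p.[w] * w + c)); last first.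
  by apply/funext => w; rewrite !hornerE.
rewrite addrC -[X in cderiv _ _ X]addr0; apply: cderivD; last exact: cderiv_cst.
by have := cderivM IH (cderiv_id z); rewrite mulr1.
Qed.

Lemma exists_antiderivative p : exists2 q, q^`() = p & (size q <= (size p).+1)%N.
Proof.
exists (\poly_(i < (size p).+1) (p`_i.-1 / i%:R)); last exact: size_poly.
apply/polyP => i; rewrite coef_deriv coef_poly ltnS /=.
have [lt|le] := ltnP i (size p); last by rewrite mul0rn nth_default.
by rewrite -[LHS]mulr_natr divfK ?pnatr_eq0.
Qed.

(** Going down the chain of derivatives, each step integrates the polynomial
    found so far and adds the constant given by [vanish_deriv_limit]. At the bottom
    no further primitive is at hand, and [vanish_deriv_limit0] takes over. *)
Lemma vanish_mod_poly (h : nat -> C -> C) (m : nat) : (1 < m)%N ->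
  (forall j, (j < m)%N -> forall z, H z -> cderiv (h j) z (h j.+1 z)) ->
  periodic (h m) -> vanish (h m) ->
  exists2 p : {poly C}, (size p <= m)%N & vanish (fun z => h 0%N z - p.[z]).
Proof.
move=> m2 hh pm vm.
pose Q j (p : {poly C}) := [/\ vanish (fun z => h j z - p.[z]), periodic (fun z => h j z - p.[z]) &
   vanish (fun z => h j.+1 z - p^`().[z])].
have step i : (i < m.-1)%N -> exists2 p : {poly C}, (size p <= i.+1)%N & Q (m - i.+1)%N p.
  elim: i => [|i IH] lt.
    case: m m2 hh pm vm lt @Q => [|[|m]] // _ hh pm vm _ Q.
    rewrite subn1 /=.
    have [ps [c vc]] := vanish_deriv_limit (hh m (leqW (leqnn _))) (hh m.+1 (leqnn _)) pm vm.
    exists c%:P; first by rewrite size_polyC leq_b1.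
    split.
    - by apply: vanish_eq vc => z _; rewrite hornerC.
    - by move=> z hz; rewrite !hornerC ps.
    - by apply: vanish_eq vm => z _; rewrite derivC horner0 subr0.
  have [p1 sp1 [v1 per1 v1']] := IH (ltnW lt).
  have e1 : (m - i.+1 = (m - i.+2).+1)%N by rewrite subnSK //; case: (m) lt => // k; rewrite /= ltnS => /ltnW.
  have lt2 : ((m - i.+2).+1 < m)%N.
    by rewrite -e1 ltn_subrL /= (leq_trans _ m2).
  have [j ej] : exists j, (m - i.+2 = j.+1)%N.
    exists (m - i.+3)%N; rewrite subnSK //.
    by case: (m) lt => // k; rewrite /= ltnS.
  rewrite ej in e1 lt2 *; rewrite e1 in v1 per1 v1'.
  have [P dP sP] := exists_antiderivative p1.
  have [PP dPP sPP] := exists_antiderivative P.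
  have ht z : H z -> cderiv (fun w => h j w - PP.[w]) z (h j.+1 z - P.[z]).
    move=> hz; apply: cderivB; first by apply: hh => //; apply: ltn_trans lt2; rewrite ltnW.
    by rewrite -dPP; exact: cderiv_horner.
  have hs z : H z -> cderiv (fun w => h j.+1 w - P.[w]) z (h j.+2 z - p1.[z]).
    move=> hz; apply: cderivB; first by apply: hh => //; apply: ltn_trans lt2.
    by rewrite -dP; exact: cderiv_horner.
  have [ps [c vc]] := vanish_deriv_limit ht hs per1 v1.
  exists (P + c%:P).
    rewrite (leq_trans (size_polyD _ _)) // geq_max (leq_trans sP) ?ltnS //=.
    by rewrite (leq_trans (size_polyC_leq1 _)).
  split.
  - by apply: vanish_eq vc => z _; rewrite hornerD hornerC; ring.
  - by move=> z hz; rewrite !hornerD !hornerC !opprD !addrA ps.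
  - by apply: vanish_eq v1 => z _; rewrite derivD derivC addr0 dP.
have [p1 sp1 [v1 per1 v1']] := step m.-2 ltac:(by case: (m) m2 => [|[|k]]).
have e1 : (m - m.-2.+1 = 1)%N by case: (m) m2 => [|[|k]] // _; rewrite subSn ?subnn.
rewrite e1 in v1 per1 v1'.
have [P dP sP] := exists_antiderivative p1.
have ht z : H z -> cderiv (fun w => h 0%N w - P.[w]) z (h 1%N z - p1.[z]).
  move=> hz; apply: cderivB; first by apply: hh => //; apply: ltnW.
  by rewrite -dP; exact: cderiv_horner.
have hs z : H z -> cderiv (fun w => h 1%N w - p1.[w]) z (h 2%N z - p1^`().[z]).
  by move=> hz; apply: cderivB; [apply: hh | exact: cderiv_horner].
have [c vc] := vanish_deriv_limit0 ht hs per1 v1 v1'.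
exists (P + c%:P).
  rewrite (leq_trans (size_polyD _ _)) // geq_max.
  rewrite (leq_trans (size_polyC_leq1 _)) ?(ltnW m2) // andbT (leq_trans sP) //.
  by move: sp1 m2; case: (m) => [|[|k]].
by apply: vanish_eq vc => z _; rewrite hornerD hornerC; ring.
Qed.

End Period.
End Growth.

(** * Eichler integrals *)

Section Eichler.
Variables (R : realType) (n : nat).
Local Notation C := R[i].
Local Notation H := (@upper_half R).
Local Notation e := (@e2pii R).
Implicit Types (phi : C -> C) (F G : C -> {poly C}) (z w : C) (p : {poly C}) (g h : 'M[int]_2).

(** [F] is a primitive of [phi z (X - z)^n dz], coefficient by coefficient in [X]. *)
Definition eichler phi F : Prop :=
  (forall z, H z -> (size (F z) <= n.+1)%N) /\
  forall i z, H z -> cderiv (fun w => (F w)`_i) z (phi z *: ('X - z%:P) ^+ n)`_i.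

Definition slashF g F z : {poly C} := pslash n g (F (mob g z)).

(** By [mob_sub], substituting [g z] multiplies [(X - z)^n dz] by
    [det g ^ (n+1) / (j X ^ n * j z ^ (n+2))]. *)
Lemma eichler_slash g phi F : 0 < \det g -> eichler phi F ->
  eichler (fun z => (\det g)%:~R ^+ n.+1 * slash n.+2 g phi z) (slashF g F).
Proof.
move=> dg [sF dF]; split=> [z hz|j z hz]; first exact: size_pslash.
have hgz := mob_H dg hz; have j0 := jf_neq0 dg hz.
rewrite (_ : (fun w => _) = (fun w => \sum_(i < n.+1)
    ((slash_basis n int g i)`_j)%:~R * (F (mob g w))`_i)); last first.
  apply/funext => w; rewrite /slashF coef_pslash.
  by apply: eq_bigr => i _; rewrite mulrC.
pose d (i : 'I_n.+1) := ((slash_basis n int g i)`_j)%:~R *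
  ((phi (mob g z) *: ('X - (mob g z)%:P) ^+ n)`_i * ((\det g)%:~R / jf g z ^+ 2)) : C.
suff -> : ((\det g)%:~R ^+ n.+1 * slash n.+2 g phi z *: ('X - z%:P) ^+ n)`_j = \sum_(i < n.+1) d i.
  apply: cderiv_sum => i; apply: cderivZ.
  exact: (cderiv_comp (F := fun u => (F u)`_i) (cderiv_mob dg hz) (dF i _ hgz)).
pose q : {poly C} := phi (mob g z) *: ('X - (mob g z)%:P) ^+ n.
have sq : (size q <= n.+1)%N.
  by apply: leq_trans (size_scale_leq _ _) _; rewrite size_exp_XsubC.
have -> : \sum_(i < n.+1) d i = ((\det g)%:~R / jf g z ^+ 2 *: pslash n g q)`_j.
  rewrite coefZ coef_pslash mulr_sumr; apply: eq_bigr => i _.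
  by rewrite /d -/q; ring.
apply: (congr1 (fun p : {poly C} => p`_j)); apply: poly_eq_H => X hX.
rewrite !hornerZ horner_pslash // /q hornerZ !horner_exp !hornerXsubC mob_sub //.
have jX0 := jf_neq0 dg hX.
rewrite slashE expr_div_n !exprMn.
have : jf g z ^+ n != 0 by rewrite expf_neq0.
have : jf g X ^+ n != 0 by rewrite expf_neq0.
rewrite !exprS expr0.
move: (jf g X ^+ n) (jf g z ^+ n) (phi _) ((X - z) ^+ n) ((\det g)%:~R ^+ n).
move=> a b c u v a0 b0.
by field; rewrite a0 b0 j0.
Qed.

Lemma eichler_unique phi phi' F F' : eichler phi F -> eichler phi' F' ->
  (forall z, H z -> phi z = phi' z) ->
  exists2 p : {poly C}, (size p <= n.+1)%N & forall z, H z -> F z - F' z = p.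
Proof.
move=> [sF dF] [sF' dF'] e0; exists (F 'i%C - F' 'i%C).
  rewrite (leq_trans (size_polyD _ _)) // size_polyN geq_max sF ?sF' //;
  by rewrite /upper_half /=.
move=> z hz; apply/polyP => i; rewrite !coefB.
apply: (cderiv0_constant (F := fun w => (F w)`_i - (F' w)`_i)) => //; last first.
  by rewrite /upper_half /=.
move=> w hw; have := cderivB (dF i w hw) (dF' i w hw).
by rewrite e0 // subrr.
Qed.

Lemma eichler_sub phi F p : (size p <= n.+1)%N -> eichler phi F ->
  eichler phi (fun z => F z - p).
Proof.
move=> sp [sF dF]; split=> [z hz|i z hz].
  by rewrite (leq_trans (size_polyD _ _)) // size_polyN geq_max sF.
rewrite (_ : (fun w => _) = (fun w => (F w)`_i - p`_i)); last first.
  by apply/funext => w; rewrite coefB.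
rewrite -[X in cderiv _ _ X]subr0; apply: cderivB; first exact: dF.
exact: cderiv_cst.
Qed.

Lemma eichler_sum I (r : seq I) (phi : I -> C -> C) (F : I -> C -> {poly C}) :
  (forall i, eichler (phi i) (F i)) ->
  eichler (fun z => \sum_(i <- r) phi i z) (fun z => \sum_(i <- r) F i z).
Proof.
move=> h; split=> [z hz|j z hz].
  elim: r => [|i r IH]; first by rewrite big_nil size_poly0.
  by rewrite big_cons (leq_trans (size_polyD _ _)) // geq_max IH andbT; apply: (h i).1.
rewrite (_ : (fun w => _) = (fun w => \sum_(i <- r) (F i w)`_j)); last first.
  by apply/funext => w; rewrite coef_sum.
by rewrite scaler_suml coef_sum; apply: cderiv_sum => i; apply: (h i).2.
Qed.

Lemma eichler_scale a phi F : eichler phi F ->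
  eichler (fun z => a * phi z) (fun z => a *: F z).
Proof.
move=> [sF dF]; split=> [z hz|j z hz].
  by apply: leq_trans (size_scale_leq _ _) _; exact: sF.
rewrite (_ : (fun w => _) = (fun w => a * (F w)`_j)); last first.
  by apply/funext => w; rewrite coefZ.
by rewrite -scalerA coefZ; apply: cderivZ; exact: dF.
Qed.

(** As [(X - z)^n] vanishes to order [n] on the diagonal [X = z], the jets of an
    Eichler integral are the successive derivatives of its diagonal values, and the
    derivative of the last one is [n! phi]. *)
Definition jet (F : C -> {poly C}) (j : nat) (z : C) : C := (F z)^`(j).[z].

Lemma derivn_XsubCX (z : C) j : (('X - z%:P) ^+ n)^`(j) = (n ^_ j)%:R *: ('X - z%:P) ^+ (n - j).
Proof.
elim: j => [|j IH]; first by rewrite ffactn0 scale1r subn0 derivn0.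
rewrite derivnS IH derivZ deriv_exp derivXsubC mul1r ffactnSr subnS.
by rewrite natrM -scalerA !scaler_nat.
Qed.

Lemma cderiv_jet phi F j z : eichler phi F -> H z -> (j <= n)%N ->
  cderiv (jet F j) z (if j == n then n`!%:R * phi z else jet F j.+1 z).
Proof.
move=> [sF dF] hz jn.
have jetE i w : H w -> jet F i w = \sum_(l < n.+1) (F w)`_l * ('X^l)^`(i).[w].
  move=> hw; rewrite /jet.
  have {1}-> : F w = \sum_(l < n.+1) (F w)`_l *: 'X^l.
    by rewrite -poly_def; apply/polyP => l; rewrite coef_poly; case: ltnP => // le;
      rewrite nth_default // (leq_trans (sF _ hw)).
  rewrite (_ : _^`(i) = \sum_(l < n.+1) (F w)`_l *: ('X^l)^`(i)).
    by rewrite horner_sum; apply: eq_bigr => l _; rewrite hornerZ.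
  by rewrite linear_sum /=; apply: eq_bigr => l _; rewrite derivnZ.
apply: (cderiv_eqH hz) => [w hw|]; first by symmetry; exact: jetE hw.
set d := (if _ then _ else _).
suff -> : d = \sum_(l < n.+1) ((phi z *: ('X - z%:P) ^+ n)`_l * ('X^l)^`(j).[z] +
                (F z)`_l * ('X^l)^`(j.+1).[z]).
  apply: cderiv_sum => l; apply: cderivM; first exact: dF.
  by rewrite derivnS; exact: cderiv_horner.
have -> : \sum_(l < n.+1) ((phi z *: ('X - z%:P) ^+ n)`_l * ('X^l)^`(j).[z] +
    (F z)`_l * ('X^l)^`(j.+1).[z]) =
  \sum_(l < n.+1) (phi z *: ('X - z%:P) ^+ n)`_l * ('X^l)^`(j).[z] + jet F j.+1 z.
  by rewrite jetE // -big_split.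
pose q := phi z *: ('X - z%:P) ^+ n.
have -> : \sum_(l < n.+1) (phi z *: ('X - z%:P) ^+ n)`_l * ('X^l)^`(j).[z] = q^`(j).[z].
  have {1}-> : q = \sum_(l < n.+1) q`_l *: 'X^l.
    rewrite -poly_def; apply/polyP => l; rewrite coef_poly; case: ltnP => // le.
    rewrite nth_default // (leq_trans (size_scale_leq _ _)) // size_exp_XsubC //.
  rewrite linear_sum /= horner_sum; apply: eq_bigr => l _.
  by rewrite derivnZ hornerZ.
rewrite /q derivnZ derivn_XsubCX !hornerZ horner_exp hornerXsubC subrr /d.
case: eqVneq => [->|neq].
  rewrite subnn expr0 mulr1 ffactnn mulrC /jet.
  suff -> : (F z)^`(n.+1) = 0 by rewrite horner0 addr0.
  apply/polyP => i; rewrite coef_derivn coef0 nth_default ?mul0rn //.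
  by rewrite (leq_trans (sF _ hz)) // leq_addr.
by rewrite expr0n subn_eq0 leqNgt ltn_neqAle neq jn /= !mulr0 add0r.
Qed.

(** The normalisation on the diagonal [X = z] singles out one Eichler integral: two of
    them differ by a polynomial in [X] alone, which can vanish at infinity only if it is
    zero. *)
Definition canonical phi F : Prop :=
  eichler phi F /\ vanish (fun z => (F z).[z]).

Lemma canonical_unique phi phi' F F' : canonical phi F -> canonical phi' F' ->
  (forall z, H z -> phi z = phi' z) -> forall z, H z -> F z = F' z.
Proof.
move=> [eF vF] [eF' vF'] e0 z hz.
have [p sp hp] := eichler_unique eF eF' e0.
apply/eqP; rewrite -subr_eq0 hp //; apply/eqP/vanish_poly_eq0.
apply: vanish_eq (vanish_lin (-1) vF' vF) => w hw.
by rewrite -(hp w hw) hornerD hornerN mulN1r addrC.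
Qed.

(** The jets of [F] form a chain of derivatives ending in [n! phi], so
    [vanish_mod_poly] finds the polynomial to subtract. *)
Lemma canonical_exists phi F N : (0 < N)%N -> (0 < n)%N -> eichler phi F ->
  periodic N phi -> vanish phi ->
  exists2 p : {poly C}, (size p <= n.+1)%N & canonical phi (fun z => F z - p).
Proof.
move=> N0 n0 eF pphi vphi.
pose hj j := if (j <= n)%N then jet F j else (fun z => n`!%:R * phi z).
have [] := @vanish_mod_poly _ N N0 hj n.+1.
- by [].
- move=> j; rewrite ltnS => jn z hz; rewrite /hj jn.
  have := cderiv_jet eF hz jn; rewrite ltn_neqAle jn andbT.
  by case: eqVneq.
- by move=> z hz; rewrite /hj ltnn pphi.
- rewrite /hj ltnn; apply: vanish_eq (vanish_lin n`!%:R vphi (@vanish0 R)) => z hz.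
  by rewrite addr0.
move=> p sp vp; exists p => //; split; first exact: eichler_sub.
by apply: vanish_eq vp => z hz; rewrite /hj /= /jet derivn0 hornerD hornerN.
Qed.

Lemma canonical_sum I (r : seq I) (phi : I -> C -> C) (F : I -> C -> {poly C}) :
  (forall i, canonical (phi i) (F i)) ->
  canonical (fun z => \sum_(i <- r) phi i z) (fun z => \sum_(i <- r) F i z).
Proof.
move=> h; split; first by apply: eichler_sum => i; case: (h i).
elim: r => [|i r IH].
  by apply: vanish_eq (@vanish0 R) => z _; rewrite big_nil horner0.
have [_ vi] := h i; apply: vanish_eq (vanish_lin 1 vi IH) => z _.
by rewrite big_cons hornerD mul1r.
Qed.

Lemma canonical_scale a phi F : canonical phi F ->
  canonical (fun z => a * phi z) (fun z => a *: F z).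
Proof.
move=> [eF vF]; split; first exact: eichler_scale.
by apply: vanish_eq (vanish_lin a vF (@vanish0 R)) => z _; rewrite hornerZ addr0.
Qed.

(** Upper triangular matrices fix the cusp at infinity, and with it the
    normalisation. *)
Lemma canonical_slash_upper (a b d : int) phi F : 0 < a -> 0 < d -> canonical phi F ->
  canonical (fun z => (a * d)%:~R ^+ n.+1 * slash n.+2 (mx2 a b 0 d) phi z)
    (slashF (mx2 a b 0 d) F).
Proof.
move=> a0 d0 [eF vF]; set g := mx2 a b 0 d.
have dE : \det g = a * d by rewrite det_mx2 mulr0 subr0.
have dg : 0 < \det g by rewrite dE mulr_gt0.
split; first by rewrite -dE; apply: eichler_slash.
have jE z : jf g z = d%:~R by rewrite /jf !mxE /= mul0r add0r.
have dR : 0 < d%:~R :> R by rewrite ltr0z.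
have aR : 0 < a%:~R :> R by rewrite ltr0z.
have nd : nm (d%:~R : C) = d%:~R by rewrite intC nm_real gtr0_norm.
move=> eps eps0; have dn : 0 < d%:~R ^+ n :> R by rewrite exprn_gt0.
have [Y hY] := vF (eps / d%:~R ^+ n) ltac:(by rewrite divr_gt0).
exists (Y * d%:~R / a%:~R) => z hz Yz.
have hgz := mob_H dg hz.
rewrite /slashF horner_pslash //; last exact: eF.1.
rewrite jE nmM nmX nd mulrC -ler_pdivlMr //; apply: hY => //.
rewrite Im_mob // jE nd dE rmorphM /=.
have -> : a%:~R * d%:~R * complex.Im z / d%:~R ^+ 2 = complex.Im z * a%:~R / d%:~R :> R.
  by field; rewrite lt0r_neq0.
by rewrite ltr_pdivlMr // -ltr_pdivrMr.
Qed.

End Eichler.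

Section QSeriesPrimitive.
Variables (R : realType) (n : nat).
Local Notation C := R[i].
Local Notation H := (@upper_half R).
Local Notation e := (@e2pii R).
Implicit Types (c d : nat -> C) (z w : C).

Lemma tame0 : tame (fun=> 0 : C).
Proof. by move=> r _; exists 0 => m; rewrite nm0 mul0r. Qed.

Lemma qser0 z : H z -> qser (fun=> 0 : C) z = 0.
Proof.
move=> hz; apply: qser_unique => eps eps0; exists 0%N => M _.
by rewrite big1 ?subr0 ?nm0 ?ltW // => i _; rewrite mul0r.
Qed.

Lemma qser_scale a c z : tame c -> H z -> qser (fun m => a * c m) z = a * qser c z.
Proof.
move=> hc hz; have := qser_lin a hc tame0 hz; rewrite qser0 // addr0 => <-.
by congr (qser _ z); apply/funext => m; rewrite addr0.
Qed.

Lemma vanish_qser c : tame c -> c 0%N = 0 -> vanish (qser c).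
Proof.
move=> hc c0 eps eps0.
have [B B0 hB] := qser_cusp hc c0 (@ltr01 R).
exists (1 + B / eps) => z hz Yz.
have Be : 0 <= B / eps by rewrite divr_ge0 // ltW.
have y1 : 1 <= complex.Im z by apply: le_trans (ltW Yz); rewrite lerDl.
apply: le_trans (hB z y1) _.
set t := 2 * pi * (complex.Im z - 1).
have -> : -2 * pi * (complex.Im z - 1) = - t by rewrite /t !mulNr.
have tB : B / eps <= t.
  have h2 : 1 <= 2 * pi :> R by have := @pi_ge2 R; lra.
  apply: le_trans (_ : complex.Im z - 1 <= t); first by rewrite lerBrDl ltW.
  by rewrite ler_peMl // subr_ge0.
have t0 : 0 <= t by apply: le_trans tB.
rewrite expRN ler_pdivrMr ?expR_gt0 //.
apply: le_trans (_ : eps * (1 + t) <= _); last first.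
  by apply: ler_wpM2l; [exact: ltW | exact: expR_ge1Dx].
rewrite mulrDr mulr1; apply: le_trans (_ : eps * t <= _); last by rewrite lerDr ltW.
by rewrite mulrC -ler_pdivrMr // mulrC.
Qed.

(** Coefficients of the [j]-fold primitive of [qser c]. *)
Definition int_coef c (j m : nat) : C := c m / (twopii R * m%:R) ^+ j.

Lemma nm_twopii_ge1 (m : nat) : (0 < m)%N -> 1 <= nm (twopii R * m%:R).
Proof.
move=> m0; rewrite nmM nm_twopii nm_nat.
have h2 : 1 <= 2 * pi :> R by have := @pi_ge2 R; lra.
have h3 : 1 <= m%:R :> R by rewrite ler1n.
by rewrite -[X in X <= _]mulr1; apply: ler_pM.
Qed.

Lemma tame_int_coef c j : tame c -> c 0%N = 0 -> tame (int_coef c j).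
Proof.
move=> hc c0; apply: (tame_le (K := 1)) hc => m; rewrite mul1r /int_coef.
case: m => [|m]; first by rewrite c0 mul0r.
rewrite nmM nmV nmX ler_piMr ?nm_ge0 // invf_le1; last first.
  by rewrite exprn_gt0 // (lt_le_trans ltr01) // nm_twopii_ge1.
by rewrite exprn_ege1 // nm_twopii_ge1.
Qed.

Lemma cderiv_int_coef c j z : tame c -> c 0%N = 0 -> H z ->
  cderiv (qser (int_coef c j.+1)) z (qser (int_coef c j) z).
Proof.
move=> hc c0 hz; have t1 := tame_int_coef j.+1 hc c0.
have := cderiv_qser t1 hz; rewrite -qser_scale //; last exact: tame_natM.
suff -> : (fun m => twopii R * (m%:R * int_coef c j.+1 m)) = int_coef c j by [].
apply/funext => m; rewrite /int_coef.
have [->|m0] := posnP m; first by rewrite c0 !mul0r !mulr0.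
have h1 : twopii R * m%:R != 0 by rewrite mulf_neq0 ?twopii_neq0 // pnatr_eq0 -lt0n.
have -> : twopii R * (m%:R * (c m / (twopii R * m%:R) ^+ j.+1)) =
  (twopii R * m%:R) * (c m / (twopii R * m%:R) ^+ j.+1) by ring.
rewrite exprS; move: (twopii R * m%:R) h1 => x x0.
have : x ^+ j != 0 by rewrite expf_neq0.
by move: (x ^+ j) => y y0; field; rewrite x0 y0.
Qed.

Lemma cderiv_XsubC_coef j i z :
  cderiv (fun w => (('X - w%:P) ^+ j)`_i) z (- j%:R * (('X - z%:P) ^+ j.-1)`_i).
Proof.
elim: j i => [|j IH] i.
  rewrite (_ : (fun w => _) = (fun=> ('X ^+ 0)`_i)); last first.
    by apply/funext => w; rewrite !expr0.
  by rewrite oppr0 mul0r; exact: cderiv_cst.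
rewrite (_ : (fun w => _) = (fun w => (if i is i'.+1 then (('X - w%:P) ^+ j)`_i' else 0)
   - w * (('X - w%:P) ^+ j)`_i)); last first.
  apply/funext => w; rewrite exprS mulrBl coefB coefCM coefXM.
  by case: i.
have step k : (('X - z%:P) ^+ j)`_k * j%:R =
   j%:R * ((if k is k'.+1 then (('X - z%:P) ^+ j.-1)`_k' else 0) - z * (('X - z%:P) ^+ j.-1)`_k).
  case: j {IH} => [|j]; first by rewrite mulr0 mul0r.
  by rewrite /= exprS mulrBl coefB coefCM coefXM mulrC; case: k.
set D := - _ * _.
have -> : D = (if i is i'.+1 then - j%:R * (('X - z%:P) ^+ j.-1)`_i' else 0) -
   (1 * (('X - z%:P) ^+ j)`_i + z * (- j%:R * (('X - z%:P) ^+ j.-1)`_i)).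
  rewrite /D /= -natr1; have := step i; clear.
  have eA (A : C) : - (j%:R + 1) * A = - (A * j%:R) - A by ring.
  by case: i => [|i] h; rewrite eA h; ring.
apply: cderivB; last by apply: cderivM; [exact: cderiv_id | exact: IH].
by clear D; case: (i) => [|i']; [exact: cderiv_cst | exact: IH].
Qed.

(** Repeated integration by parts of [phi z (X - z)^n dz]. *)
Definition eichler_integral c (z : C) : {poly C} :=
  \sum_(j < n.+1) (n`!%:R / j`!%:R * qser (int_coef c (n.+1 - j)) z) *: ('X - z%:P) ^+ j.

Lemma canonical_qser c : tame c -> c 0%N = 0 ->
  canonical n (qser c) (eichler_integral c).
Proof.
move=> hc c0.
have factn0 j : j`!%:R != 0 :> C by rewrite pnatr_eq0 -lt0n fact_gt0.
split; last first.
  apply: vanish_eq (vanish_lin n`!%:R (vanish_qser (tame_int_coef n.+1 hc c0) _) (@vanish0 R)).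
    move=> z hz; rewrite addr0 /eichler_integral horner_sum big_ord_recl /=.
    rewrite expr0 hornerZ hornerC mulr1 fact0 divr1 subn0 big1 ?addr0 // => i _.
    by rewrite hornerZ horner_exp hornerXsubC subrr expr0n mulr0.
  by rewrite /int_coef c0 mul0r.
split=> [z hz|i z hz].
  apply: leq_trans (size_sum _ _ _) _; apply/bigmax_leqP => j _.
  by apply: leq_trans (size_scale_leq _ _) _; rewrite size_exp_XsubC.
rewrite (_ : (fun w => _) = (fun w => \sum_(j < n.+1)
    (n`!%:R / j`!%:R) * (qser (int_coef c (n.+1 - j)) w * (('X - w%:P) ^+ j)`_i))); last first.
  apply/funext => w; rewrite /eichler_integral coef_sum; apply: eq_bigr => j _.
  by rewrite coefZ mulrA.
pose Gj (j : nat) : C := if j is j'.+1 then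
   n`!%:R / j'`!%:R * (qser (int_coef c (n - j')) z * (('X - z%:P) ^+ j')`_i) else 0.
have -> : (qser c z *: ('X - z%:P) ^+ n)`_i = \sum_(j < n.+1) (n`!%:R / j`!%:R *
   (qser (int_coef c (n - j)) z * (('X - z%:P) ^+ j)`_i +
    qser (int_coef c (n.+1 - j)) z * (- j%:R * (('X - z%:P) ^+ j.-1)`_i))).
  transitivity (\sum_(j < n.+1) (Gj j.+1 - Gj j)).
    rewrite -(big_mkord xpredT (fun j => Gj j.+1 - Gj j)) telescope_sumr //.
    rewrite /= subr0 subnn divff // mul1r coefZ.
    by congr (qser _ _ * _); apply/funext => m; rewrite /int_coef expr0 divr1.
  apply: eq_bigr => -[[|j] lt] _ /=.
    by rewrite !subn0 subr0 oppr0 mul0r mulr0 addr0.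
  rewrite subSS factS natrM.
  have j0 : j.+1%:R != 0 :> C by rewrite pnatr_eq0.
  have := factn0 j; move: (qser _ z) (qser _ z) (j.+1%:R : C) j0 => A B u u0.
  move: ((('X - z%:P) ^+ j)`_i) ((('X - z%:P) ^+ j.+1)`_i) (n`!%:R : C) (j`!%:R : C) => D E v w w0.
  by field; rewrite u0 w0.
apply: cderiv_sum => j; apply: cderivZ; apply: cderivM; last exact: cderiv_XsubC_coef.
rewrite subSn; last by rewrite -ltnS.
exact: cderiv_int_coef.
Qed.

Lemma horner_eichler_integral c z : tame c -> c 0%N = 0 -> H z ->
  (eichler_integral c z).[z] = qser (fun m => n`!%:R * int_coef c n.+1 m) z.
Proof.
move=> hc c0 hz; rewrite qser_scale //; last exact: tame_int_coef.
rewrite /eichler_integral horner_sum big_ord_recl /=.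
rewrite expr0 hornerZ hornerC mulr1 fact0 divr1 subn0 big1 ?addr0 // => i _.
by rewrite hornerZ horner_exp hornerXsubC subrr expr0n mulr0.
Qed.

End QSeriesPrimitive.

(** * Hecke operators and coefficients *)

Section HeckeCoefficients.
Variable R : realType.
Local Notation C := R[i].
Local Notation H := (@upper_half R).
Local Notation e := (@e2pii R).
Implicit Types (c d : nat -> C) (z w : C).
Variable q : nat.
Hypothesis q0 : (0 < q)%N.

Definition dilate c (m : nat) : C := if (q %| m)%N then c (m %/ q)%N else 0.
Definition sample c (m : nat) : C := c (q * m)%N.

Lemma tame_sample c : tame c -> tame (sample c).
Proof.
move=> hc r /andP[r0 r1].
have [x [x0 x1 xq]] : exists x : R, [/\ 0 < x, x < 1 & r <= x ^+ q].
  exists (r `^ q%:R^-1); split.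
  - exact: powR_gt0.
  - have e1 : 1 `^ q%:R^-1 = 1 :> R by rewrite powR1.
    rewrite -[X in _ < X]e1.
    by apply: gt0_ltr_powR; rewrite ?invr_gt0 ?ltr0n ?nnegrE ?(ltW r0).
  - by rewrite -powR_mulrn ?powR_ge0 // -powRrM mulVf ?pnatr_eq0 -?lt0n // powRr1 // ltW.
have [B hB] := hc x ltac:(by rewrite x0).
exists B => m; apply: le_trans (hB (q * m)%N).
rewrite ler_wpM2l ?nm_ge0 // exprM lerXn2r ?nnegrE ?exprn_ge0 // ltW //.
Qed.

Lemma tame_dilate c : tame c -> tame (dilate c).
Proof.
move=> hc r /andP[r0 r1]; have [B hB] := hc r ltac:(by rewrite r0).
have B0 : 0 <= B.
  by apply: le_trans (hB 0%N); rewrite mulr_ge0 ?exprn_ge0 ?nm_ge0 // ltW.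
exists B => m; rewrite /dilate; case: ifP => [dv|_]; last by rewrite nm0 mul0r.
apply: le_trans (hB (m %/ q)%N); rewrite ler_wpM2l ?nm_ge0 //.
by rewrite ler_wiXn2l ?(ltW r0) ?(ltW r1) // leq_div.
Qed.

Lemma sums_to_subseq (c d : nat -> C) s t : sums_to c s -> sums_to d t ->
  (forall M, \sum_(i < q * M) c i = \sum_(i < M) d i) -> s = t.
Proof.
move=> hs ht h; apply: (sums_to_unique (c := d)) => // eps /hs [M0 hM].
exists M0 => M le; rewrite -h; apply: hM.
by apply: leq_trans le _; rewrite leq_pmull.
Qed.

Lemma sum_multiples (F : nat -> C) M :
  (forall i, ~~ (q %| i)%N -> F i = 0) ->
  \sum_(i < q * M) F i = \sum_(i < M) F (q * i)%N.
Proof.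
move=> hF; elim: M => [|M IH]; first by rewrite muln0 !big_ord0.
rewrite big_ord_recr -IH /= -!(big_mkord xpredT F).
have le : (q * M <= q * M.+1)%N by rewrite leq_mul2l leqW ?orbT.
rewrite (big_cat_nat _ le) //=; congr (_ + _).
rewrite big_ltn; last by rewrite ltn_mul2l q0 /=.
rewrite big_nat big1 ?addr0 // => i /andP[h1 h2]; apply: hF.
apply/negP => /dvdnP [k ek]; move: h1 h2; rewrite ek ![(k * q)%N]mulnC !ltn_mul2l q0 /= => h1.
by rewrite ltnS leqNgt h1.
Qed.

Lemma H_natM z : H z -> H (q%:R * z).
Proof. by rewrite /upper_half /= natC ImZ => h; rewrite mulr_gt0 ?ltr0n. Qed.

Lemma H_divnat z (j : nat) : H z -> H ((z + j%:R) / q%:R).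
Proof.
rewrite /upper_half /= !natC mulrC -(rmorphV (real_complex R)) ?unitfE ?pnatr_eq0 -?lt0n //.
by rewrite ImZ ImD /= addr0 => h; rewrite mulr_gt0 ?invr_gt0 ?ltr0n.
Qed.

Lemma qser_dilate c z : tame c -> H z -> qser c (q%:R * z) = qser (dilate c) z.
Proof.
move=> hc hz.
apply/esym; apply: (sums_to_subseq (qserP (tame_dilate hc) hz) (qserP hc (H_natM hz))) => M.
rewrite (@sum_multiples (fun i => dilate c i * e z ^+ i)); last first.
  by move=> i /negbTE h; rewrite /dilate h mul0r.
by apply: eq_bigr => i _; rewrite /dilate dvdn_mulr // mulKn // e2piiX exprM.
Qed.

Lemma qser_sample c z : tame c -> H z ->
  q%:R^-1 * \sum_(j < q) qser c ((z + j%:R) / q%:R) = qser (sample c) z.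
Proof.
move=> hc hz.
have qC : q%:R != 0 :> C by rewrite pnatr_eq0 -lt0n.
pose w := e (q%:R^-1)%:C; have wp : q.-primitive_root w := e2pii_primitive_root R q0.
pose F i : C := q%:R^-1 * \sum_(j < q) c i * e ((z + j%:R) / q%:R) ^+ i.
have sF : sums_to F (q%:R^-1 * \sum_(j < q) qser c ((z + j%:R) / q%:R)).
  have base : forall k (f : nat -> nat -> C) (s : nat -> C), (forall j, sums_to (f j) (s j)) ->
      sums_to (fun i => \sum_(j < k) f j i) (\sum_(j < k) s j).
    elim=> [|k IH] f s h.
      move=> eps eps0; exists 0%N => M _; rewrite big_ord0 big1 ?subr0 ?nm0 ?ltW // => i _.
      by rewrite big_ord0.
    have := sums_to_lin 1 (IH f s h) (h k); rewrite big_ord_recr /= mul1r.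
    by congr sums_to; apply/funext => i; rewrite big_ord_recr /= mul1r.
  have h := base q (fun j i => c i * e ((z + j%:R) / q%:R) ^+ i)
     (fun j => qser c ((z + j%:R) / q%:R)) (fun j => qserP hc (H_divnat j hz)).
  have z0 : sums_to (fun=> 0 : C) 0.
    by move=> eps eps0; exists 0%N => M _; rewrite big1 ?subr0 ?nm0 ?ltW.
  have := sums_to_lin q%:R^-1 h z0; rewrite addr0.
  by congr sums_to; apply/funext => i; rewrite addr0.
have FE i : F i = c i * e (z / q%:R) ^+ i * (q%:R^-1 * \sum_(j < q) (w ^+ i) ^+ j).
  rewrite /F [RHS]mulrCA; congr (_ * _); rewrite mulr_sumr; apply: eq_bigr => j _.
  rewrite mulrDl e2piiD exprMn -mulrA; congr (_ * (_ * _)).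
  have -> : j%:R / q%:R = j%:R * (q%:R^-1)%:C :> C.
    by rewrite fmorphV rmorph_nat.
  by rewrite e2piiX -/w -!exprM mulnC.
apply: (sums_to_subseq sF (qserP (tame_sample hc) hz)) => M.
rewrite sum_multiples.
  apply: eq_bigr => i _; rewrite FE /sample -mulrA; congr (_ * _).
  rewrite !exprM (prim_expr_order wp) expr1n (eq_bigr (fun=> 1)); last first.
    by move=> j _; rewrite expr1n.
  rewrite sumr_const card_ord mulVf // mulr1 -e2piiX.
  by congr (e _ ^+ _); rewrite mulrC divfK.
move=> i ndvd; rewrite FE.
have u1 : w ^+ i - 1 != 0.
  by rewrite subr_eq0 -(prim_order_dvd wp).
have := subrX1 (w ^+ i) q; rewrite -exprM mulnC exprM (prim_expr_order wp) expr1n subrr.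
move=> /esym/eqP; rewrite mulf_eq0 (negbTE u1) /= => /eqP ->.
by rewrite !mulr0.
Qed.

(** Averaging over [(z + j) / q] keeps the coefficients at multiples of [q], and
    [z |-> q z] spreads them; equal series have equal coefficients. *)
Lemma hecke_coefficients k c lam : tame c ->
  (forall z, H z -> hecke k 1 q (qser c) z = lam * qser c z) ->
  forall m, lam * c m = q%:R ^+ k.-1 * dilate c m + c (q * m)%N.
Proof.
move=> hc h.
have hd := tame_dilate hc; have hs := tame_sample hc.
have t : tame (fun m => q%:R ^+ k.-1 * dilate c m + sample c m).
  move=> r r01; have [B1 h1] := hd r r01; have [B2 h2] := hs r r01.
  exists (nm (q%:R ^+ k.-1 : C) * B1 + B2) => m; have /andP[r0 _] := r01.
  apply: le_trans (_ : nm (q%:R ^+ k.-1 : C) * (nm (dilate c m) * r ^+ m) + nm (sample c m) * r ^+ m <= _).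
    rewrite mulrA -mulrDl ler_wpM2r ?exprn_ge0 ?(ltW r0) // -nmM; exact: nmD.
  by apply: lerD => //; rewrite ler_wpM2l ?nm_ge0.
have tl : tame (fun m => lam * c m).
  by apply: (tame_le (K := nm lam)) hc => m; rewrite nmM.
have := @qser_inj _ _ _ tl t; apply=> z hz.
rewrite qser_scale // -h // /hecke mulr1 qser_lin // qser_dilate // qser_sample //.
Qed.

End HeckeCoefficients.

(** * Eigenvalues of integer matrices *)

Section IntegerEigenvalues.
Variable R : realType.
Local Notation C := R[i].

(** Take the characteristic polynomial of the matrix. The bound holds for all its
    roots, because the largest entry of an eigenvector bounds the eigenvalue by a row
    sum. *)
Lemma bounded_integer_eigenvalue (I : finType) (A : I -> I -> int) (v : I -> C)
    (lam : C) (B : R) :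
  (exists i, v i != 0) ->
  (forall i, lam * v i = \sum_k (A i k)%:~R * v k) ->
  (forall i, \sum_k `|(A i k)%:~R| <= B) ->
  exists2 chi : {poly int}, chi \is monic & root (map_poly intr chi) lam /\
    forall mu : C, root (map_poly intr chi) mu -> nm mu <= B.
Proof.
move=> [i0 vi0] hv hB.
pose M : 'M[int]_#|I| := \matrix_(i, j) A (enum_val j) (enum_val i).
pose MC : 'M[C]_#|I| := map_mx intr M.
have mapE : map_poly intr (char_poly M) = char_poly MC.
  exact: (map_char_poly (intr : {rmorphism int -> C})).
exists (char_poly M); first exact: char_poly_monic.
have toE (F : I -> C) : \sum_(j < #|I|) F (enum_val j) = \sum_k F k.
  by rewrite (reindex_onto (@enum_val I xpredT) (@enum_rank I)) //=;
    [apply: eq_bigl => j; rewrite enum_valK eqxx | move=> i _; rewrite enum_rankK].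
split.
  rewrite mapE -eigenvalue_root_char; apply/eigenvalueP.
  exists (\row_j v (enum_val j)).
    apply/rowP => j; rewrite !mxE hv -toE; apply: eq_bigr => k _.
    by rewrite !mxE mulrC.
  apply: contraNneq vi0 => /rowP /(_ (enum_rank i0)).
  by rewrite !mxE enum_rankK => ->.
move=> mu; rewrite mapE -eigenvalue_root_char => /eigenvalueP [u hu un0].
have [j0 uj0] : exists j, u 0 j != 0.
  apply: contrapT => no; move: un0; rewrite (_ : u = 0) ?eqxx //.
  apply/rowP => j; rewrite mxE; apply: contrapT => /eqP h; apply: no; by exists j.
pose m := [arg max_(j > j0) nm (u 0 j)]%O.
have mmax j : nm (u 0 j) <= nm (u 0 m).
  by rewrite /m; case: arg_maxP => // i _; apply.
have um0 : 0 < nm (u 0 m) by apply: lt_le_trans (mmax j0); exact: nm_gt0.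
have := congr1 (fun w : 'rV_#|I| => nm (w 0 m)) hu.
rewrite !mxE nmM => e; rewrite -(ler_pM2r um0) -e.
apply: le_trans (nm_sum _ _ _) _.
apply: le_trans (_ : \sum_(j < #|I|) `|(A (enum_val m) (enum_val j))%:~R| * nm (u 0 m) <= _).
  apply: ler_sum => j _; rewrite !mxE nmM mulrC intC nm_real.
  by rewrite ler_wpM2l.
rewrite -mulr_suml ler_wpM2r ?nm_ge0 //.
apply: le_trans (hB (enum_val m)).
rewrite [leRHS](reindex_onto (@enum_val I xpredT) (@enum_rank I)) /=; last first.
  by move=> i _; rewrite enum_rankK.
rewrite le_eqVlt; apply/orP; left; apply/eqP.
by apply: eq_bigl => j; rewrite enum_valK eqxx.
Qed.

End IntegerEigenvalues.

(** * Words in SL2(Z) and cocycles *)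

Section IntegerMatrixDecompositions.
Implicit Types (g h : 'M[int]_2) (m : int).

Definition Tm m : 'M[int]_2 := mx2 1 m 0 1.
Definition Sm : 'M[int]_2 := mx2 0 (-1) 1 0.

Lemma det_Tm m : \det (Tm m) = 1.
Proof. by rewrite det_mx2 mulr0 subr0. Qed.
Lemma det_Sm : \det Sm = 1. Proof. by rewrite det_mx2. Qed.
Lemma Tm0 : Tm 0 = 1%:M.
Proof. by apply: mx2_eq; rewrite !mxE. Qed.
Lemma TmD m m' : Tm m *m Tm m' = Tm (m + m').
Proof. by apply: mx2_eq; rewrite mulmx2E !mxE /=; ring. Qed.

(** Bezout coefficients for the first column clear its second entry, and a
    translation reduces [b]. *)
Lemma hermite_form g : 0 < \det g -> exists h a b d,
  [/\ \det h = 1, 0 < a, 0 < d, 0 <= b < d & g = h *m mx2 a b 0 d].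
Proof.
rewrite det2E => dg.
set x := g 0 0 in dg *; set y := g 1 0 in dg *.
set x' := g 0 1 in dg *; set y' := g 1 1 in dg *.
pose a := gcdz x y.
have a0 : 0 < a.
  have age : 0 <= a by []. rewrite lt_def age andbT; apply: contraTneq dg => /eqP.
  by rewrite gcdz_eq0 => /andP[/eqP -> /eqP ->]; rewrite mul0r mulr0 subrr.
have [u [v uv]] := Bezoutz x y.
have /dvdzP [x1 ex] := dvdz_gcdl x y; have /dvdzP [y1 ey] := dvdz_gcdr x y.
rewrite -/a in ex ey uv.
have uv1 : u * x1 + v * y1 = 1.
  apply: (mulIf (lt0r_neq0 a0)); rewrite mul1r mulrDl -!mulrA -ex -ey; exact: uv.
pose d := x1 * y' - y1 * x'.
have d0 : 0 < d.
  rewrite -(pmulr_rgt0 _ a0); suff -> : a * d = x * y' - x' * y by [].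
  by rewrite /d ex ey; ring.
pose b0 := u * x' + v * y'.
exists (mx2 x1 (- v) y1 u *m Tm (b0 %/ d)%Z), a, (b0 %% d)%Z, d.
split=> //.
- by rewrite det_mulmx det_Tm mulr1 det_mx2 -uv1; ring.
- by rewrite modz_ge0 ?lt0r_neq0 // ltz_pmod.
have TT t r : b0 = t * d + r -> Tm t *m mx2 a r 0 d = mx2 a b0 0 d.
  by move=> ->; apply: mx2_eq; rewrite mulmx2E !mxE /=; ring.
rewrite -mulmxA (TT _ _ (divz_eq b0 d)).
have e1 : x' = x1 * b0 - v * d.
  have -> : x1 * b0 - v * d = (u * x1 + v * y1) * x' by rewrite /b0 /d; ring.
  by rewrite uv1 mul1r.
have e2 : y' = y1 * b0 + u * d.
  have -> : y1 * b0 + u * d = (u * x1 + v * y1) * y' by rewrite /b0 /d; ring.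
  by rewrite uv1 mul1r.
apply: mx2_eq; rewrite mulmx2E !mxE /=.
- by rewrite mulr0 addr0.
- by rewrite -/x' {1}e1 mulNr.
- by rewrite mulr0 addr0.
- by rewrite -/y' {1}e2.
Qed.

(** Products of [S] and translations, built on the right: the cocycle relation then
    splits off the last factor. *)
Inductive word : 'M[int]_2 -> Prop :=
| word1 : word 1%:M
| wordS g : word g -> word (g *m Sm)
| wordT g m : word g -> word (g *m Tm m).

Lemma word_det g : word g -> \det g = 1.
Proof.
elim=> [|{}g _ IH|{}g m _ IH]; first exact: det1.
  by rewrite det_mulmx IH det_Sm.
by rewrite det_mulmx IH det_Tm.
Qed.

(** Euclid's algorithm on the second row; [S^4 = 1] makes up for the inverse of [S]. *)
Lemma SL2_word g : \det g = 1 -> word g.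
Proof.
have [k] := ubnP (absz (g 1 0)); elim: k g => // k IH g lt dg.
have [c0|cn0] := eqVneq (g 1 0) 0.
  have ad : g 0 0 * g 1 1 = 1 by move: dg; rewrite det2E c0 mulr0 subr0.
  have : g 1 1 \is a GRing.unit by apply/unitrPr; exists (g 0 0); rewrite mulrC.
  case/orP => /eqP d1.
    have a1 : g 0 0 = 1 by move: ad; rewrite d1 mulr1.
    have -> : g = 1%:M *m Tm (g 0 1).
      by rewrite mul1mx; apply: mx2_eq; rewrite !mxE.
    by apply: wordT; exact: word1.
  have a1 : g 0 0 = -1 by move: ad; rewrite d1 mulrN1 => /eqP; rewrite eqr_oppLR => /eqP.
  have -> : g = 1%:M *m Sm *m Sm *m Tm (- g 0 1).
    by rewrite mul1mx; apply: mx2_eq; rewrite !mulmx2E !mxE /= ?a1 ?c0 ?d1; ring.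
  by apply: wordT; apply: wordS; apply: wordS; exact: word1.
pose gd : int := g 1 1; pose gc : int := g 1 0; pose t := (gd %/ gc)%Z.
pose g' := g *m Tm (- t) *m Sm.
have e : g = g' *m Sm *m Sm *m Sm *m Tm t.
  rewrite /g' -!mulmxA.
  have -> : Sm *m (Sm *m (Sm *m (Sm *m Tm t))) = Tm t.
    by apply: mx2_eq; rewrite !mulmx2E !mxE /=; ring.
  by rewrite TmD addNr Tm0 mulmx1.
rewrite e; apply: wordT; apply: wordS; apply: wordS; apply: wordS; apply: IH.
  have -> : g' 1 0 = (gd %% gc)%Z.
    rewrite /g' !mulmx2E !mxE /= -/gc -/gd.
    have := divz_eq gd gc; rewrite -/t; move: (gd %% gc)%Z => r h.
    have -> : r = gd - t * gc by rewrite {1}h addrAC subrr add0r.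
    by clear; ring.
  have lt' : (absz gc < k.+1)%N by [].
  rewrite ltnS in lt'; apply: leq_trans lt'.
  by rewrite -ltz_nat gez0_abs ?modz_ge0 // abszE; exact: ltz_mod.
by rewrite !det_mulmx dg det_Tm det_Sm.
Qed.

Section Cocycles.
Variables (R : realType) (n : nat).
Local Notation C := R[i].

(** The second argument is the group element, the first one selects a form [f|g] in
    the orbit of [f]; translations are killed as they fix the cusp at infinity. *)
Record cocycle (P : 'M[int]_2 -> 'M[int]_2 -> {poly C}) : Prop := Cocycle {
  cocycle_size : forall g h, \det g = 1 -> \det h = 1 -> (size (P g h) <= n.+1)%N;
  cocycleM : forall g h h', \det g = 1 -> \det h = 1 -> \det h' = 1 ->
    P g (h *m h') = pslash n h' (P g h) + P (g *m h) h';
  cocycleT : forall g m, \det g = 1 -> P g (Tm m) = 0 }.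

(** Unfold the cocycle relation along a word for [h]; only the letters [S] contribute.
    The list does not depend on the cocycle, which is what makes the coefficients of
    the Hecke action universal. *)
Lemma word_cocycle h : word h -> exists L : seq ('M[int]_2 * 'M[int]_2),
  (forall u, u \in L -> \det u.1 = 1 /\ \det u.2 = 1) /\
  forall P, cocycle P -> forall g, \det g = 1 ->
    P g h = \sum_(u <- L) pslash n u.2 (P (g *m u.1) Sm).
Proof.
have push (L : seq ('M[int]_2 * 'M[int]_2)) P g h' : cocycle P -> \det g = 1 -> \det h' = 1 ->
    (forall u, u \in L -> \det u.1 = 1 /\ \det u.2 = 1) ->
    pslash n h' (\sum_(u <- L) pslash n u.2 (P (g *m u.1) Sm)) =
    \sum_(u <- [seq (u.1, u.2 *m h') | u <- L]) pslash n u.2 (P (g *m u.1) Sm).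
  move=> cP dg dh hL; rewrite pslash_sum big_map; apply: eq_big_seq => u /hL [d1 d2].
  rewrite pslashM ?d2 ?dh //; apply: (cocycle_size cP); last exact: det_Sm.
  by rewrite det_mulmx dg d1.
elim=> [|{}h wh [L [hL IH]]|{}h m wh [L [hL IH]]].
- exists [::]; split => // P cP g dg.
  by rewrite big_nil -Tm0 (cocycleT cP).
- have dh := word_det wh.
  exists ((h, 1%:M) :: [seq (u.1, u.2 *m Sm) | u <- L]); split.
    move=> u; rewrite inE => /orP[/eqP ->|/mapP [w /hL [d1 d2] ->]] /=.
      by rewrite dh det1.
    by rewrite det_mulmx d1 d2 det_Sm.
  move=> P cP g dg; rewrite (cocycleM cP) ?det_Sm // IH // big_cons addrC push ?det_Sm //.
  congr (_ + _); apply/polyP => j /=.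
  have sP : (size (P (g *m h) Sm) <= n.+1)%N.
    by apply: (cocycle_size cP); rewrite ?det_Sm // det_mulmx dg dh.
  congr (nth 0 (polyseq _) j); apply: poly_eq_H => X hX.
  rewrite horner_pslash ?det1 //.
  have -> : jf 1%:M X = 1 by rewrite /jf !mxE /= mul0r add0r.
  rewrite expr1n mul1r; congr (horner _ _).
  by rewrite /mob /jf !mxE /= !mul0r !add0r addr0 mul1r divr1.
- have dh := word_det wh.
  exists [seq (u.1, u.2 *m Tm m) | u <- L]; split.
    by move=> u /mapP [w /hL [d1 d2] ->] /=; rewrite det_mulmx d1 d2 det_Tm.
  move=> P cP g dg; rewrite (cocycleM cP) ?det_Tm // IH // (cocycleT cP); last first.
    by rewrite det_mulmx dg dh.
  by rewrite addr0 push ?det_Tm.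
Qed.

End Cocycles.
End IntegerMatrixDecompositions.

Section HeckeWords.
Variables (R : realType) (n q : nat).
Local Notation C := R[i].
Implicit Types (t : int * int * int) (L : seq ('M[int]_2 * 'M[int]_2)).

Definition upper t : 'M[int]_2 := mx2 t.1.1 t.1.2 0 t.2.
Definition hermite_triple t := [/\ 0 < t.1.1, 0 < t.2, 0 <= t.1.2 < t.2 & t.1.1 * t.2 = q].

(** How the representative [upper t] moves past [S], at the price of the period of
    some [u] in [SL2(Z)], which [L] expands into periods at [S]. *)
Definition hecke_word t L : Prop := exists (u : 'M[int]_2) (t' : int * int * int),
  [/\ \det u = 1, 0 < t'.1.1, 0 < t'.2, upper t *m Sm = u *m upper t' &
    (forall w, w \in L -> \det w.1 = 1) /\
    forall P : 'M[int]_2 -> 'M[int]_2 -> {poly C}, cocycle n P -> forall g, \det g = 1 ->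
      pslash n (upper t') (P g u) = \sum_(w <- L) pslash n w.2 (P (g *m w.1) Sm)].

(** Bounds the contribution of [L] to a row sum of the Hecke matrix. *)
Definition word_norm L (j : nat) : R :=
  \sum_(w <- L) \sum_(l < n.+1) `|((slash_basis n int w.2 l)`_j)%:~R|.

(** There are finitely many triples [t] for each [q]. No level occurs here: this is why
    the conjugates of the eigenvalue are bounded independently of [N]. *)
Lemma exists_hecke_words : exists (B : R) (LL : int * int * int -> seq ('M[int]_2 * 'M[int]_2)),
  forall t, hermite_triple t -> hecke_word t (LL t) /\
    forall j, (j < n.+1)%N -> word_norm (LL t) j <= B.
Proof.
have ex t : exists L, hermite_triple t -> hecke_word t L.
  have [ht|ht] := pselect (hermite_triple t); last by exists [::].
  have [a0 d0 _ _] := ht.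
  have dS : 0 < \det (upper t *m Sm).
    by rewrite det_mulmx det_Sm mulr1 det_mx2 mulr0 subr0 mulr_gt0.
  have [u [a [b [d [du a0' d0' _ e]]]]] := hermite_form dS.
  have dt' : 0 < \det (upper (a, b, d)) by rewrite det_mx2 mulr0 subr0 mulr_gt0.
  have [L [hL LP]] := word_cocycle R n (SL2_word du).
  exists [seq (w.1, w.2 *m upper (a, b, d)) | w <- L] => _.
  exists u, (a, b, d); split => //; split.
    by move=> w /mapP [w' /hL [d1 _] ->].
  move=> P cP g dg; rewrite (LP P cP g dg) pslash_sum big_map.
  apply: eq_big_seq => w /hL [d1 d2] /=.
  rewrite -pslashM ?d2 //; apply: (cocycle_size cP); last exact: det_Sm.
  by rewrite det_mulmx dg d1.
have [LL hLL] := choice ex.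
pose ts : seq (int * int * int) :=
  [seq (x, Posz d) | x <- [seq (Posz a, Posz b) | a <- iota 0 q.+1, b <- iota 0 q.+1], d <- iota 0 q.+1].
exists (\sum_(t <- ts) \sum_(j < n.+1) word_norm (LL t) j), LL => t ht.
split; first exact: hLL.
move=> j lj.
have norm0 t' j' : 0 <= word_norm (LL t') j'.
  by apply: sumr_ge0 => w _; apply: sumr_ge0.
have tts : t \in ts.
  case: t ht => [[a b] d] [/= a0 d0 /andP[b0 bd] ad].
  case: a a0 ad => [a|//] a0 ad; case: b b0 bd => [b|//] b0 bd; case: d d0 bd ad => [d|//] d0 bd ad.
  have {}ad : (a * d = q)%N by case: ad.
  have da : (d <= q)%N by rewrite -ad leq_pmull.
  apply: (allpairs_f (fun x d => (x, Posz d))).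
    apply: (allpairs_f (fun a b => (Posz a, Posz b))).
      by rewrite mem_iota /= add0n ltnS -ad leq_pmulr.
    by rewrite mem_iota /= add0n ltnS (leq_trans _ da) // ltnW.
  by rewrite mem_iota /= add0n ltnS.
apply: le_trans (_ : \sum_(j < n.+1) word_norm (LL t) j <= _).
  by rewrite (bigD1 (Ordinal lj)) //= lerDl; apply: sumr_ge0.
rewrite (big_rem t tts) /= lerDl.
by apply: sumr_ge0 => t' _; apply: sumr_ge0.
Qed.

End HeckeWords.
(** * Periods of a cusp form *)

Section PeriodSystem.
Variables (R : realType) (n : nat) (N : nat) (f : R[i] -> R[i]) (c : nat -> R[i]).
Local Notation C := R[i].
Local Notation H := (@upper_half R).
Local Notation k := n.+2.
Implicit Types (g h : 'M[int]_2) (z w : C).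
Hypothesis n0 : (0 < n)%N.
Hypothesis N0 : (0 < N)%N.
Hypothesis fG : forall g, Gamma0 N g -> forall z, H z -> slash k g f z = f z.
Hypothesis fV : forall g, \det g = 1 -> vanish (slash k g f).
Hypothesis ct : tame c.
Hypothesis c0 : c 0%N = 0.
Hypothesis fE : forall z, H z -> f z = qser c z.

Lemma gt0_det g : \det g = 1 -> 0 < \det g.
Proof. by move=> ->. Qed.

Lemma slash_eqH g (phi psi : C -> C) z : 0 < \det g -> H z ->
  (forall w, H w -> phi w = psi w) -> slash k g phi z = slash k g psi z.
Proof. by move=> dg hz e; rewrite !slashE e //; exact: mob_H. Qed.

(** The quotient of the two matrices lies in [Gamma0 N]. *)
Lemma slash_congruent g h : \det g = 1 -> \det h = 1 ->
  (forall i j, (g i j = h i j %[mod N])%Z) ->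
  forall z, H z -> slash k g f z = slash k h f z.
Proof.
move=> dg dh e z hz.
(* h g^-1, congruent to the identity modulo N *)
pose gam := mx2 (h 0 0 * g 1 1 - h 0 1 * g 1 0) (- h 0 0 * g 0 1 + h 0 1 * g 0 0)
  (h 1 0 * g 1 1 - h 1 1 * g 1 0) (- h 1 0 * g 0 1 + h 1 1 * g 0 0).
have dg' := dg; have dh' := dh; rewrite det2E in dg'; rewrite det2E in dh'.
have eh : h = gam *m g.
  have key x : x = x * (g 0 0 * g 1 1 - g 0 1 * g 1 0) by rewrite dg' mulr1.
  by apply: mx2_eq; rewrite mulmx2E !mxE /= [LHS]key; ring.
have dgam : \det gam = 1.
  by have := congr1 determinant eh; rewrite det_mulmx dg dh mulr1.
have gG : Gamma0 N gam.
  split=> //; rewrite !mxE /=.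
  have -> : h 1 0 * g 1 1 - h 1 1 * g 1 0 =
      (h 1 0 - g 1 0) * g 1 1 - (h 1 1 - g 1 1) * g 1 0 by ring.
  by rewrite rpredB // dvdz_mulr // -eqz_mod_dvd; apply/eqP/esym.
rewrite [in RHS]eh slashM ?dgam ?dg //.
by apply: slash_eqH; rewrite ?dg // => w hw; rewrite fG.
Qed.

Lemma mob_Tm m z : mob (Tm m) z = z + m%:~R.
Proof. by rewrite /mob /jf !mxE /= mul1r mul0r add0r divr1. Qed.
Lemma jf_Tm m z : jf (Tm m) z = 1.
Proof. by rewrite /jf !mxE /= mul0r add0r. Qed.

Lemma slash_periodic g : \det g = 1 -> periodic N (slash k g f).
Proof.
move=> dg z hz.
have -> : slash k g f (z + N%:R) = slash k (Tm N) (slash k g f) z.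
  by rewrite [RHS]slashE jf_Tm expr1n invr1 mul1r mob_Tm pmulrn.
rewrite -slashM ?dg ?det_Tm //.
apply: slash_congruent => //; first by rewrite det_mulmx dg det_Tm.
move=> i j; rewrite mulmx2E; case: (ord2P j) => ->; rewrite !mxE /=.
  by rewrite mulr1 mulr0 addr0.
by rewrite mulr1 modzMDl.
Qed.

Lemma exists_canonical g : \det g = 1 -> exists F, canonical n (slash k g f) F.
Proof.
move=> dg; have [eF _] := canonical_qser n ct c0.
have [sF dF] := eichler_slash (gt0_det dg) eF.
have eF' : eichler n (slash k g f) (slashF n g (eichler_integral n c)).
  split=> // i z hz; have := dF i z hz; rewrite dg expr1n mul1r.
  by rewrite -(slash_eqH (gt0_det dg) hz fE).
(* The integral of f itself, slashed by g, lacks only the normalisation. *)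
have [p sp hp] := canonical_exists N0 n0 eF' (slash_periodic dg) (fV dg).
by exists (fun z => slashF n g (eichler_integral n c) z - p).
Qed.

Definition eich g : C -> {poly C} :=
  if pselect (\det g = 1) is left dg then projT1 (cid (exists_canonical dg))
  else fun=> 0.

Lemma eichP g : \det g = 1 -> canonical n (slash k g f) (eich g).
Proof.
by move=> dg; rewrite /eich; case: pselect => // dg'; case: cid.
Qed.

Lemma eich_congruent g h : \det g = 1 -> \det h = 1 ->
  (forall i j, (g i j = h i j %[mod N])%Z) -> forall z, H z -> eich g z = eich h z.
Proof.
move=> dg dh e; apply: canonical_unique (eichP dg) (eichP dh) _.
exact: slash_congruent.
Qed.

Lemma eich1 z : H z -> eich 1%:M z = eichler_integral n c z.
Proof.
move=> hz; apply: (canonical_unique (eichP (det1 _ _)) (canonical_qser n ct c0)) => //.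
move=> w hw; rewrite -fE // slashE /mob /jf !mxE /= !mul0r !add0r addr0 mul1r.
by rewrite expr1n invr1 !mul1r mulr1.
Qed.

(** The choice of the point [i] is immaterial, by [periodE]. *)
Definition period g h : {poly C} :=
  slashF n h (eich g) 'i%C - eich (g *m h) 'i%C.

Lemma eichler_eq phi psi F : (forall z, H z -> phi z = psi z) ->
  eichler n phi F -> eichler n psi F.
Proof. by move=> e [sF dF]; split=> // i z hz; rewrite -e //; exact: dF. Qed.

Lemma eichler_slash_eich g h : \det g = 1 -> \det h = 1 ->
  eichler n (slash k (g *m h) f) (slashF n h (eich g)).
Proof.
move=> dg dh; have [eg _] := eichP dg.
apply: eichler_eq (eichler_slash (gt0_det dh) eg) => z hz.
by rewrite dh expr1n mul1r slashM ?dg ?dh.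
Qed.

Lemma periodE g h z : \det g = 1 -> \det h = 1 -> H z ->
  slashF n h (eich g) z = eich (g *m h) z + period g h.
Proof.
move=> dg dh hz.
have dgh : \det (g *m h) = 1 by rewrite det_mulmx dg dh.
have [p sp hp] := eichler_unique (eichler_slash_eich dg dh) (eichP dgh).1
  (fun z _ => erefl).
have hi : H 'i%C by rewrite /upper_half /=.
by rewrite /period hp // -(hp z hz) addrC subrK.
Qed.

Lemma size_eich g z : \det g = 1 -> H z -> (size (eich g z) <= n.+1)%N.
Proof. by move=> dg; case: (eichP dg) => [[s _] _]; exact: s. Qed.

(** Translations carry canonical integrals to canonical integrals, so their periods
    vanish. *)
Lemma cocycle_period : cocycle n period.
Proof.
have hi : H 'i%C by rewrite /upper_half /=.
split=> [g h dg dh|g h h' dg dh dh'|g m dg].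
- rewrite (leq_trans (size_polyD _ _)) // size_polyN geq_max size_pslash /=.
  by apply: size_eich => //; rewrite det_mulmx dg dh.
- have dgh : \det (g *m h) = 1 by rewrite det_mulmx dg dh.
  rewrite {1}/period.
  have -> : slashF n (h *m h') (eich g) 'i%C = pslash n h' (slashF n h (eich g) (mob h' 'i%C)).
    rewrite /slashF mobM ?dh ?dh' // pslashM ?dh ?dh' //.
    apply: size_eich => //; apply: mob_H; rewrite ?dh //.
    by apply: mob_H; rewrite ?dh'.
  rewrite periodE //; last by apply: mob_H; rewrite ?dh'.
  by rewrite pslashD mulmxA /period /slashF; ring.
- apply/eqP; rewrite subr_eq0; apply/eqP.
  have dgT : \det (g *m Tm m) = 1 by rewrite det_mulmx dg det_Tm.
  apply: (canonical_unique (canonical_slash_upper m ltr01 ltr01 (eichP dg)) (eichP dgT)) => // z hz.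
  by rewrite mulr1 expr1n mul1r slashM ?dg ?det_Tm.
Qed.

Lemma period_congruent g h : \det g = 1 -> \det h = 1 ->
  (forall i j, (g i j = h i j %[mod N])%Z) -> period g Sm = period h Sm.
Proof.
move=> dg dh e; have hi : H 'i%C by rewrite /upper_half /=.
rewrite /period /slashF (eich_congruent dg dh e); last first.
  by apply: mob_H; rewrite ?det_Sm.
congr (_ - _); apply: eich_congruent => //; rewrite ?det_mulmx ?dg ?dh ?det_Sm //.
move=> i j; rewrite !mulmx2E; case: (ord2P j) => ->; rewrite !mxE /=.
  by rewrite !mulr0 !add0r !mulr1 e.
rewrite !mulr0 !addr0 !mulrN1; apply/eqP; rewrite eqz_mod_dvd.
by rewrite -opprD rpredN -eqz_mod_dvd e.
Qed.

Section Hecke.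
Variables (q : nat) (lam : C).
Hypothesis q0 : (0 < q)%N.
Hypothesis hecke_f : forall z, H z -> hecke k 1 q f z = lam * f z.

Definition hecke_rep (i : 'I_q.+1) : 'M[int]_2 :=
  if unlift ord_max i is Some j then mx2 1 (j : nat) 0 q else mx2 q 0 0 1.

Lemma det_hecke_rep i : \det (hecke_rep i) = q.
Proof.
by rewrite /hecke_rep; case: unliftP => [j _|_]; rewrite det_mx2 !mulr0 subr0 ?mul1r ?mulr1.
Qed.

Lemma hecke_sum z : H z ->
  lam * f z = q%:R ^+ n.+1 * \sum_(i < q.+1) slash k (hecke_rep i) f z.
Proof.
move=> hz; rewrite -hecke_f // /hecke mulr1 big_ord_recr mulrDr addrC; congr (_ + _).
  rewrite !mulr_sumr; apply: eq_bigr => j _.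
  have -> : hecke_rep (widen_ord (leqnSn q) j) = mx2 1 (j : nat) 0 q.
    rewrite /hecke_rep; have -> : widen_ord (leqnSn q) j = lift ord_max j.
      by apply: val_inj; rewrite /= /bump leqNgt ltn_ord.
    by rewrite liftK.
  have qC : q%:R != 0 :> C by rewrite pnatr_eq0 -lt0n.
  rewrite slashE /mob /jf !mxE /= mul0r add0r mul1r -!pmulrn mulrA; congr (_ * _).
  by rewrite [q%:R ^+ n.+2]exprS; field; rewrite qC expf_neq0.
have -> : hecke_rep ord_max = mx2 q 0 0 1 by rewrite /hecke_rep unlift_none.
by rewrite slashE /mob /jf !mxE /= mul0r add0r addr0 expr1n invr1 mul1r mulr1 -pmulrn.
Qed.

(** Both sides are canonical integrals of the same function, as the matrices on the
    right are upper triangular. *)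
Lemma hecke_canonical g (h : 'I_q.+1 -> 'M[int]_2) (a b d : 'I_q.+1 -> int) :
  \det g = 1 -> (forall i, [/\ \det (h i) = 1, 0 < a i, 0 < d i &
     hecke_rep i *m g = h i *m mx2 (a i) (b i) 0 (d i)]) ->
  forall z, H z -> lam *: eich g z =
    \sum_(i < q.+1) slashF n (mx2 (a i) (b i) 0 (d i)) (eich (h i)) z.
Proof.
move=> dg hh.
have ad i : a i * d i = q.
  have [h1 _ _ e] := hh i; have := congr1 determinant e.
  by rewrite !det_mulmx h1 dg det_hecke_rep det_mx2 mulr0 subr0 mul1r mulr1 => ->.
have can1 := canonical_scale lam (eichP dg).
have can2 := canonical_sum (index_enum _) (fun i : 'I_q.+1 =>
  canonical_slash_upper (b i) (let: And4 _ a0 _ _ := hh i in a0)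
    (let: And4 _ _ d0 _ := hh i in d0) (eichP (let: And4 h1 _ _ _ := hh i in h1))).
apply: canonical_unique can1 can2 _ => z hz /=.
have hgz := mob_H (gt0_det dg) hz.
rewrite slashE mulrCA hecke_sum // mulrCA mulr_sumr mulr_sumr; apply: eq_bigr => i _.
have [h1 a0 d0 e] := hh i.
rewrite ad -pmulrn; congr (_ * _).
have dm : 0 < \det (mx2 (a i) (b i) 0 (d i)) by rewrite det_mx2 mulr0 subr0 mulr_gt0.
rewrite -slashM ?h1 // -e slashM ?det_hecke_rep ?dg //.
Qed.

(** The integrals attached to [g] and to [g S] are both expanded by
    [hecke_canonical]. The decompositions of [alpha g] and [alpha g S] differ by the
    matrices [u i], whose periods are what survives in the difference. *)
Lemma hecke_period g (h : 'I_q.+1 -> 'M[int]_2) (a b d : 'I_q.+1 -> int)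
    (u : 'I_q.+1 -> 'M[int]_2) (a' b' d' : 'I_q.+1 -> int) :
  \det g = 1 -> (forall i, [/\ \det (h i) = 1, 0 < a i, 0 < d i &
     hecke_rep i *m g = h i *m mx2 (a i) (b i) 0 (d i)]) ->
  (forall i, [/\ \det (u i) = 1, 0 < a' i, 0 < d' i &
     mx2 (a i) (b i) 0 (d i) *m Sm = u i *m mx2 (a' i) (b' i) 0 (d' i)]) ->
  lam *: period g Sm =
    \sum_(i < q.+1) pslash n (mx2 (a' i) (b' i) 0 (d' i)) (period (h i) (u i)).
Proof.
move=> dg hh hu; have hi : H 'i%C by rewrite /upper_half /=.
have hSi : H (mob Sm 'i%C) by apply: mob_H; rewrite ?det_Sm.
have dgS : \det (g *m Sm) = 1 by rewrite det_mulmx dg det_Sm.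
have hgS i : [/\ \det (h i *m u i) = 1, 0 < a' i, 0 < d' i &
     hecke_rep i *m (g *m Sm) = (h i *m u i) *m mx2 (a' i) (b' i) 0 (d' i)].
  have [h1 a0 d0 e] := hh i; have [u1 a0' d0' e'] := hu i.
  by split=> //; [rewrite det_mulmx h1 u1 | rewrite mulmxA e -!mulmxA e'].
rewrite /period scalerBr (hecke_canonical dgS hgS hi).
have -> : lam *: slashF n Sm (eich g) 'i%C =
    \sum_(i < q.+1) pslash n (mx2 (a' i) (b' i) 0 (d' i))
       (slashF n (u i) (eich (h i)) (mob (mx2 (a' i) (b' i) 0 (d' i)) 'i%C)).
  rewrite /slashF -pslashZ (hecke_canonical dg hh hSi) pslash_sum.
  apply: eq_bigr => i _; have [h1 a0 d0 e] := hh i; have [u1 a0' d0' e'] := hu i.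
  have dm : 0 < \det (mx2 (a i) (b i) 0 (d i)) by rewrite det_mx2 mulr0 subr0 mulr_gt0.
  have dm' : 0 < \det (mx2 (a' i) (b' i) 0 (d' i)) by rewrite det_mx2 mulr0 subr0 mulr_gt0.
  have hm : H (mob (mx2 (a i) (b i) 0 (d i)) (mob Sm 'i%C)) by apply: mob_H.
  rewrite /slashF -pslashM ?det_Sm //; last exact: size_eich.
  rewrite -mobM ?det_Sm // e' mobM ?u1 // pslashM ?u1 //.
  by apply: size_eich => //; apply: mob_H; rewrite ?u1 //; apply: mob_H.
rewrite -sumrB; apply: eq_bigr => i _.
have [h1 a0 d0 e] := hh i; have [u1 a0' d0' e'] := hu i.
have dm' : 0 < \det (mx2 (a' i) (b' i) 0 (d' i)) by rewrite det_mx2 mulr0 subr0 mulr_gt0.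
rewrite -/(period (h i) (u i)) periodE //; last exact: mob_H.
by rewrite pslashD /slashF addrAC subrr add0r.
Qed.

End Hecke.

Definition residue_class g : 'M['I_N]_2 := \matrix_(i, j)
  Ordinal (ltac:(by rewrite -ltz_nat gez0_abs ?modz_ge0 ?ltz_pmod // -lt0n) :
    (absz (g i j %% N)%Z < N)%N).

Lemma residue_class_eq g h : residue_class g = residue_class h ->
  forall i j, (g i j = h i j %[mod N])%Z.
Proof.
move=> /matrixP e i j; have := congr1 val (e i j); rewrite !mxE /= => e'.
have N0' : (N : int) != 0 by rewrite -lt0n.
by rewrite -(gez0_abs (modz_ge0 (g i j) N0')) e' gez0_abs ?modz_ge0.
Qed.

(** There are finitely many classes of matrices modulo [N]. *)
Lemma uniform_over_classes (Q : 'M[int]_2 -> R -> Prop) :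
  (forall g B B', B <= B' -> Q g B -> Q g B') ->
  (forall g h B, \det g = 1 -> \det h = 1 -> (forall i j, (g i j = h i j %[mod N])%Z) ->
     Q g B -> Q h B) ->
  (forall g, \det g = 1 -> exists B, Q g B) ->
  exists2 B, 0 <= B & forall g, \det g = 1 -> Q g B.
Proof.
move=> mono cong ex.
have ex' x : exists B, forall g, \det g = 1 -> residue_class g = x -> Q g B.
  have [[g [dg gx]]|no] := pselect (exists g, \det g = 1 /\ residue_class g = x).
    have [B hB] := ex g dg; exists B => h dh hx; apply: cong hB => //.
    by apply: residue_class_eq; rewrite gx hx.
  by exists 0 => g dg gx; case: no; exists g.
have [b hb] := choice ex'.
exists (\sum_x `|b x|); first by apply: sumr_ge0.
move=> g dg; apply: mono (hb _ g dg erefl).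
rewrite (bigD1 (residue_class g)) //= (le_trans (ler_norm _)) // lerDl.
by apply: sumr_ge0.
Qed.

Definition eichv g z : C := (eich g z).[z].

Lemma eichv_congruent g h : \det g = 1 -> \det h = 1 ->
  (forall i j, (g i j = h i j %[mod N])%Z) -> forall z, H z -> eichv g z = eichv h z.
Proof. by move=> dg dh e z hz; rewrite /eichv (eich_congruent dg dh e hz). Qed.

Lemma eichv_slash g h z : \det g = 1 -> \det h = 1 -> H z ->
  jf h z ^+ n * eichv g (mob h z) = eichv (g *m h) z + (period g h).[z].
Proof.
move=> dg dh hz; have := congr1 (fun p : {poly C} => p.[z]) (periodE dg dh hz).
rewrite /= hornerD /slashF horner_pslash ?dh //.
by apply: size_eich => //; apply: mob_H; rewrite ?dh.
Qed.

Lemma eichv_shift g m z : \det g = 1 -> H z ->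
  eichv (g *m Tm m) z = eichv g (z + m%:~R).
Proof.
move=> dg hz; have := eichv_slash dg (det_Tm m) hz.
by rewrite (cocycleT cocycle_period) // horner0 addr0 jf_Tm expr1n mul1r mob_Tm.
Qed.

Lemma H_shiftz z (m : int) : H z -> H (z + m%:~R).
Proof. by rewrite intC; exact: H_shift. Qed.

Lemma jf_Sm z : jf Sm z = z.
Proof. by rewrite /jf !mxE /= mul1r addr0. Qed.

Lemma horner_bound (p : {poly C}) z (Z : R) : nm z <= Z ->
  nm p.[z] <= \sum_(i < size p) nm p`_i * Z ^+ i.
Proof.
move=> hz; rewrite horner_coef; apply: le_trans (nm_sum _ _ _) _.
apply: ler_sum => i _; rewrite nmM nmX ler_wpM2l ?nm_ge0 //.
by rewrite lerXn2r ?nnegrE ?nm_ge0 // (le_trans (nm_ge0 _) hz).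
Qed.

(** Very high up the normalisation gives the bound. The rest of the strip is bounded and
    [g] maps it above some horizontal line, where the [q]-series is bounded. *)
Lemma eichv_bound_strip g : \det g = 1 -> exists B, forall z, H z ->
  0 <= complex.Re z <= 1 -> 2^-1 <= complex.Im z -> nm (eichv g z) <= B.
Proof.
move=> dg; have [_ vg] := eichP dg; have [Y hY] := vg 1 ltr01.
have [eF _] := canonical_qser n ct c0.
have esl : eichler n (slash k g f) (slashF n g (eichler_integral n c)).
  apply: eichler_eq (eichler_slash (gt0_det dg) eF) => z hz.
  by rewrite dg expr1n mul1r -(slash_eqH (gt0_det dg) hz fE).
have [p sp hp] := eichler_unique esl (eichP dg).1 (fun z _ => erefl).
pose b m := n`!%:R * int_coef c n.+1 m.
have bt : tame b.
  by apply: (tame_le (K := nm n`!%:R)) (tame_int_coef n.+1 ct c0) => m; rewrite nmM.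
have b0 : b 0%N = 0 by rewrite /b /int_coef c0 mul0r mulr0.
pose Z : R := 1 + `|Y|.
have Z0 : 0 <= Z by rewrite addr_ge0.
pose J : R := nm (g 1 0)%:~R * Z + nm (g 1 1)%:~R + 1.
have J0 : 0 < J by rewrite ltr_wpDl // addr_ge0 ?mulr_ge0 ?nm_ge0.
pose y0 := 2^-1 / J ^+ 2.
have y00 : 0 < y0 by rewrite divr_gt0 ?exprn_gt0.
have [B1 B10 hB1] := qser_cusp bt b0 y00.
have S0 : 0 <= \sum_(i < size p) nm p`_i * Z ^+ i.
  by apply: sumr_ge0 => i _; rewrite mulr_ge0 ?nm_ge0 ?exprn_ge0.
exists (1 + J ^+ n * B1 + \sum_(i < size p) nm p`_i * Z ^+ i) => z hz /andP[re0 re1] im.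
have [Yz|zY] := ltP Y (complex.Im z).
  apply: le_trans (hY z hz Yz) _.
  by rewrite -addrA lerDl addr_ge0 // mulr_ge0 // exprn_ge0 // ltW.
have nz : nm z <= Z.
  apply: le_trans (nm_le_ReIm z) _; apply: lerD; first by rewrite ger0_norm.
  rewrite ger0_norm ?(ltW hz) //; exact: le_trans zY (ler_norm _).
have hgz := mob_H (gt0_det dg) hz.
have nj : nm (jf g z) <= J.
  apply: le_trans (nmD _ _) _; rewrite nmM /J.
  have : nm (g 1 0)%:~R * nm z <= nm (g 1 0)%:~R * Z by rewrite ler_wpM2l ?nm_ge0.
  by lra.
have j0 : 0 < nm (jf g z) by apply: nm_gt0; apply: jf_neq0 => //; rewrite dg.
have ygz : y0 <= complex.Im (mob g z).
  rewrite Im_mob ?dg // mul1r /y0; apply: ler_pM => //.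
    by rewrite invr_ge0 exprn_ge0 // ltW.
  by rewrite lef_pV2 ?posrE ?exprn_gt0 // lerXn2r ?nnegrE ?(ltW J0) ?(ltW j0).
have -> : eichv g z = jf g z ^+ n * qser b (mob g z) - p.[z].
  rewrite -(hp z hz) hornerD hornerN /slashF horner_pslash ?dg //; last first.
    by rewrite (canonical_qser n ct c0).1.1.
  by rewrite horner_eichler_integral // opprD opprK addNKr.
apply: le_trans (nmB _ _) _; apply: lerD; last exact: horner_bound.
rewrite nmM nmX; apply: le_trans (_ : J ^+ n * B1 <= _); last by rewrite lerDr.
apply: ler_pM; rewrite ?nm_ge0 ?exprn_ge0 ?nm_ge0 //.
  by rewrite lerXn2r ?nnegrE ?(ltW J0) ?(ltW j0).
apply: le_trans (hB1 _ ygz) _; rewrite ler_piMr // expR_le1.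
by rewrite !mulNr oppr_le0 !mulr_ge0 ?pi_ge0 // subr_ge0.
Qed.

Lemma eichv_bound_high : exists2 B, 0 <= B & forall g z, \det g = 1 -> H z ->
  2^-1 <= complex.Im z -> nm (eichv g z) <= B.
Proof.
have [|||B B0 hB] := @uniform_over_classes (fun g B => forall z, H z ->
  0 <= complex.Re z <= 1 -> 2^-1 <= complex.Im z -> nm (eichv g z) <= B).
- by move=> g B B' le h z hz h1 h2; apply: le_trans (h z hz h1 h2) le.
- by move=> g h B dg dh e hB z hz h1 h2; rewrite -(eichv_congruent dg dh e hz); exact: hB.
- exact: eichv_bound_strip.
exists B => // g z dg hz im.
pose m := Num.floor (complex.Re z).
have e : z = (z + (- m)%:~R) + m%:~R by rewrite -addrA -intrD addNr addr0.
have hz' := H_shiftz (- m) hz.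
have ImE : complex.Im (z + (- m)%:~R) = complex.Im z by rewrite intC ImD /= addr0.
have ReE : complex.Re (z + (- m)%:~R) = complex.Re z - m%:~R.
  by rewrite intC ReD /= rmorphN.
rewrite e -eichv_shift //; apply: hB => //.
- by rewrite det_mulmx dg det_Tm.
- have h1 := floor_le (complex.Re z).
  have h2 := floorD1_gt (complex.Re z).
  by rewrite ReE; move: h1 h2; rewrite -/m intrD; lra.
- by rewrite ImE.
Qed.

(** A translation brings [z] to [w] with real part at most 1/2 in absolute value.
    Since [|w|^2 <= 1/2], the inversion at least doubles the height, while the
    factor [w ^+ n] is a contraction. *)
Lemma reduction_step g z : \det g = 1 -> H z -> complex.Im z < 2^-1 ->
  exists h w, [/\ \det h = 1, H w, nm w ^+ 2 <= 2^-1,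
    complex.Im w = complex.Im z &
    eichv g z = w ^+ n * eichv h (mob Sm w) - (period h Sm).[w]].
Proof.
move=> dg hz im.
pose m := Num.floor (complex.Re z + 2^-1).
pose w := z + (- m)%:~R.
have hw : H w by exact: H_shiftz.
have ImE : complex.Im w = complex.Im z by rewrite /w intC ImD /= addr0.
have ReE : complex.Re w = complex.Re z - m%:~R.
  by rewrite /w intC ReD /= rmorphN.
(* S^4 = 1, so that h S = g T^m. *)
pose h := g *m Tm m *m Sm *m Sm *m Sm.
have dh : \det h = 1 by rewrite !det_mulmx dg det_Tm det_Sm.
have hS : h *m Sm = g *m Tm m.
  rewrite /h -!mulmxA; congr (_ *m _); rewrite -[RHS]mulmx1; congr (_ *m _).
  by apply: mx2_eq; rewrite !mulmx2E !mxE /=.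
exists h, w; split => //.
- rewrite nm_sqr ImE ReE.
  have h1 := floor_le (complex.Re z + 2^-1); have h2 := floorD1_gt (complex.Re z + 2^-1).
  move: h1 h2; rewrite -/m intrD => h1 h2.
  have hzi : 0 < complex.Im z by exact: hz.
  have a1 : (complex.Re z - m%:~R) ^+ 2 <= 2^-1 ^+ 2.
    rewrite -real_normK ?num_real // lerXn2r ?nnegrE // ler_norml; apply/andP; lra.
  have a2 : complex.Im z ^+ 2 <= 2^-1 ^+ 2 by rewrite lerXn2r ?nnegrE // ltW.
  by lra.
- have := eichv_slash dh det_Sm hw; rewrite hS jf_Sm eichv_shift // => ->.
  by rewrite addrK /w -addrA -intrD addNr addr0.
Qed.

Lemma Im_mob_Sm w : H w -> complex.Im (mob Sm w) = complex.Im w / nm w ^+ 2.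
Proof. by move=> hw; rewrite Im_mob ?det_Sm // mul1r jf_Sm. Qed.

Lemma nm_H_gt0 w : H w -> 0 < nm w.
Proof.
move=> hw; apply: lt_le_trans (Im_le_nm w); rewrite normr_gt0; exact: lt0r_neq0.
Qed.

(** The height doubles in each step, so the reduction terminates. *)
Lemma reduction_ind (Q : 'M[int]_2 -> C -> Prop) :
  (forall g z, \det g = 1 -> H z -> 2^-1 <= complex.Im z -> Q g z) ->
  (forall g z h w, \det g = 1 -> H z -> \det h = 1 -> H w -> nm w ^+ 2 <= 2^-1 ->
     complex.Im w = complex.Im z ->
     eichv g z = w ^+ n * eichv h (mob Sm w) - (period h Sm).[w] ->
     Q h (mob Sm w) -> Q g z) ->
  forall g z, \det g = 1 -> H z -> Q g z.
Proof.
move=> base step g z dg hz.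
have [m hm] : exists m, 2^-1 <= 2 ^+ m * complex.Im z.
  have y0 : 0 < complex.Im z := hz.
  have x0 : 0 <= 2^-1 / complex.Im z by rewrite divr_ge0 // ltW.
  exists (Num.bound (2^-1 / complex.Im z)); rewrite -ler_pdivrMr //.
  apply: le_trans (ltW (archi_boundP x0)) _.
  by rewrite -natrX ler_nat ltnW // ltn_expl.
elim: m g z dg hz hm => [|m IH] g z dg hz hm.
  by apply: base => //; rewrite expr0 mul1r in hm.
have [im|im] := leP 2^-1 (complex.Im z); first exact: base.
have [h [w [dh hw nw iw e]]] := reduction_step dg hz im.
apply: (step g z h w) => //; apply: IH => //; first by apply: mob_H; rewrite ?det_Sm.
rewrite Im_mob_Sm // iw; apply: le_trans hm _.
rewrite exprSr -mulrA ler_wpM2l ?exprn_ge0 //.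
have nw0 := nm_H_gt0 hw.
rewrite mulrC ler_wpM2l ?(ltW hz) // -[X in X <= _]invrK lef_pV2 ?posrE ?invr_gt0 ?exprn_gt0 //.
Qed.

Lemma period_value_bound : exists2 B, 0 <= B & forall g z, \det g = 1 -> nm z <= 1 ->
  nm (period g Sm).[z] <= B.
Proof.
have [|||B B0 hB] := @uniform_over_classes (fun g B => forall z, nm z <= 1 ->
  nm (period g Sm).[z] <= B).
- by move=> g B B' le h z hz; apply: le_trans (h z hz) le.
- by move=> g h B dg dh e hB z hz; rewrite -(period_congruent dg dh e); exact: hB.
- move=> g dg; exists (\sum_(i < size (period g Sm)) nm (period g Sm)`_i * 1 ^+ i) => z.
  exact: horner_bound.
by exists B => // g z dg hz; exact: hB.
Qed.

Lemma nm_le1 w : nm w ^+ 2 <= 2^-1 -> nm w <= 1.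
Proof.
move=> h; rewrite -(ler_pXn2r (n := 2)) ?nnegrE ?nm_ge0 // expr1n.
by apply: le_trans h _; rewrite invf_le1 // ler1n.
Qed.

Hypothesis n2 : (1 < n)%N.

(** The value at [z] is at most half of a value higher up, plus a bounded period. *)
Lemma eichv_bounded : exists K, forall g z, \det g = 1 -> H z -> nm (eichv g z) <= K.
Proof.
have [B B0 hB] := eichv_bound_high; have [B' B0' hB'] := period_value_bound.
(* 2 B' is the fixed point of K |-> K / 2 + B', and 2 B covers the points of
   height at least 1/2. *)
exists (2 * (B + B')); apply: reduction_ind => [g z dg hz im|].
  by apply: le_trans (hB g z dg hz im) _; lra.
move=> g z h w dg hz dh hw nw iw -> IH.
apply: le_trans (nmB _ _) _; rewrite nmM nmX.
have n1 := nm_le1 nw.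
have wn : nm w ^+ n <= 2^-1.
  by apply: le_trans nw; rewrite ler_wiXn2l ?nm_ge0.
have h1 : nm w ^+ n * nm (eichv h (mob Sm w)) <= 2^-1 * (2 * (B + B')).
  by apply: ler_pM; rewrite ?exprn_ge0 ?nm_ge0.
have h2 := hB' h w dh n1.
by lra.
Qed.

(** Without periods, [|eichv g z|^2 / (Im z)^n] is unchanged by a reduction step, as
    for a form of weight [-n]. *)
Lemma eichv_decay : (forall g, \det g = 1 -> period g Sm = 0) ->
  exists2 B, 0 <= B & forall g z, \det g = 1 -> H z ->
    nm (eichv g z) ^+ 2 <= B * (2 * complex.Im z) ^+ n.
Proof.
move=> p0; have [B B0 hB] := eichv_bound_high.
exists (B ^+ 2); first exact: sqr_ge0.
apply: reduction_ind => [g z dg hz im|].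
  apply: le_trans (_ : B ^+ 2 <= _).
    by rewrite lerXn2r ?nnegrE ?nm_ge0 // hB.
  rewrite ler_peMr ?sqr_ge0 // exprn_ege1 //.
  by rewrite -ler_pdivrMl // mulr1.
move=> g z h w dg hz dh hw nw iw -> IH.
rewrite p0 // horner0 subr0 nmM nmX exprMn.
apply: le_trans (ler_wpM2l _ IH) _; first by rewrite sqr_ge0.
rewrite Im_mob_Sm // -iw; have nw0 := nm_H_gt0 hw.
rewrite le_eqVlt; apply/orP; left; apply/eqP.
rewrite !exprMn exprVn -!exprM [(2 * n)%N]mulnC.
have : nm w ^+ (n * 2) != 0 by rewrite expf_neq0 // lt0r_neq0.
by move: (nm w ^+ (n * 2)) => x x0; field.
Qed.

Definition eich_coef (m : nat) : C := n`!%:R * int_coef c n.+1 m.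

Lemma tame_eich_coef : tame eich_coef.
Proof.
by apply: (tame_le (K := nm n`!%:R)) (tame_int_coef n.+1 ct c0) => m; rewrite nmM.
Qed.

Lemma eichv1 z : H z -> eichv 1%:M z = qser eich_coef z.
Proof. by move=> hz; rewrite /eichv eich1 // horner_eichler_integral. Qed.

(** Otherwise [eichv_decay] and Bessel's inequality at height [y -> 0] annihilate
    the first coefficient, a nonzero multiple of [c 1]. *)
Lemma exists_nonzero_period : c 1%N = 1 -> exists2 g, \det g = 1 & period g Sm != 0.
Proof.
move=> c1; apply: contrapT => no.
have p0 g : \det g = 1 -> period g Sm = 0.
  by move=> dg; apply/eqP; apply: contrapT => /negP h; apply: no; exists g.
have [B B0 hB] := eichv_decay p0.
pose b1 := nm (eich_coef 1).
have b10 : 0 < b1.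
  apply: nm_gt0; apply: mulf_neq0; first by rewrite pnatr_eq0 -lt0n fact_gt0.
  by rewrite /int_coef c1 mul1r invr_eq0 expf_neq0 // mulr1 twopii_neq0.
have b120 : 0 < b1 ^+ 2 by rewrite exprn_gt0.
pose K := expR (2 * pi * 1) ^+ 2 * B * 2 : R.
have K0 : 0 <= K by rewrite !mulr_ge0 ?exprn_ge0 ?expR_ge0.
pose y := Num.min 2^-1 (b1 ^+ 2 / (K + 1) / 2).
have y0 : 0 < y by rewrite lt_min !divr_gt0 // ?invr_gt0 // ltr_wpDl.
have y12 : y <= 2^-1 by rewrite ge_min lexx.
have yb : y <= b1 ^+ 2 / (K + 1) / 2 by rewrite ge_min lexx orbT.
have [S0 Sy] : 0 <= B * (2 * y) ^+ n /\ B * (2 * y) ^+ n <= B * (2 * y).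
  split; first by rewrite mulr_ge0 // exprn_ge0 // mulr_ge0 // ltW.
  have y2 : 2 * y <= 1 by rewrite -ler_pdivlMl // mulr1.
  have y20 : 0 <= 2 * y by rewrite mulr_ge0 // ltW.
  by rewrite ler_wpM2l // -[X in _ <= X]expr1 ler_wiXn2l.
have := @coef_bound R eich_coef y (Num.sqrt (B * (2 * y) ^+ n)) 1 tame_eich_coef y0.
have hx (x : R) : nm (qser eich_coef (x +i* y)) <= Num.sqrt (B * (2 * y) ^+ n).
  have hz : H (x +i* y) by [].
  rewrite -eichv1 // -[leLHS]ger0_norm ?nm_ge0 // -sqrtr_sqr ler_sqrt //.
  exact: hB (det1 _ _) hz.
move=> /(_ hx); rewrite expr1 -/b1 => hb.
have : (b1 * expR (-2 * pi * y)) ^+ 2 <= B * (2 * y).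
  apply: le_trans Sy; rewrite -[leRHS]sqr_sqrtr // lerXn2r ?nnegrE ?sqrtr_ge0 //.
  by rewrite mulr_ge0 ?expR_ge0 // ltW.
rewrite exprMn => hb2.
have e1 : 1 <= expR (2 * pi * 1) * expR (-2 * pi * y).
  rewrite -expRD -[X in X <= _]expR0 ler_expR.
  have -> : 2 * pi * 1 + -2 * pi * y = 2 * pi * (1 - y) by ring.
  rewrite !mulr_ge0 ?pi_ge0 // subr_ge0; apply: le_trans y12 _.
  by rewrite invf_le1 // ler1n.
have e2 : 1 <= (expR (2 * pi * 1) * expR (-2 * pi * y)) ^+ 2 by exact: exprn_ege1.
rewrite exprMn in e2.
move: e2 hb2; set E1 := expR _ ^+ 2; set E2 := expR _ ^+ 2 => e2 hb2.
have E10 : 0 <= E1 by exact: sqr_ge0.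
have : b1 ^+ 2 <= K * y.
  apply: le_trans (_ : E1 * (b1 ^+ 2 * E2) <= _).
    by rewrite mulrCA ler_peMr // ltW.
  apply: le_trans (ler_wpM2l E10 hb2) _.
  by rewrite /K -/E1 le_eqVlt; apply/orP; left; apply/eqP; ring.
have K1 : 0 < K + 1 by rewrite ltr_wpDl.
have h3 : (K + 1) * y <= b1 ^+ 2 / 2 by rewrite mulrC -ler_pdivlMr // mulrAC.
have h4 : b1 ^+ 2 / 2 < b1 ^+ 2 by rewrite ltr_pdivrMr // ltr_pMr // ltr1n.
have h5 : K * y <= (K + 1) * y by rewrite ler_wpM2r ?(ltW y0) // lerDl.
by move=> h6; have := le_lt_trans h6 (le_lt_trans h5 (le_lt_trans h3 h4)); rewrite ltxx.
Qed.

Section HeckeEigenvalue.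
Variables (q : nat) (lam : C).
Hypothesis q1 : (1 < q)%N.
Hypothesis hecke_f : forall z, H z -> hecke k 1 q f z = lam * f z.
Hypothesis c1 : c 1%N = 1.

Let q0 : (0 < q)%N := ltnW q1.

Lemma hecke_coefs m : lam * c m = q%:R ^+ n.+1 * dilate q c m + c (q * m)%N.
Proof.
apply: (@hecke_coefficients R q q0 k c lam ct) => z hz.
rewrite -(fE hz) -hecke_f // /hecke fE; last exact: H_natM.
by congr (_ + _ * _); apply: eq_bigr => j _; rewrite fE //; exact: H_divnat.
Qed.

Lemma eigenvalue_coef : lam = c q.
Proof.
have := hecke_coefs 1; rewrite c1 mulr1 muln1 /dilate dvdn1 gtn_eqF //.
by rewrite mulr0 add0r.
Qed.

Lemma eisenstein_coefs : lam = 1 + q%:R ^+ n.+1 -> forall i,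
  exists2 s : nat, c (q ^ i)%N = s%:R & (q ^ (i * n.+1) <= s)%N.
Proof.
move=> elam.
have rec i : c (q ^ i.+1)%N = 1 + q%:R ^+ n.+1 * c (q ^ i)%N.
  elim: i => [|i IH].
    by rewrite expn1 expn0 c1 mulr1 -eigenvalue_coef elam.
  have := hecke_coefs (q ^ i.+1); rewrite -expnS /dilate expnS dvdn_mulr // mulKn //.
  rewrite -expnS => h.
  have -> : c (q ^ i.+2)%N = lam * c (q ^ i.+1)%N - q%:R ^+ n.+1 * c (q ^ i)%N.
    by rewrite h addrAC subrr add0r.
  by rewrite elam IH; ring.
elim=> [|i [s e le]]; first by exists 1%N; rewrite ?expn0 ?c1 // mul0n.
exists (1 + q ^ n.+1 * s)%N; first by rewrite rec e natrD natrM natrX.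
rewrite mulSn expnD (leq_trans _ (leq_addl _ _)) //.
by rewrite leq_mul2l le orbT.
Qed.

(** Otherwise the coefficients of the bounded function [eichv 1] would not tend
    to zero along the powers of [q], against Bessel's inequality. *)
Lemma eigenvalue_not_eisenstein : lam != 1 + q%:R ^+ n.+1.
Proof.
apply/eqP => elam; have hs := eisenstein_coefs elam.
have [K hK] := eichv_bounded.
pose kap : R := n`!%:R / (2 * pi) ^+ n.+1.
have p20 : 0 < 2 * pi :> R by rewrite mulr_gt0 ?pi_gt0.
have kap0 : 0 < kap by rewrite divr_gt0 ?exprn_gt0 // ltr0n fact_gt0.
have hkap i : kap <= nm (eich_coef (q ^ i)%N).
  have [s e le] := hs i.
  rewrite /eich_coef /int_coef nmM nm_nat nmM e nm_nat nmV nmX nmM nm_twopii nm_nat.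
  rewrite /kap ler_wpM2l // [(2 * pi * _) ^+ _]exprMn.
  have v0 : 0 < (q ^ i)%:R ^+ n.+1 :> R by rewrite exprn_gt0 // ltr0n expn_gt0 q0.
  have u0 : 0 < (2 * pi) ^+ n.+1 :> R by rewrite exprn_gt0.
  rewrite ler_pdivlMr ?mulr_gt0 // mulrA mulVf ?mul1r; last exact: lt0r_neq0.
  by rewrite -natrX -expnM ler_nat.
(* So many powers of q that their terms alone exceed the bound K^2. *)
pose L := Num.bound (K ^+ 2 / (kap / 2) ^+ 2).
have hL : K ^+ 2 < L%:R * (kap / 2) ^+ 2.
  have k20 : 0 < (kap / 2) ^+ 2 by rewrite exprn_gt0 // divr_gt0.
  have x0 : 0 <= K ^+ 2 / (kap / 2) ^+ 2 by rewrite divr_ge0 ?sqr_ge0.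
  by have := archi_boundP x0; rewrite ltr_pdivrMr.
pose M := (q ^ L)%N; have M0 : (0 < M)%N by rewrite expn_gt0 q0.
have MR : 0 < M%:R :> R by rewrite ltr0n.
(* So small that rho^m >= 1/2 for all m <= M, because e^x >= 1 + x. *)
pose y : R := (2 * (2 * pi) * M%:R)^-1.
have y0 : 0 < y by rewrite invr_gt0 !mulr_gt0 ?pi_gt0.
pose rho := expR (- 2 * pi * y).
have rho0 : 0 <= rho by exact: expR_ge0.
have rho1 : rho <= 1 by rewrite expR_le1 !mulNr oppr_le0 !mulr_ge0 ?pi_ge0 // ltW.
have rhoM m : (m <= M)%N -> 2^-1 <= rho ^+ m.
  move=> le; apply: le_trans (_ : rho ^+ M <= _); last by rewrite ler_wiXn2l.
  rewrite /rho -expRM_natr; apply: le_trans (expR_ge1Dx _).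
  have -> : - 2 * pi * y * M%:R = - 2^-1.
    have M1 : M%:R != 0 :> R by exact: lt0r_neq0.
    have pi1 : pi != 0 :> R by rewrite lt0r_neq0 // pi_gt0.
    by rewrite /y; move: (M%:R : R) (pi : R) M1 pi1 => u v u1 v1; field; rewrite u1 v1.
  by lra.
pose t m := (nm (eich_coef m) * rho ^+ m) ^+ 2.
have t0 m : 0 <= t m by exact: sqr_ge0.
have tq i : (q ^ i <= M)%N -> (kap / 2) ^+ 2 <= t (q ^ i)%N.
  move=> le.
  have k2 : 0 <= kap / 2 by rewrite divr_ge0 // ltW.
  have h : kap / 2 <= nm (eich_coef (q ^ i)%N) * rho ^+ (q ^ i).
    by apply: ler_pM; [exact: ltW | | exact: hkap | exact: rhoM]; rewrite invr_ge0.
  by rewrite /t lerXn2r ?nnegrE // (le_trans k2 h).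
have sum_ge j : (j <= L)%N -> j%:R * (kap / 2) ^+ 2 <= \sum_(m < q ^ j) t m.
  elim: j => [|j IH] le; first by rewrite mul0r sumr_ge0.
  have leq : (q ^ j < q ^ j.+1)%N by rewrite ltn_exp2l.
  rewrite -(big_mkord xpredT t) (big_cat_nat _ (ltnW leq)) //= big_mkord.
  rewrite -natr1 mulrDl mul1r; apply: lerD; first exact/IH/ltnW.
  rewrite big_ltn //; apply: le_trans (tq j _) _; last by rewrite lerDl sumr_ge0.
  by rewrite leq_exp2l // ltnW.
have := sum_ge L (leqnn L); rewrite leNgt => /negP; apply.
apply: le_lt_trans hL; apply: (@bessel R eich_coef y K tame_eich_coef y0) => x.
have hz : H (x +i* y) by [].
by rewrite -eichv1 //; apply: hK => //; exact: det1.
Qed.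

(** The coefficients of the periods at [S], for [g] running over the matrices modulo
    [N], form a nonzero eigenvector of an integer matrix. Its size grows with [N], but
    its row sums are bounded by the words in [LL] alone. *)
Lemma eigenvalue_integer_polynomial (B : R) (LL : int * int * int -> seq ('M[int]_2 * 'M[int]_2)) :
  (forall t, hermite_triple q t -> hecke_word R n t (LL t) /\
     forall j, (j < n.+1)%N -> word_norm R n (LL t) j <= B) ->
  exists2 chi : {poly int}, chi \is monic & root (map_poly intr chi) lam /\
    forall mu : C, root (map_poly intr chi) mu -> nm mu <= q.+1%:R * B.
Proof.
move=> hLL.
pose has x g := \det g = 1 /\ residue_class g = x.
pose rp x : 'M[int]_2 := if pselect (exists g, has x g) is left ex then projT1 (cid ex) else 1%:M.
have rpP x g : has x g -> has x (rp x).
  by rewrite /rp => hg; case: pselect => [ex|no]; [case: cid | case: no; exists g].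
have det_rp x : \det (rp x) = 1.
  rewrite /rp; case: pselect => [ex|no]; last exact: det1.
  by case: (cid ex) => g [].
have hdata x (i : 'I_q.+1) : exists D : 'M[int]_2 * (int * int * int),
    [/\ \det D.1 = 1, hermite_triple q D.2 & hecke_rep i *m rp x = D.1 *m upper D.2].
  have dh : \det (hecke_rep i *m rp x) = q by rewrite det_mulmx det_hecke_rep det_rp mulr1.
  have dh0 : 0 < \det (hecke_rep i *m rp x) by rewrite dh.
  have [h [a [b [d [h1 a0 d0 b0 e]]]]] := hermite_form dh0.
  exists (h, (a, b, d)); split=> //; split=> //=.
  by rewrite -dh e det_mulmx h1 det_mx2 mulr0 subr0 mul1r.
have [D hD] := choice (fun xi => hdata xi.1 xi.2).
pose DD x i := D (x, i).
have hDD x i : [/\ \det (DD x i).1 = 1, hermite_triple q (DD x i).2 &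
    hecke_rep i *m rp x = (DD x i).1 *m upper (DD x i).2] := hD (x, i).
pose ent (w : 'M[int]_2 * 'M[int]_2) (l j : nat) : int := (slash_basis n int w.2 l)`_j.
pose I := ('M['I_N]_2 * 'I_n.+1)%type.
pose A (u v : I) : int := \sum_(i < q.+1) \sum_(w <- LL (DD u.1 i).2)
   (if residue_class ((DD u.1 i).1 *m w.1) == v.1 then ent w v.2 u.2 else 0).
pose vec (u : I) : C := (period (rp u.1) Sm)`_u.2.
have cong g : \det g = 1 -> period (rp (residue_class g)) Sm = period g Sm.
  move=> dg; apply: period_congruent => //; apply: residue_class_eq.
  by have [_ ->] := rpP (residue_class g) g (conj dg erefl).
apply: (@bounded_integer_eigenvalue R I A vec lam (q.+1%:R * B)).
- have [g dg gn0] := exists_nonzero_period c1.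
  apply: contrapT => no; move/eqP: gn0; apply; apply/polyP => j; rewrite coef0.
  have [lt|le] := ltnP j n.+1; last first.
    rewrite nth_default // (leq_trans _ le) //.
    by apply: (cocycle_size cocycle_period) => //; exact: det_Sm.
  apply: contrapT => /eqP h; apply: no.
  by exists (residue_class g, Ordinal lt); rewrite /vec /= cong.
- move=> u.
  pose t i := (DD u.1 i).2.
  have ht i : hermite_triple q (t i) by have [_ ? _] := hDD u.1 i.
  have [W hW] := choice (fun i => (hLL (t i) (ht i)).1).
  have [W' hW'] := choice hW.
  have e1 i : [/\ \det (DD u.1 i).1 = 1, 0 < (t i).1.1, 0 < (t i).2 &
      hecke_rep i *m rp u.1 = (DD u.1 i).1 *m mx2 (t i).1.1 (t i).1.2 0 (t i).2].
    by have [h1 [a0 b0 _ _] e] := hDD u.1 i; split.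
  have e2 i : [/\ \det (W i) = 1, 0 < (W' i).1.1, 0 < (W' i).2 &
      mx2 (t i).1.1 (t i).1.2 0 (t i).2 *m Sm = W i *m mx2 (W' i).1.1 (W' i).1.2 0 (W' i).2].
    by have [h1 h2 h3 h4 _] := hW' i; split.
  have := hecke_period q0 hecke_f (det_rp u.1) e1 e2.
  move=> /(congr1 (fun p : {poly C} => p`_u.2)); rewrite coefZ -/(vec u) => ->.
  rewrite coef_sum.
  have term i : (pslash n (mx2 (W' i).1.1 (W' i).1.2 0 (W' i).2) (period (DD u.1 i).1 (W i)))`_u.2 =
    \sum_(v : I) (\sum_(w <- LL (t i)) (if residue_class ((DD u.1 i).1 *m w.1) == v.1
        then ent w v.2 u.2 else 0))%:~R * vec v.
    have [_ _ _ _ [hdet hP]] := hW' i; have [h1 _ _] := hDD u.1 i.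
    rewrite -/(upper (W' i)) (hP _ cocycle_period _ h1) coef_sum.
    transitivity (\sum_(w <- LL (t i)) \sum_(v : I) (if residue_class ((DD u.1 i).1 *m w.1) == v.1
        then ent w v.2 u.2 else 0)%:~R * vec v).
      apply: eq_big_seq => w /hdet dw; rewrite coef_pslash.
      rewrite -(pair_bigA _ (fun x (l : 'I_n.+1) => (if residue_class ((DD u.1 i).1 *m w.1) == x
        then ent w l u.2 else 0)%:~R * vec (x, l))) /=.
      rewrite (bigD1 (residue_class ((DD u.1 i).1 *m w.1))) //= [X in _ + X]big1 ?addr0; last first.
        by move=> x /negbTE h; apply: big1 => l _; rewrite eq_sym h mul0r.
      apply: eq_bigr => l _; rewrite eqxx mulrC /vec /= cong //.
      by rewrite det_mulmx h1 dw.
    rewrite exchange_big /=; apply: eq_bigr => v _.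
    by rewrite rmorph_sum mulr_suml.
  rewrite (eq_bigr _ (fun i _ => term i)) exchange_big /=; apply: eq_bigr => v _.
  by rewrite /A rmorph_sum mulr_suml.
- move=> u.
  apply: le_trans (_ : \sum_(v : I) \sum_(i < q.+1) \sum_(w <- LL (DD u.1 i).2)
     (if residue_class ((DD u.1 i).1 *m w.1) == v.1 then `|(ent w v.2 u.2)%:~R| else 0 : R) <= _).
    apply: ler_sum => v _; rewrite /A rmorph_sum; apply: le_trans (ler_norm_sum _ _ _) _.
    apply: ler_sum => i _; rewrite rmorph_sum; apply: le_trans (ler_norm_sum _ _ _) _.
    by apply: ler_sum => w _; case: eqP; rewrite ?rmorph0 ?normr0.
  rewrite exchange_big /=.
  have -> : q.+1%:R * B = \sum_(i < q.+1) B by rewrite sumr_const card_ord mulr_natl.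
  apply: ler_sum => i _; rewrite exchange_big /=.
  have [_ ht _] := hDD u.1 i.
  apply: le_trans ((hLL _ ht).2 u.2 (ltn_ord _)); rewrite /word_norm.
  apply: ler_sum => w _.
  rewrite -(pair_bigA _ (fun x (l : 'I_n.+1) => (if residue_class ((DD u.1 i).1 *m w.1) == x
        then `|(ent w l u.2)%:~R| else 0))) /=.
  rewrite (bigD1 (residue_class ((DD u.1 i).1 *m w.1))) //= [X in _ + X]big1 ?addr0; last first.
    by move=> x /negbTE h; apply: big1 => l _; rewrite eq_sym h.
  by rewrite eqxx.
Qed.

End HeckeEigenvalue.
End PeriodSystem.

(** * Congruences and degrees *)

Section NormArgument.
Variable R : realType.
Local Notation C := R[i].

Lemma map_ratr_intr (p : {poly int}) :
  map_poly (@ratr C) (map_poly intr p) = map_poly intr p.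
Proof.
rewrite -map_poly_comp; apply: eq_map_poly => m.
have -> : (ratr \o intr) m = ratr (m%:~R : rat) :> C by [].
by rewrite rmorph_int.
Qed.

(** The minimal polynomial over the rationals divides [chi], so it has integer
    coefficients and its complex roots are among those of [chi]. *)
Lemma exists_integral_minpoly (alpha : C) (chi : {poly int}) : chi \is monic ->
  root (map_poly intr chi) alpha ->
  exists D : {poly int}, [/\ D \is monic, root (map_poly intr D) alpha,
    (map_poly intr D : {poly C}) %| map_poly intr chi &
    forall p : {poly rat}, root (map_poly (@ratr C) p) alpha ->
      (size p < size D)%N -> p = 0].
Proof.
move=> cmon rchi.
pose Q m := `[< exists p : {poly rat}, [/\ p != 0, root (map_poly (@ratr C) p) alpha & size p = m] >].
have exQ : exists m, Q m.
  exists (size (map_poly (intr : int -> rat) chi)); apply/asboolP; exists (map_poly intr chi).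
  split=> //; last by rewrite map_ratr_intr.
  by rewrite -size_poly_gt0 size_map_poly_id0 ?intr_eq0 ?lead_coef_eq0 ?monic_neq0 //
     size_poly_gt0 monic_neq0.
case: (ex_minnP exQ) => m /asboolP [p [pn0 rp sp]] pmin.
pose mu := (lead_coef p)^-1 *: p.
have lp : lead_coef p != 0 by rewrite lead_coef_eq0.
have mmon : mu \is monic by rewrite monicE lead_coefZ mulVf.
have rmu : root (map_poly (@ratr C) mu) alpha.
  by rewrite /mu linearZ /= rootE hornerZ (rootP rp) mulr0.
have smu : size mu = m by rewrite /mu size_scale ?invr_eq0.
have min' (p' : {poly rat}) : root (map_poly (@ratr C) p') alpha -> (size p' < m)%N -> p' = 0.
  move=> rp' lt; apply/eqP; apply: contraT => n0.
  have : (m <= size p')%N by apply: pmin; apply/asboolP; exists p'.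
  by rewrite leqNgt lt.
have dv : mu %| map_poly intr chi.
  apply/eqP; apply: min'; last by rewrite -smu ltn_modp monic_neq0.
  have := rchi; rewrite -map_ratr_intr {1}(divp_eq (map_poly intr chi) mu).
  by rewrite rmorphD rmorphM /root hornerD hornerM (rootP rmu) mulr0 add0r.
have [D Dmon eD] := monic_rat_dvd_int mmon cmon dv.
have eD' : map_poly intr D = map_poly (@ratr C) mu by rewrite eD map_ratr_intr.
exists D; split=> //.
- by rewrite eD'.
- by rewrite eD' -map_ratr_intr dvdp_map.
have -> : size D = m.
  rewrite -smu eD size_map_poly_id0 // intr_eq0 lead_coef_eq0; exact: monic_neq0.
exact: min'.
Qed.

Lemma subfieldM (K : set C) x y : is_subfield K -> K x -> K y -> K (x * y).
Proof.
move=> [h1 _ hd] kx ky; have := hd _ _ kx (hd _ _ h1 ky).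
by rewrite div1r invrK.
Qed.

Lemma degree_lower_bound (K : set C) (alpha : C) (d : nat) : is_subfield K -> K alpha ->
  (forall p : {poly rat}, root (map_poly (@ratr C) p) alpha -> (size p <= d)%N -> p = 0) ->
  (d%:R%:E <= degree_over_Q K)%E.
Proof.
move=> sK Ka hp; apply: ereal_sup_ubound; exists d => //=.
exists (fun i => alpha ^+ i); split=> [i|c hc].
  elim: (i : nat) => [|j IH]; first by rewrite expr0; case: sK.
  by rewrite exprS; exact: subfieldM.
have := hp (\poly_(i < d) (if insub i is Some i' then c i' else 0)).
move=> h i; have {}h := h _ (size_poly _ _).
have r0 : root (map_poly (@ratr C) (\poly_(i < d) (if insub i is Some i' then c i' else 0))) alpha.
  rewrite /root (_ : map_poly _ _ = \poly_(i < d) ratr (if insub i is Some i' then c i' else 0)).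
    rewrite horner_poly -[X in _ == X]hc; apply/eqP; apply: eq_bigr => j _.
    by rewrite valK.
  by apply/polyP => j; rewrite coef_map !coef_poly; case: ifP => // _; exact: (rmorph0 (@ratr C : {rmorphism rat -> C})).
have := congr1 (fun p : {poly rat} => p`_i) (h r0).
by rewrite coef_poly ltn_ord valK coef0.
Qed.

Lemma conjugate_bound (D chi : {poly int}) (B : R) (m : nat) : D \is monic ->
  (map_poly intr D : {poly C}) %| map_poly intr chi ->
  (forall mu : C, root (map_poly intr chi) mu -> nm mu <= B) ->
  `|D.[m%:R]|%:~R <= (m%:R + B) ^+ (size D).-1 :> R.
Proof.
move=> Dmon dv hB.
have [r er] := closed_field_poly_normal (map_poly intr D : {poly C}).
have lD : lead_coef (map_poly intr D : {poly C}) = 1.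
  by rewrite lead_coef_map_inj ?rmorph0 ?(monicP Dmon) //; exact: intr_inj.
rewrite lD scale1r in er.
have sD : size (map_poly intr D : {poly C}) = size D.
  by rewrite size_map_poly_id0 // (monicP Dmon) oner_eq0.
have sr : size r = (size D).-1 by rewrite -sD er size_prod_XsubC.
have -> : `|D.[m%:R]|%:~R = nm (map_poly intr D).[m%:R : C] :> R.
  have -> : (m%:R : C) = (m%:R : int)%:~R by rewrite rmorph_nat.
  by rewrite horner_map /= intC nm_real intr_norm.
rewrite er horner_prod -sr.
have hr x : x \in r -> nm x <= B.
  by move=> xr; apply: hB; rewrite -dvdp_XsubCl (dvdp_trans _ dv) // dvdp_XsubCl er root_prod_XsubC.
elim: r hr {er sr} => [|x r IH] hr; first by rewrite big_nil nm1 expr0.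
rewrite big_cons nmM exprS hornerXsubC; apply: ler_pM; rewrite ?nm_ge0 //.
  apply: le_trans (nmB _ _) _; rewrite nm_nat lerD2l; apply: hr; exact: mem_head.
by apply: IH => y yr; apply: hr; rewrite inE yr orbT.
Qed.

(** The norm of [a - m] is, up to sign, the value at [m] of the minimal polynomial
    [D] of [a]. It is divisible by [l], since [w] maps [D(a) = 0] to [D(m)], and nonzero
    by minimality of [D], since [a] is not [m]. *)
Lemma degree_of_congruence (l : nat) (w : place R l) (a : Zbar R) (m : nat)
    (K : set C) (chi : {poly int}) (B : R) :
  is_subfield K -> K (Qbar_val a) -> w a = m%:R -> Qbar_val a != m%:R ->
  chi \is monic -> root (map_poly intr chi) (Qbar_val a) ->
  (forall mu : C, root (map_poly intr chi) mu -> nm mu <= B) ->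
  exists2 d : nat, (d%:R%:E <= degree_over_Q K)%E & l%:R <= (m%:R + B) ^+ d :> R.
Proof.
move=> sK Ka wa neq cmon rchi hB.
have [D [Dmon rD dv Dmin]] := exists_integral_minpoly cmon rchi.
have sD0 : (0 < size D)%N by rewrite size_poly_gt0 monic_neq0.
exists (size D).-1.
  apply: (degree_lower_bound sK Ka) => p rp sp; apply: Dmin rp _.
  by rewrite (leq_ltn_trans sp) // prednK.
apply: le_trans (conjugate_bound m Dmon dv hB).
have Dm0 : D.[m%:R] != 0.
  apply/eqP => D0; have /factor_theorem [E eE] : root D m%:R by apply/rootP.
  have En0 : E != 0.
    by apply: contraTneq Dmon => E0; rewrite eE E0 mul0r monicE lead_coef0 eq_sym oner_eq0.
  have sE : size D = (size E).+1.
    by rewrite eE size_mul ?polyXsubC_eq0 // size_XsubC addn2.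
  have : map_poly intr E = 0 :> {poly rat}.
    apply: Dmin; last by rewrite sE size_map_poly_id0 // intr_eq0 lead_coef_eq0.
    move: rD; rewrite map_ratr_intr eE rmorphM rootM => /orP[//|].
    rewrite rmorphB /= map_polyX map_polyC /= root_XsubC => /eqP e.
    by move: neq; rewrite e rmorph_nat eqxx.
  move/eqP; rewrite map_poly_eq0_id0 ?intr_eq0 ?lead_coef_eq0 // => /eqP e.
  by rewrite e eqxx in En0.
have ldiv : (l %| absz D.[m%:R])%N.
  have Da : (map_poly intr D).[a] = 0 :> Zbar R.
    apply: val_inj; apply: val_inj => /=.
    pose v : {rmorphism Zbar R -> Qbar R} := \val.
    pose v' : {rmorphism Qbar R -> C} := \val.
    have e1 : v' (v (map_poly intr D).[a]) = (map_poly intr D).[v' (v a)].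
      rewrite -[v' (v _)]/((v' \o v) _) -horner_map; congr (_.[_]).
      rewrite -map_poly_comp; apply: eq_map_poly => x.
      by have -> : ((v' \o v) \o intr) x = v' (v x%:~R) by []; rewrite !rmorph_int.
    have -> : Qbar_val (Zbar_val (map_poly intr D).[a]) = v' (v (map_poly intr D).[a]) by [].
    rewrite e1 (rootP rD); have -> : 0 = v' (v 0) by rewrite !rmorph0.
    by [].
  have := congr1 w Da; rewrite -horner_map -map_poly_comp.
  rewrite (eq_map_poly (g := intr)); last by move=> x /=; rewrite rmorph_int.
  rewrite wa rmorph0.
  have -> : (m%:R : residue w) = (m%:R : int)%:~R by rewrite rmorph_nat.
  rewrite horner_map /= => /eqP e0.
  rewrite (dvdn_pcharf (residue_char w)).
  move: e0; case: (D.[_]) => x; first by [].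
  by rewrite NegzE mulrNz oppr_eq0.
have := dvdn_leq _ ldiv; rewrite absz_gt0 Dm0 => /(_ isT) le.
by rewrite -abszE -pmulrn ler_nat.
Qed.

End NormArgument.

(** * The levels *)

Section Levels.

Lemma prime_dvd_prod_primes (p : nat) (ps : seq nat) : prime p -> all prime ps ->
  (p %| \prod_(x <- ps) x)%N -> p \in ps.
Proof.
move=> pp; elim: ps => [|x ps IH] /=; first by rewrite big_nil dvdn1 => _ /eqP p1; rewrite p1 in pp.
move=> /andP[px hps]; rewrite big_cons Euclid_dvdM // inE => /orP[|/IH -> //].
  by rewrite dvdn_prime2 // => ->.
by rewrite orbT.
Qed.

Lemma squarefree_prod_primes (ps : seq nat) : uniq ps -> all prime ps ->
  squarefree (\prod_(x <- ps) x).
Proof.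
move=> ups hps p pp; apply/negP => dv.
have pps : p \in ps.
  by apply: prime_dvd_prod_primes => //; apply: dvdn_trans dv; rewrite expnS dvdn_mulr.
move: dv; rewrite (big_rem p pps) /= expnS expn1 dvdn_pmul2l ?prime_gt0 // => dv.
have := prime_dvd_prod_primes pp _ dv.
rewrite mem_rem_uniqF // => h; apply: notF; apply: h.
by apply/allP => x /mem_rem; exact: (allP hps).
Qed.

Lemma dvdn_big_gcdn (ps : seq nat) p : p \in ps ->
  (\big[gcdn/0%N]_(x <- ps) x.-1 %| p.-1)%N.
Proof.
elim: ps => // x ps IH; rewrite inE big_cons => /orP[/eqP ->|/IH h].
  exact: dvdn_gcdl.
exact: dvdn_trans (dvdn_gcdr _ _) h.
Qed.

Variable R : realType.

(** That [l] exceeds the [2r]-th root of [N] gives both [l > m] and the logarithmic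
    estimate. *)
Lemma Nset_prime (r N m : nat) : (0 < r)%N -> (0 < m)%N -> (m ^ (2 * r) <= N)%N -> Nset R r N ->
  exists (ps : seq nat) (l : nat), [/\ [/\ size ps = r, uniq ps, all prime ps & N = (\prod_(p <- ps) p)%N],
    prime l, (m < l)%N, forall p, p \in ps -> (l %| p.-1)%N &
    ln (N%:R : R) <= (2 * r)%:R * ln (l%:R : R)].
Proof.
move=> r0 m0 mN [ps [sps ups pps eN hl]].
set G := \big[gcdn/0%N]_(p <- ps) p.-1 in hl.
have r20 : (0 < 2 * r)%N by rewrite muln_gt0.
have r2R : 0 < (2 * r)%:R :> R by rewrite ltr0n.
have N0 : (0 < N)%N by apply: leq_trans mN; rewrite expn_gt0 m0.
have NR : 0 < N%:R :> R by rewrite ltr0n.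
have ml : (m < max_pdiv G)%N.
  rewrite -(ltr_nat R); apply: le_lt_trans hl.
  have -> : m%:R = ((m ^ (2 * r))%:R : R) `^ ((2 * r)%:R)^-1.
    rewrite natrX -powR_mulrn // -powRrM mulfV ?powRr1 //; exact: lt0r_neq0.
  by apply: ge0_ler_powR; rewrite ?nnegrE ?invr_ge0 ?ler_nat.
have G1 : (1 < G)%N.
  move: ml; case: (G) => [|[|g]] //; rewrite /max_pdiv /= ltnNge => /negP; by case.
exists ps, (max_pdiv G); split => //.
- exact: max_pdiv_prime.
- by move=> p hp; apply: dvdn_trans (max_pdiv_dvd _) (dvdn_big_gcdn hp).
have l0 : 0 < (max_pdiv G)%:R :> R by rewrite ltr0n max_pdiv_gt0.
have : ln ((N%:R : R) `^ ((2 * r)%:R)^-1) <= ln (max_pdiv G)%:R.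
  by rewrite ler_ln ?posrE ?powR_gt0 // ltW.
by rewrite ln_powR ler_pdivrMl.
Qed.

End Levels.

(** * Degrees of the coefficient fields *)

Section NewformEigenvalue.
Variable R : realType.
Local Notation C := R[i].
Local Notation H := (@upper_half R).

Lemma qser_neq0 (c : nat -> C) : tame c -> c 1%N = 1 -> exists2 z, H z & qser c z != 0.
Proof.
move=> ct c1; apply: contrapT => no.
have z0 z : H z -> qser c z = 0.
  by move=> hz; apply/eqP; apply: contrapT => /negP h; apply: no; exists z.
by have := qser_eq0 ct z0 1; rewrite c1 => /eqP; rewrite oner_eq0.
Qed.

(** Compare both transformation laws for a matrix of [Gamma0 N] with lower right entry
    [q], at a point where [f] does not vanish. *)
Lemma nebentypus_trivial (N k q : nat) (chi : int -> Zbar R) (f : C -> C) z0 :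
  (forall g, Gamma0 N g -> forall z, H z -> slash k g f z = f z) ->
  nebentypus N k chi f -> coprime q N -> H z0 -> f z0 != 0 -> chi q = 1.
Proof.
move=> fG [_ hneb] cop hz0 fz0.
have [u [v uv]] := Bezoutz q N.
pose g := mx2 u (- v) N q.
have dg : \det g = 1.
  rewrite det_mx2 mulNr opprK uv /gcdz /=.
  by move: cop; rewrite /coprime => /eqP ->.
have gG : Gamma0 N g by split=> //; rewrite !mxE /= dvdzz.
have := hneb g gG z0 hz0; rewrite (fG g gG z0 hz0) !mxE /= => e.
apply: val_inj; apply: val_inj => /=.
have : Qbar_val (Zbar_val (chi q)) * f z0 = 1 * f z0 by rewrite -e mul1r.
by move/(mulIf fz0).
Qed.

Lemma vanishes_vanish (u : C -> C) : vanishes_at_infty u -> vanish u.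
Proof.
move=> h eps eps0; have [Y hY] := h eps eps0; exists Y => z hz Yz.
by have := hY z hz Yz; rewrite nm_normr ltcR => /ltW.
Qed.

(** The constant [A] is [1 + q^(n+1)] plus a bound, independent of [N] and [l], for
    all the conjugates of the eigenvalue at [q]; [degree_of_congruence] applies to this
    eigenvalue, congruent to [1 + q^(n+1)] by way of a Frobenius element. *)
Lemma newform_degree (n q : nat) : (1 < n)%N -> prime q -> exists2 A : R, 1 < A &
  forall (N l : nat) (w : place R l) (v : place R q) (f : C -> C),
    prime l -> (0 < N)%N -> coprime N q -> q != l -> newform N n.+2 f ->
    arises_from N n.+2 (@one_plus_cyclotomic R (residue w) l n.+1) f ->
    exists2 d : nat, (d%:R%:E <= dnew R n.+2 N)%E & l%:R <= A ^+ d.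
Proof.
move=> n2 pq; have q1 := prime_gt1 pq; have q0 := prime_gt0 pq.
have [B [LL hLL]] := exists_hecke_words R n q.
pose m0 := (1 + q ^ n.+1)%N.
exists (m0%:R + `|q.+1%:R * B|).
  apply: lt_le_trans (_ : m0%:R <= _); last by rewrite lerDl.
  by rewrite ltr1n /m0 add1n ltnS expn_gt0 q0.
move=> N l w v f pl N0 cop neq [a hnew] [_ [chi [ev [rho [hneb hev hrep hiso]]]]].
have [[[_ fG fcusp] _] _ hq a1] := hnew.
have [ct fE] := q_expansion_qser hq.
have c1 : coefs0 a 1%N = 1 by [].
have [z0 hz0] := qser_neq0 ct c1; rewrite -fE // => fz0.
have ndvd : ~~ (q %| N)%N by rewrite -prime_coprime // coprime_sym.
have copq : coprime q N by rewrite coprime_sym.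
have chi1 := nebentypus_trivial fG hneb copq hz0 fz0.
pose lam : C := Qbar_val (Zbar_val (ev q)).
have hecke_f z : H z -> hecke n.+2 1 q f z = lam * f z.
  by move=> hz; have := hev q pq ndvd z hz; rewrite chi1.
have fV g : \det g = 1 -> vanish (slash n.+2 g f).
  by move=> dg; apply: vanishes_vanish; apply: fcusp.
have n0 : (0 < n)%N by exact: ltnW.
have lamE : lam = a q.
  have := eigenvalue_coef ct fE q1 hecke_f c1; case: (q) q0 => //.
have lam_neq : lam != 1 + q%:R ^+ n.+1.
  exact: (eigenvalue_not_eisenstein n0 N0 fG fV ct erefl fE n2 q1 hecke_f c1).
have [X Xmon [rX hX]] :=
  eigenvalue_integer_polynomial n0 N0 fG fV ct erefl fE q1 hecke_f c1 hLL.
have wa : w (ev q) = m0%:R.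
  rewrite (eigenvalue_congruence v pl pq _ hrep hiso) ?natrD ?natrX //.
  by rewrite Euclid_dvdM // negb_or ndvd dvdn_prime2.
have sK : is_subfield (coef_field N a).
  split.
  - by move=> K [[]].
  - by move=> x y hx hy K hK; case: (hK) => -[_ hB _] _; apply: hB; [apply: hx | apply: hy].
  - by move=> x y hx hy K hK; case: (hK) => -[_ _ hD] _; apply: hD; [apply: hx | apply: hy].
have Klam : coef_field N a lam.
  by move=> K [_ hK]; apply: hK; exists q => //=; rewrite q0.
have neq0 : lam != m0%:R by rewrite /m0 natrD natrX.
have [d hd ld] := degree_of_congruence sK Klam wa neq0 Xmon rX
  (fun mu h => le_trans (hX mu h) (ler_norm _)).
exists d => //; apply: le_trans hd _.
by apply: ereal_sup_ubound; exists f, a.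
Qed.

End NewformEigenvalue.

Theorem theorem4p2 (R : realType)
    (w : forall l : nat, prime l -> place R l)
    (HC : conjectureC w) (q : nat) (hq : prime q) (k : nat)
    (k_even : ~~ odd k) (k_ge4 : (4 <= k)%N) :
  exists c : R, 0 < c /\
    forall r : nat, (2 <= r)%N ->
    exists N0 : nat, forall N : nat, (N0 <= N)%N ->
      Nset R r N -> coprime N q ->
      ((c / r%:R * ln N%:R)%:E <= dnew R k N)%E.
Proof.
have [n ek n2] : exists2 n, k = n.+2 & (1 < n)%N.
  by case: (k) k_ge4 => [|[|n]] // h; exists n.
have [A A1 hA] := @newform_degree R n q n2 hq.
have lnA : 0 < ln A by rewrite ln_gt0.
(* ln N <= 2 r ln l and ln l <= d ln A *)
exists (2 * ln A)^-1; split; first by rewrite invr_gt0 mulr_gt0.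
move=> r r2; have r0 : (0 < r)%N by exact: ltnW.
(* Large enough for l > k + 1, as the conjecture demands, and for l > q. *)
exists (maxn k.+1 q ^ (2 * r))%N => N leN hN cop.
have m0 : (0 < maxn k.+1 q)%N by rewrite leq_max.
have [ps [l [[sps ups pps eN] pl ml hdiv hln]]] := Nset_prime r0 m0 leN hN.
have [kl ql] : (k.+1 < l)%N /\ (q < l)%N.
  by move: ml; rewrite gtn_max => /andP[].
have N0 : (0 < N)%N.
  rewrite eN; elim: (ps) pps => [|p ps' IH] /=; first by rewrite big_nil.
  by move=> /andP[pp /IH h]; rewrite big_cons muln_gt0 prime_gt0.
have sqf : squarefree N by rewrite eN; exact: squarefree_prod_primes.
have cong1 p : p \in ps -> p = 1 %[mod l].
  move=> hp; have pp := allP pps _ hp; apply/eqP.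
  by rewrite eqn_mod_dvd ?prime_gt0 // subn1 hdiv.
have inN p : prime p -> (p %| N)%N -> p \in ps.
  by move=> pp; rewrite eN; apply: prime_dvd_prod_primes.
have lN : ~~ (l %| N)%N.
  apply/negP => /(inN l pl) /cong1 /eqP; rewrite modnn.
  by rewrite modn_small ?(prime_gt1 pl).
have congk p : p \in ps -> p ^ k = 1 %[mod l].
  by move=> /cong1 e; rewrite -modnXm e modnXm exp1n.
have [|f fnew farises] := (HC k l N pl k_even k_ge4 kl N0 sqf lN).2.
  left; split.
    move=> p pp pN; apply: dvdn_mulr.
    by rewrite -eqn_mod_dvd ?expn_gt0 ?prime_gt0 //; apply/eqP/congk/inN.
  case: (ps) sps r2 inN congk pps eN => [|p0 ps'] sps r2' inN congk pps' eN'.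
    by rewrite -sps in r2'.
  exists p0; split.
  - by case/andP: pps'.
  - by rewrite eN' big_cons dvdn_mulr.
  - by apply: congk; exact: mem_head.
rewrite ek /= in fnew farises.
have [|d hd ld] := hA N l (w l pl) (w q hq) f pl N0 cop _ fnew farises.
  by rewrite ltn_eqF.
rewrite ek; apply: le_trans hd; rewrite lee_fin.
have rR : 0 < r%:R :> R by rewrite ltr0n.
have A0 : 0 < A by exact: lt_trans A1.
have l0 : 0 < l%:R :> R by rewrite ltr0n prime_gt0.
have ll : ln (l%:R : R) <= d%:R * ln A.
  by rewrite mulr_natl -lnXn // ler_ln ?posrE ?exprn_gt0.
rewrite -mulrA ler_pdivrMl ?mulr_gt0 // ler_pdivrMl //.
apply: le_trans hln _; rewrite natrM.
have -> : r%:R * (2 * ln A * d%:R) = 2 * r%:R * (d%:R * ln A) by ring.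
by rewrite ler_wpM2l // mulr_ge0 // ltW.
Qed.
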